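(* Let $k\ge1$, $0<\gamma\le1$, and let $P_0$ be a probability measure on $\mathbb{R}^k$ with $P_0(H)<\gamma$ for every (affine) hyperplane $H\subset\mathbb{R}^k$. Suppose that the MCD functional $(T_0(\phi_0),C_0(\phi_0))$ is uniquely defined at $P_0$. Let $X_1,X_2,\ldots$ be i.i.d. with distribution $P_0$, and for $n\ge1$ let $S_n$ be a minimizing subsample for the MCD estimator based on $X_1,\ldots,X_n$. Then: (i) $(\widehat T_n(S_n),\widehat C_n(S_n))\to(T_0(\phi_0),C_0(\phi_0))$ with probability one. If in addition $P_0\big(E(T_0(\phi_0),C_0(\phi_0),r_0(\phi_0)+\varepsilon)\big)>\gamma$ for all $\varepsilon>0$, then: (ii) $\widehat r_n(S_n)\to r_0(\phi_0)$ with probability one.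
   Context: MCD functional. Let $K_0(\gamma)$ be the set of measurable $\phi:\mathbb{R}^k\to[0,1]$ with $\int\phi\,dP_0\ge\gamma$ and $\int\|x\|^2\phi(x)\,P_0(dx)<\infty$. For $\phi\in K_0(\gamma)$ define $$T_0(\phi)=\frac{1}{\int\phi\,dP_0}\int x\,\phi(x)\,P_0(dx),\qquad C_0(\phi)=\frac{1}{\int\phi\,dP_0}\int (x-T_0(\phi))(x-T_0(\phi))'\phi(x)\,P_0(dx).$$ If $\phi_0$ minimizes $\det(C_0(\phi))$ over $K_0(\gamma)$, the pair $(T_0(\phi_0),C_0(\phi_0))$ is called an MCD functional at $P_0$; it is uniquely defined if a minimizer exists and all minimizers give the same pair. For $\mu\in\mathbb{R}^k$, $\Sigma$ symmetric positive definite, $\rho>0$, $E(\mu,\Sigma,\rho)=\{x:(x-\mu)'\Sigma^{-1}(x-\mu)\le\rho^2\}$, and $r_0(\phi_0)=\inf\{s>0:P_0(E(T_0(\phi_0),C_0(\phi_0),s))\ge\gamma\}$. MCD estimator. For a subsample $S$ of $\{X_1,\ldots,X_n\}$ with $h_n\ge\lceil n\gamma\rceil$ points (counted by index), put $\widehat T_n(S)=\frac1{h_n}\sum_{X_i\in S}X_i$ and $\widehat C_n(S)=\frac1{h_n}\sum_{X_i\in S}(X_i-\widehat T_n(S))(X_i-\widehat T_n(S))'$. A minimizing subsample $S_n$ is one that minimizes $\det(\widehat C_n(S))$ over all subsamples with at least $\lceil n\gamma\rceil$ points. With $P_n$ the empirical measure of $X_1,\ldots,X_n$, $\widehat r_n(S_n)=\inf\{s>0:P_n(E(\widehat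 T_n(S_n),\widehat C_n(S_n),s))\ge\gamma\}$ (defined when $\widehat C_n(S_n)$ is nonsingular, which under the hyperplane condition holds for all large $n$ with probability one). *)

(* Defs.v *)
From HB Require Import structures.
From mathcomp Require Import all_boot all_order all_algebra.
From mathcomp Require Import finmap.
From mathcomp Require Import all_classical all_reals all_analysis.

Set Implicit Arguments.
Unset Strict Implicit.
Unset Printing Implicit Defensive.

Import Order.TTheory GRing.Theory Num.Theory.
Import numFieldNormedType.Exports.

Local Open Scope classical_set_scope.
Local Open Scope ring_scope.

(* The library puts no sigma-algebra on matrices: equip them, hence the column
   vectors of R^k, with the Borel sigma-algebra of their topology. *)
Section borel_matrix.
Context (R : realType) (m n : nat).

Let borel : set (set 'M[R]_(m, n)) := <<s @open 'M[R]_(m, n) >>.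

Let borel0 : borel set0.
Proof. exact: sigma_algebra0. Qed.

Let borelC A : borel A -> borel (~` A).
Proof. by move=> bA; rewrite -setTD; exact: sigma_algebraCD. Qed.

Let borel_bigcup (F : (set 'M[R]_(m, n))^nat) :
  (forall i, borel (F i)) -> borel (\bigcup_i F i).
Proof. exact: sigma_algebra_bigcup. Qed.

HB.instance Definition _ := @isMeasurable.Build
  (sigma_display (@open 'M[R]_(m, n))) 'M[R]_(m, n) borel
  borel0 borelC borel_bigcup.

End borel_matrix.

Definition mutually_independent (d d' : measure_display)
    (Omega : measurableType d) (T : measurableType d') (R : realType)
    (P : probability Omega R) (X : nat -> Omega -> T) : Prop :=
  forall (J : {fset nat}) (B : nat -> set T),
    (forall i, measurable (B i)) ->
    P (\bigcap_(i in [set` J]) X i @^-1` B i) =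
    (\prod_(i <- J) P (X i @^-1` B i))%E.

Section mcd.
Context (R : realType) (k : nat).
Implicit Types (x mu a : 'cV[R]_k) (Sigma : 'M[R]_k) (gamma rho : R).

(* Euclidean; the library norm on matrices is the sup norm. *)
Definition sqnorm x : R := \sum_i x i 0 ^+ 2.

Definition hyperplane (H : set 'cV[R]_k) : Prop :=
  exists a b, a != 0 /\ H = [set x | \sum_i a i 0 * x i 0 = b].

Definition ellipsoid mu Sigma rho : set 'cV[R]_k :=
  [set x | ((x - mu)^T *m invmx Sigma *m (x - mu)) 0 0 <= rho ^+ 2].

(* [inf set0] is 0 instead of +oo. For P a probability and gamma <= 1 the set can
   be empty only if gamma = 1 and no ellipsoid around mu has full mass. *)
Definition mcd_radius gamma (P : set 'cV[R]_k -> \bar R) mu Sigma : R :=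
  inf [set s | 0 < s /\ (gamma%:E <= P (ellipsoid mu Sigma s))%E].

Section functional.
Variable P0 : probability 'cV[R]_k R.
Implicit Type phi : 'cV[R]_k -> R.

Definition mcd_class gamma phi : Prop :=
  [/\ measurable_fun setT phi,
      forall x, 0 <= phi x <= 1,
      (gamma%:E <= \int[P0]_x (phi x)%:E)%E &
      (\int[P0]_x (sqnorm x * phi x)%:E < +oo)%E ].

Definition mcd_loc phi : 'cV[R]_k :=
  (Rintegral P0 setT phi)^-1 *:
    \col_i Rintegral P0 setT (fun x => x i 0 * phi x).

Definition mcd_cov phi : 'M[R]_k :=
  let T := mcd_loc phi in
  (Rintegral P0 setT phi)^-1 *:
    \matrix_(i, j) Rintegral P0 setT
      (fun x => ((x - T) *m (x - T)^T) i j * phi x).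

Definition mcd_minimizer gamma phi : Prop :=
  mcd_class gamma phi /\
  forall psi, mcd_class gamma psi -> \det (mcd_cov phi) <= \det (mcd_cov psi).

Definition mcd_functional gamma (TC : 'cV[R]_k * 'M[R]_k) : Prop :=
  exists2 phi, mcd_minimizer gamma phi & TC = (mcd_loc phi, mcd_cov phi).

Definition mcd_uniquely_defined gamma : Prop :=
  exists! TC, mcd_functional gamma TC.

Definition mcd_functional_radius gamma phi : R :=
  mcd_radius gamma P0 (mcd_loc phi) (mcd_cov phi).

End functional.

Section estimator.
(* The sample of size n consists of X 0, ..., X n.-1; a subsample is the set of
   the indices of its points, so that ties in the data are counted apart. *)
Variables (X : nat -> 'cV[R]_k) (n : nat).
Implicit Type S : {set 'I_n}.

Definition mean_hat S : 'cV[R]_k := #|S|%:R^-1 *: \sum_(i in S) X i.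

Definition cov_hat S : 'M[R]_k :=
  let T := mean_hat S in
  #|S|%:R^-1 *: \sum_(i in S) (X i - T) *m (X i - T)^T.

Definition subsample gamma S : Prop := Num.ceil (n%:R * gamma) <= #|S|%:Z.

Definition minimizing_subsample gamma S : Prop :=
  subsample gamma S /\
  forall S', subsample gamma S' -> \det (cov_hat S) <= \det (cov_hat S').

Definition empirical_measure : set 'cV[R]_k -> \bar R :=
  mscale (n%:R^-1)%:nng (msum (fun i => \d_(X i)) n).

(* Junk value if [cov_hat S] is singular, when the radius is left undefined. *)
Definition radius_hat gamma S : R :=
  mcd_radius gamma empirical_measure (mean_hat S) (cov_hat S).

End estimator.
End mcd.

(* Main.v *)
(* Write a minimizing subsample through the quadratic polynomial
   t_n(x) = (x - T_n)' C_n^-1 (x - T_n), and let t0 be its analogue for (T0, C0). The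
   functions clamp(t), with values cut to [0, 1], obey a law of large numbers that is
   locally uniform in the coefficients of t.

   The hyperplane condition makes C_n uniformly nondegenerate along all large n, so
   that the coefficients of t_n stay in a compact set. Averaging t_n over the
   subsample gives k, hence by trimming at level q the sample average of
   clamp(1 - t_n / q) is at least gamma (1 - k / q). A cluster point t inherits this
   inequality under P0, and trimming t at a quantile produces an admissible phi of mass
   gamma with mean of t at most k. On the other hand, the subsample of the points with
   smallest t0 shows that the determinant of C_n is asymptotically at most that of C0. Now
   det M det C <= 1 whenever tr (M C) <= k, with equality only for C = M^-1 (the
   inequality of arithmetic and geometric means); this makes phi a minimizer and,
   by uniqueness of the functional, forces t = t0. So t_n converges to t0.

   The radius follows from the uniform law, by squeezing the indicators of the
   ellipsoids between clamped quadratic polynomials. *)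

(* P0 need not have any moments, and the subsamples are arbitrary index sets, not assumed measurable
   in the outcome or cut out by ellipsoids. So a subsample is compared by trimming with averages of
   bounded functions over the whole sample. Indicators of ellipsoids are discontinuous in their
   coefficients, while clamped quadratics are Lipschitz in them on bounded sets; laws of large
   numbers for countably many rational coefficients then suffice. The only unbounded average is that
   of t0 weighted by an optimal phi. It has just a first moment, but only an upper bound on it is
   needed, whence the one-sided law for nonnegative functions. Off a single null set everything else
   is about one fixed sequence of points.

   The unknown is C_n^-1 rather than C_n because no upper bound on C_n or T_n is available
   beforehand: the spread of large subsamples bounds C_n from below only. A cluster point of C_n^-1
   might still be singular; the comparison of determinants excludes this. *)
Require Import Defs.
From HB Require Import structures.
From mathcomp Require Import all_boot all_order all_algebra.
From mathcomp Require Import perm finmap.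
From mathcomp Require Import all_classical all_reals all_analysis.
From mathcomp Require Import measurable_realfun.
From mathcomp Require Import ring lra.

Set Implicit Arguments.
Unset Strict Implicit.
Unset Printing Implicit Defensive.

Import Order.TTheory GRing.Theory Num.Theory.
Import numFieldNormedType.Exports.

Local Open Scope classical_set_scope.
Local Open Scope ring_scope.

(** * Quadratic forms and determinants *)

Section quadratic_forms.
Variable R : realType.

Lemma quadratic_ge0_linear0 (b c : R) :
  (forall t, 0 <= 2 * t * b + t ^+ 2 * c) -> b = 0.
Proof.
move=> key; have c0 : 0 <= c by have := key 1; have := key (-1); lra.
have c1 : c + 1 != 0 by rewrite gt_eqF ?ltr_wpDl.
(* The minimizer would be -b / c; adding 1 to the denominator covers c = 0 and still gives a
   negative value unless b = 0. *)
have := key (- b / (c + 1)).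
rewrite (_ : _ + _ = - (b / (c + 1)) ^+ 2 * (c + 2)); last by field.
move=> h; have /eqP : (b / (c + 1)) ^+ 2 = 0.
  by apply/eqP; rewrite eq_le sqr_ge0 andbT; nra.
by rewrite sqrf_eq0 mulf_eq0 invr_eq0 (negPf c1) orbF => /eqP.
Qed.

Definition quad_form n (M : 'M[R]_n) (x : 'cV[R]_n) : R := (x^T *m M *m x) 0 0.

Definition psd n (M : 'M[R]_n) := M^T = M /\ forall x, 0 <= quad_form M x.

Definition pd n (M : 'M[R]_n) := M^T = M /\ forall x, x != 0 -> 0 < quad_form M x.

Lemma quad_formE n (M : 'M[R]_n) x :
  quad_form M x = \sum_i \sum_j M i j * (x i 0 * x j 0).
Proof.
rewrite /quad_form mxE [RHS]exchange_big; apply: eq_bigr => j _ /=.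
by rewrite !mxE mulr_suml; apply: eq_bigr => i _; rewrite !mxE; ring.
Qed.

Lemma quad_formD n (M : 'M[R]_n) x y : M^T = M ->
  quad_form M (x + y) = quad_form M x + 2 * (y^T *m M *m x) 0 0 + quad_form M y.
Proof.
move=> Ms; have xy : x^T *m M *m y = (y^T *m M *m x)^T.
  by rewrite !trmx_mul trmxK Ms mulmxA.
rewrite /quad_form [(x + y)^T]linearD /= !mulmxDl !mulmxDr xy.
move: (x^T *m M *m x) (y^T *m M *m x) (y^T *m M *m y) => a b c.
by rewrite !mxE; ring.
Qed.

Lemma quad_formZ n (M : 'M[R]_n) t x : quad_form M (t *: x) = t ^+ 2 * quad_form M x.
Proof.
by rewrite /quad_form [(t *: x)^T]linearZ /= -!scalemxAl -scalemxAr !mxE mulrA.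
Qed.

Lemma pd_unit n (M : 'M[R]_n) : pd M -> M \in unitmx.
Proof.
case=> Ms Mp; rewrite -row_free_unit -kermx_eq0; apply/eqP/row_matrixP => i.
rewrite row0; apply/eqP; apply: contraT => r0.
have /Mp : (row i (kermx M))^T != 0 by rewrite -trmx0 (inj_eq trmx_inj).
rewrite /quad_form trmxK -row_mul mulmx_ker row0 mul0mx mxE ltxx //.
Qed.

(** At a zero x of the form, nonnegativity along every line x + t e_i kills the linear term in t,
    which is (M x)_i; hence M x = 0. *)
Lemma psd_pd n (M : 'M[R]_n) : psd M -> \det M != 0 -> pd M.
Proof.
case=> Ms Mp dM; split=> // x x0; rewrite lt_def Mp andbT.
apply: contra_neq x0 => qx.
suff Mx : M *m x = 0.
  have uM : M \in unitmx by rewrite unitmxE unitfE.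
  by rewrite -[x](mulKmx uM) Mx mulmx0.
apply/colP => i; rewrite [RHS]mxE.
have key t : 0 <= 2 * t * (M *m x) i 0 + t ^+ 2 * quad_form M (delta_mx i 0).
  have := Mp (x + t *: delta_mx i 0).
  rewrite quad_formD // qx add0r quad_formZ [(t *: _)^T]linearZ /= trmx_delta -!scalemxAl mxE.
  by rewrite -mulmxA -rowE mxE mulrA.
exact: quadratic_ge0_linear0 key.
Qed.

(** Induction on the size: split off the first coordinate and factor the Schur complement of its
    entry. *)
Lemma cholesky n (M : 'M[R]_n) : pd M ->
  exists2 L : 'M[R]_n, is_trig_mx L & M = L *m L^T.
Proof.
elim: n M => [|n IHn] M.
  by exists 0; rewrite ?mx0_is_trig //; apply/matrixP => -[].
rewrite -[n.+1]/(1 + n)%N in M *; rewrite -[M]submxK.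
set a := ulsubmx M; set w := ursubmx M; set v := dlsubmx M; set N := drsubmx M.
case; rewrite tr_block_mx => /eq_block_mx[_ vw _ NN] Mp.
have vE : v = w^T by rewrite -vw trmxK.
have [c aE] : exists c, a = c%:M by exists (a 0 0); exact: mx11_scalar.
have c0 : 0 < c.
  have /Mp : col_mx (1%:M : 'cV_1) (0 : 'cV[R]_n) != 0.
    apply/eqP => /matrixP/(_ (lshift n 0) 0).
    by rewrite col_mxEu !mxE /= => /eqP; rewrite oner_eq0.
  rewrite /quad_form tr_col_mx mul_row_block mul_row_col trmx0 trmx1.
  by rewrite mulmx0 !mul1mx !mul0mx !addr0 mulmx1 aE mxE.
set s := Num.sqrt c.
have s2 : s * s = c by rewrite -expr2 sqr_sqrtr // ltW.
have s0 : s != 0 by rewrite gt_eqF // sqrtr_gt0.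
have Sp : pd (N - c^-1 *: (w^T *m w)).
  split; first by rewrite linearB /= NN linearZ /= trmx_mul trmxK.
  (* For fixed y, this first coordinate minimizes the form of M; the minimum is the form of the
     Schur complement at y. *)
  move=> y y0; set x := - c^-1 *: (w *m y).
  have /Mp : col_mx x y != 0.
    by apply: contra_neq y0 => /(congr1 dsubmx); rewrite col_mxKd linear0.
  rewrite /quad_form tr_col_mx mul_row_block mul_row_col vE aE mul_mx_scalar.
  have xE : x^T = - c^-1 *: (y^T *m w^T) by rewrite linearZ /= trmx_mul.
  rewrite xE scalerA mulrN mulfV ?gt_eqF // scaleN1r addNr mul0mx add0r.
  by rewrite -scalemxAl scaleNr addrC mulmxBr -scalemxAr mulmxA.
have [L Lt LE] := IHn _ Sp.
exists (block_mx s%:M 0 (s^-1 *: w^T) L).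
  by rewrite is_trig_block_mx // eqxx Lt scalar_mx_is_trig.
rewrite tr_block_mx mulmx_block trmx0 mulmx0 addr0 !mul0mx !addr0.
rewrite tr_scalar_mx -scalar_mxM s2 -aE linearZ /= trmxK mul_scalar_mx scalerA.
rewrite mulfV // scale1r mulmx0 addr0 mul_mx_scalar scalerA mulfV // scale1r vE.
congr block_mx; rewrite -scalemxAl -scalemxAr scalerA -LE -invfM s2.
by rewrite addrC subrK.
Qed.

Lemma tr_mulmx_trmx n (L : 'M[R]_n) : \tr (L *m L^T) = \sum_i \sum_j L i j ^+ 2.
Proof.
by apply: eq_bigr => i _; rewrite mxE; apply: eq_bigr => j _; rewrite mxE expr2.
Qed.

(** For B = L L' with L triangular, det B is the product of the L_ii^2 while tr B is the sum of all
    L_ij^2. The arithmetic-geometric inequality for the diagonal gives the bound. Equality makes the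
    L_ii^2 all equal to 1, which exhausts the trace and leaves nothing off the diagonal. *)
Lemma psd_tr_det n (B : 'M[R]_n) : psd B -> \tr B <= n%:R ->
  \det B <= 1 /\ (\det B = 1 -> B = 1%:M).
Proof.
move=> Bp trB; have [d0|d0] := eqVneq (\det B) 0.
  by rewrite d0; split=> // /eqP; rewrite eq_sym oner_eq0.
have [L Lt BE] := cholesky (psd_pd Bp d0).
have detB : \det B = \prod_i L i i ^+ 2.
  by rewrite BE det_mulmx det_tr (det_trig Lt) -big_split; apply: eq_bigr => i _; rewrite expr2.
have diag_le i : L i i ^+ 2 <= \sum_j L i j ^+ 2.
  by rewrite (bigD1 i) //= lerDl sumr_ge0 // => j _; rewrite sqr_ge0.
have sum_le : \sum_i L i i ^+ 2 <= \tr B.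
  by rewrite BE tr_mulmx_trmx ler_sum.
have [n0|n0] := posnP n.
  move: B {Bp trB d0} BE detB sum_le; subst n => B _ _ _; split=> [|_].
    by rewrite det_mx00.
  by apply/matrixP => -[].
have n0' : 0 < n%:R :> R by rewrite ltr0n.
have /leifP := @leif_AGM _ _ predT (fun i => L i i ^+ 2) (fun i _ => sqr_ge0 _).
rewrite cardT size_enum_ord -detB.
set m := (X in X ^+ n).
have mE0 : m = (\sum_i L i i ^+ 2) / n%:R by [].
have m0 : 0 <= m by rewrite mE0 divr_ge0 ?sumr_ge0 // => i _; rewrite sqr_ge0.
have m1 : m <= 1 by rewrite mE0 ler_pdivrMr // mul1r; apply: le_trans trB.
have mn : m ^+ n <= 1 by rewrite exprn_ile1.
case: ifPn => [/forall_inP eqL /eqP detE | _ lt_det]; last first.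
  split; first by rewrite (le_trans (ltW lt_det)).
  by move=> det1; move: (lt_le_trans lt_det mn); rewrite det1 ltxx.
split; rewrite detE // => mn1.
have mE : m = 1 by apply/eqP; rewrite -(@pexpr_eq1 _ _ n) ?mn1.
have sumE : \sum_i L i i ^+ 2 = n%:R.
  by move: mE; rewrite mE0 => /(divr1_eq); rewrite ?gt_eqF.
have Lii i : L i i ^+ 2 = 1.
  apply: (mulfI (lt0r_neq0 n0')); rewrite mulr1 -[RHS]sumE.
  rewrite (eq_bigr (fun=> L i i ^+ 2)) ?sumr_const ?cardT ?size_enum_ord ?mulr_natl // => j _.
  by have /forall_inP/(_ i isT)/eqP := eqL j isT.
have Lij i j : j != i -> L i j = 0.
  move=> ij; apply/eqP; rewrite -sqrf_eq0; apply/eqP.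
  have E : \sum_i (\sum_j L i j ^+ 2 - L i i ^+ 2) = 0.
    apply/eqP; rewrite eq_le sumrB sumE subr_le0 -tr_mulmx_trmx -BE trB.
    by rewrite subr_ge0 BE tr_mulmx_trmx -sumE ler_sum.
  have /eqP : \sum_j L i j ^+ 2 - L i i ^+ 2 = 0.
    by apply: (psumr_eq0P _ E) => // l _; rewrite subr_ge0.
  rewrite (bigD1 i) //= [X in X - _]addrC addrK psumr_eq0 => [|l _]; last exact: sqr_ge0.
  by move=> /allP/(_ j); rewrite mem_index_enum ij => /(_ isT)/eqP.
apply/matrixP => i j; rewrite BE !mxE (bigD1 i) //= mxE big1 ?addr0 => [|l li].
  have [->|ij] := eqVneq i j; first by rewrite -expr2 Lii.
  by rewrite (Lij j i) // mulr0.
by rewrite Lij // mul0r.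
Qed.

Lemma pd_psd n (M : 'M[R]_n) : pd M -> psd M.
Proof.
case=> Ms Mp; split=> // x; have [->|/Mp/ltW//] := eqVneq x 0.
by rewrite /quad_form trmx0 mul0mx mul0mx mxE.
Qed.

(* With M = L L', apply the arithmetic-geometric inequality to L' B L. *)
Lemma pd_psd_tr_det n (M B : 'M[R]_n) : pd M -> psd B -> \tr (M *m B) <= n%:R ->
  \det M * \det B <= 1 /\ (\det M * \det B = 1 -> B = invmx M).
Proof.
move=> Mp [Bs Bp] trMB; have uM := pd_unit Mp.
have [L _ ME] := cholesky Mp.
have uL : L \in unitmx by move: uM; rewrite ME unitmx_mul => /andP[].
have detE : \det (L^T *m B *m L) = \det M * \det B.
  by rewrite ME !det_mulmx det_tr; ring.
have LBp : psd (L^T *m B *m L).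
  split; first by rewrite !trmx_mul trmxK Bs mulmxA.
  by move=> x; have := Bp (L *m x); rewrite /quad_form trmx_mul !mulmxA.
have [] := psd_tr_det LBp; first by rewrite mxtrace_mulC mulmxA -ME.
rewrite detE => le1 eq1; split=> // /eq1 LBL.
have LB : L^T *m B = invmx L by rewrite -[LHS](mulmxK uL) LBL mul1mx.
by rewrite -[LHS](mulKmx uM) {2}ME -(mulmxA L) LB mulmxV // mulmx1.
Qed.

Lemma pd_invmx n (M : 'M[R]_n) : pd M -> pd (invmx M).
Proof.
move=> Mp; have uM := pd_unit Mp; case: (Mp) => Ms M0.
split=> [|x x0]; first by rewrite trmx_inv Ms.
have /M0 : invmx M *m x != 0.
  by apply: contra_neq x0 => /(congr1 (mulmx M)); rewrite mulKVmx // mulmx0.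
by rewrite /quad_form trmx_mul trmx_inv Ms !mulmxA mulmxKV.
Qed.

Lemma pd_det_gt0 n (M : 'M[R]_n) : pd M -> 0 < \det M.
Proof.
move=> Mp; have [L _ ME] := cholesky Mp; have := pd_unit Mp.
by rewrite unitmxE unitfE ME det_mulmx det_tr -expr2 sqrf_eq0 -sqrf_eq0 lt_def sqr_ge0 andbT.
Qed.

End quadratic_forms.

(** * One-sided law of large numbers for pairwise independent samples *)

Lemma ae_forall_countable d (T : measurableType d) (R : realType)
    (mu : {measure set T -> \bar R}) (I : countType) (Pr : I -> T -> Prop) :
  (forall i, {ae mu, forall w, Pr i w}) -> {ae mu, forall w, forall i, Pr i w}.
Proof.
move=> aeP; pose F k := if @choice.unpickle I k is Some i then ~` [set w | Pr i w] else set0.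
apply: (@negligibleS _ _ _ mu (\bigcup_k F k)); last first.
  apply: negligible_bigcup => k; rewrite /F; case: choice.unpickle => [i|]; first exact: aeP.
  exact: negligible_set0.
move=> w /= /existsNP[i nP]; exists (choice.pickle i) => //.
by rewrite /F choice.pickleK.
Qed.

Section geometric_domination.
Variables (R : realType) (a : R).
Hypothesis a1 : 1 < a.

(** The price of truncating at level t for a sample of size about t: the first term integrates to
    the union bound for values above t, the second to the Chebyshev bound for the values kept. *)
Definition trunc_cost (t y : R) : R := (t < y)%R%:R * t + (y <= t)%R%:R * (y ^+ 2 / t).

Lemma trunc_cost_ge0 t y : 0 <= t -> 0 <= trunc_cost t y.
Proof.
move=> t0; rewrite /trunc_cost; apply: addr_ge0; apply: mulr_ge0; rewrite ?ler0n //.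
by rewrite divr_ge0 ?sqr_ge0.
Qed.

(* The increment of y t / (t + y) from t to a t dominates [trunc_cost t y], so the
   sum over a geometric progression telescopes. *)
Lemma trunc_cost_increment t y : 0 < t -> 0 <= y ->
  trunc_cost t y <= 2 * (a + 1) / (a - 1) * (y * (a * t) / (a * t + y) - y * t / (t + y)).
Proof.
move=> t0 y0.
have at0 : 0 < a * t by rewrite mulr_gt0 // (lt_trans ltr01).
have d1 : a * t + y != 0 by rewrite gt_eqF // ltr_wpDr.
have d2 : t + y != 0 by rewrite gt_eqF // ltr_wpDr.
have -> : 2 * (a + 1) / (a - 1) * (y * (a * t) / (a * t + y) - y * t / (t + y)) =
    (2 * (a + 1)) * (y ^+ 2 * t) / ((a * t + y) * (t + y)).
  by field; rewrite d1 d2 subr_eq0 gt_eqF.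
rewrite ler_pdivlMr; last by rewrite mulr_gt0 // ltr_wpDr.
rewrite /trunc_cost; case: (ltP t y) => ty /=.
  rewrite mul1r mul0r addr0.
  have h : (a * t + y) * (t + y) <= ((a + 1) * y) * (2 * y).
    apply: ler_pM; rewrite ?addr_ge0 ?(ltW at0) ?(ltW t0) //; last lra.
    by rewrite mulrDl mul1r lerD2r ler_pM2l ?ltW // (lt_trans ltr01).
  apply: (le_trans (ler_wpM2l (ltW t0) h)).
  by rewrite le_eqVlt; apply/orP; left; apply/eqP; ring.
rewrite mul1r mul0r add0r.
have h : (a * t + y) * (t + y) <= ((a + 1) * t) * (2 * t).
  apply: ler_pM; rewrite ?addr_ge0 ?(ltW at0) ?(ltW t0) //; lra.
apply: (le_trans (ler_wpM2l _ h)); first by rewrite divr_ge0 ?sqr_ge0 ?ltW.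
rewrite le_eqVlt; apply/orP; left; apply/eqP; field; by rewrite gt_eqF.
Qed.

Lemma trunc_cost_sum n y : 0 <= y ->
  \sum_(j < n) trunc_cost (a ^+ j) y <= 2 * (a + 1) / (a - 1) * y.
Proof.
move=> y0; have a0 : 0 < a by rewrite (lt_trans ltr01).
pose G j := y * a ^+ j / (a ^+ j + y).
have G0 j : 0 <= G j <= y.
  have aj0 : 0 < a ^+ j by rewrite exprn_gt0.
  rewrite /G divr_ge0 ?mulr_ge0 ?addr_ge0 ?(ltW aj0) //=.
  by rewrite ler_pdivrMr ?ltr_wpDr // ler_wpM2l // lerDl.
have K0 : 0 <= 2 * (a + 1) / (a - 1).
  by rewrite divr_ge0 ?subr_ge0 ?(ltW a1) // mulr_ge0 // addr_ge0 // ltW.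
apply: (@le_trans _ _ (\sum_(0 <= j < n) (2 * (a + 1) / (a - 1) * (G j.+1 - G j)))).
  rewrite big_mkord ler_sum // => j _; rewrite /G exprS.
  by apply: trunc_cost_increment; rewrite ?exprn_gt0.
rewrite -mulr_sumr telescope_sumr // ler_wpM2l //.
by have /andP[_ h1] := G0 n; have /andP[h2 _] := G0 0%N; rewrite lerBlDr (le_trans h1) // lerDl.
Qed.

End geometric_domination.

Section measurable_level_sets.
Context d (T : measurableType d) (R : realType).
Implicit Type f : T -> R.

Lemma measurable_level_ge f c : measurable_fun setT f -> measurable [set x | c <= f x].
Proof.
move=> mf; rewrite (_ : mkset _ = setT `&` f @^-1` `[c, +oo[%classic); first exact: mf.
by apply/seteqP; split => x /=; rewrite in_itv /= andbT // => -[].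
Qed.

Lemma measurable_level_le f c : measurable_fun setT f -> measurable [set x | f x <= c].
Proof.
move=> mf; rewrite (_ : mkset _ = setT `&` f @^-1` `]-oo, c]%classic); first exact: mf.
by apply/seteqP; split => x /=; rewrite in_itv //= => -[].
Qed.

End measurable_level_sets.

Section slln.
Context d d' (Omega : measurableType d) (T : measurableType d') (R : realType).
Variables (P : probability Omega R) (Q : probability T R).
Variable X : nat -> {RV P >-> T}.
Hypothesis X_distr : forall i A, measurable A -> distribution P (X i) A = Q A.
Hypothesis X_pair : forall i j A B, i != j -> measurable A -> measurable B ->
  P (X i @^-1` A `&` X j @^-1` B) = (Q A * Q B)%E.

Local Open Scope ereal_scope.

Lemma ge0_integral_sample i (f : T -> \bar R) : measurable_fun setT f ->
  (forall x, 0 <= f x) -> \int[P]_w f (X i w) = \int[Q]_x f x.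
Proof.
move=> mf f0; rewrite -[LHS](ge0_integral_distribution (X i) mf f0).
by apply: eq_measure_integral => A mA _; exact: X_distr.
Qed.

(** Pairwise independence makes the law of (X_i, X_j) agree with the product measure on rectangles,
    hence everywhere; the rest is Tonelli's theorem. *)
Lemma ge0_integral_sample_pair i j (f : T -> R) : i != j -> measurable_fun setT f ->
  (forall x, (0 <= f x)%R) ->
  \int[P]_w (f (X i w) * f (X j w))%:E = (\int[Q]_x (f x)%:E) * \int[Q]_x (f x)%:E.
Proof.
move=> ij mf f0.
have mZ : measurable_fun setT (fun w => (X i w, X j w)).
  by apply/measurable_fun_pairP; split; exact: measurable_funPT.
pose Z : {mfun Omega >-> (T * T)%type} :=
  HB.pack (fun w => (X i w, X j w)) (isMeasurableFun.Build _ _ _ _ _ mZ).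
pose g (z : (T * T)%type) := (f z.1 * f z.2)%:E.
have mg : measurable_fun setT g.
  by apply/measurable_EFinP/measurable_funM; exact: measurableT_comp.
have g0 z : 0 <= g z by rewrite lee_fin mulr_ge0.
have := @ge0_integral_distribution _ _ _ _ _ P Z g mg g0.
rewrite [RHS](_ : _ = \int[P]_w (f (X i w) * f (X j w))%:E) // => <-.
rewrite (eq_measure_integral (Q \x Q)); last first.
  move=> A mA _; symmetry; apply: product_measure_unique => // B C mB mC.
  by rewrite -(X_pair ij mB mC).
rewrite fubini_tonelli1 // /fubini_F /g /=.
have mfE : measurable_fun setT (EFin \o f) by exact/measurable_EFinP.
have f0E x : 0 <= (f x)%:E by rewrite lee_fin.
transitivity (\int[Q]_x ((f x)%:E * \int[Q]_y (f y)%:E)).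
  apply: eq_integral => x _; rewrite -ge0_integralZl_EFin //.
by rewrite ge0_integralZr // integral_ge0.
Qed.

Lemma sample_chebyshev n (f : T -> R) (m v e : R) : measurable_fun setT f ->
  (forall x, (0 <= f x)%R) -> \int[Q]_x (f x)%:E = m%:E ->
  \int[Q]_x (f x ^+ 2)%:E <= v%:E -> (0 < e)%R -> (0 < n)%N ->
  P [set w | (n%:R * (m + e) <= \sum_(i < n) f (X i w))%R] <= (v / (n%:R * e ^+ 2))%:E.
Proof.
move=> mf f0 fm fv e0 n0.
have n0' : (0 < n%:R :> R)%R by rewrite ltr0n.
have mfX i : measurable_fun setT (fun w => f (X i w)) by apply: measurableT_comp.
pose W w := (\sum_(i < n) f (X i w))%R.
have mW : measurable_fun setT W by apply: measurable_sum.
have W0 w : (0 <= W w)%R by apply: sumr_ge0.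
have m0 : (0 <= m)%R by rewrite -lee_fin -fm integral_ge0 // => x _; rewrite lee_fin.
have EW : \int[P]_w (W w)%:E = (n%:R * m)%:E.
  rewrite /W; under eq_integral do rewrite -sumEFin.
  rewrite ge0_integral_sum //; last 2 first.
    by move=> i; apply/measurable_EFinP.
    by move=> i x _; rewrite lee_fin.
  rewrite (eq_bigr (fun=> m%:E)) => [|i _]; last first.
    rewrite -fm -(@ge0_integral_sample i (EFin \o f)) //; exact/measurable_EFinP.
  by rewrite sumEFin sumr_const card_ord mulr_natl.
have EW2 : \int[P]_w (W w ^+ 2)%:E <= (n%:R * v + (n%:R * m) ^+ 2)%:E.
  have -> : \int[P]_w (W w ^+ 2)%:E =
      \sum_(i < n) \sum_(j < n) \int[P]_w (f (X i w) * f (X j w))%:E.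
    under eq_integral do rewrite expr2 mulr_suml -sumEFin.
    rewrite ge0_integral_sum //; last 2 first.
      by move=> i; apply/measurable_EFinP/measurable_funM.
      by move=> i x _; rewrite lee_fin mulr_ge0.
    apply: eq_bigr => i _.
    under eq_integral do rewrite mulr_sumr -sumEFin.
    rewrite ge0_integral_sum //.
      by move=> j; apply/measurable_EFinP/measurable_funM.
    by move=> j x _; rewrite lee_fin mulr_ge0.
  have -> : (n%:R * v + (n%:R * m) ^+ 2 = \sum_(i < n) (v + \sum_(j < n) m * m))%R.
    by rewrite !sumr_const card_ord -[RHS]mulr_natl -[(m * m *+ n)%R]mulr_natl; ring.
  rewrite -sumEFin; apply: lee_sum => i _.
  rewrite (bigD1 i) //= EFinD leeD //.
    rewrite (le_trans _ fv) // -(@ge0_integral_sample i (fun x => (f x ^+ 2)%:E)).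
    - by under eq_integral do rewrite -expr2.
    - by apply/measurable_EFinP/measurable_funX.
    - by move=> x; rewrite lee_fin sqr_ge0.
  rewrite -sumEFin [leRHS](bigD1 i) //= -[leLHS]add0e leeD ?lee_fin ?mulr_ge0 //.
  by apply: lee_sum => j ji; rewrite ge0_integral_sample_pair 1?eq_sym // fm.
have mV : measurable_fun setT (fun w => ((W w - n%:R * m) ^+ 2)%:E).
  apply/measurable_EFinP; apply: measurable_funX; exact: measurable_funB.
have EV : \int[P]_w ((W w - n%:R * m) ^+ 2)%:E <= (n%:R * v)%:E.
  (* The cross term is moved to the left, so that every integrand is nonnegative and additivity of
     the integral needs no integrability. *)
  have : \int[P]_w ((W w - n%:R * m) ^+ 2 + (2 * (n%:R * m)) * W w)%:E <=
      (n%:R * v + 2 * (n%:R * m) ^+ 2)%:E.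
    rewrite (eq_integral (fun w => (W w ^+ 2)%:E + ((n%:R * m) ^+ 2)%:E)); last first.
      by move=> w _; rewrite -EFinD; congr EFin; ring.
    rewrite ge0_integralD //; last 3 first.
    - by move=> x _; rewrite lee_fin sqr_ge0.
    - by apply/measurable_EFinP/measurable_funX.
    - by move=> x _; rewrite lee_fin sqr_ge0.
    rewrite integral_cst //= probability_setT mule1.
    by rewrite (le_trans (leeD2r _ EW2)) // -EFinD lee_fin; lra.
  rewrite (eq_integral (fun w => ((W w - n%:R * m) ^+ 2)%:E +
    (2 * (n%:R * m))%:E * (W w)%:E)) //.
  have mWE : measurable_fun setT (fun w => (W w)%:E) by exact/measurable_EFinP.
  rewrite ge0_integralD //; last 3 first.
  - by move=> x _; rewrite lee_fin sqr_ge0.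
  - by move=> x _; rewrite mule_ge0 // lee_fin ?mulr_ge0.
  - exact: measurable_funeM.
  rewrite ge0_integralZl_EFin ?EW ?mulr_ge0 // => [|x _]; last by rewrite lee_fin.
  rewrite -EFinM -leeBrDr //.
  by move=> /le_trans; apply; rewrite -EFinB lee_fin; lra.
have ne0 : (0 < (n%:R * e) ^+ 2)%R by rewrite exprn_gt0 ?mulr_gt0.
have := le_integral_abse P measurableT mV ne0.
rewrite setTI (eq_integral (fun w => ((W w - n%:R * m) ^+ 2)%:E)); last first.
  by move=> w _; rewrite gee0_abs // lee_fin sqr_ge0.
move=> /le_trans/(_ EV) H.
have -> : ((v / (n%:R * e ^+ 2))%:E = ((n%:R * e) ^+ 2)^-1%:E * (n%:R * v)%:E).
  by rewrite -EFinM; congr EFin; field; rewrite !gt_eqF.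
rewrite lee_pdivlMl //; apply: le_trans H; rewrite lee_pmul2l ?lte_fin //.
apply: le_measure; rewrite ?inE.
- exact: measurable_level_ge.
- rewrite -[X in measurable X]setTI.
  by apply: emeasurable_fun_c_infty => //; exact: measurableT_comp.
move=> w /= Ww; have {}Ww : (n%:R * e <= W w - n%:R * m)%R.
  by rewrite lerBrDr -mulrDr [(e + m)%R]addrC.
have ne1 : (0 <= n%:R * e)%R by rewrite mulr_ge0 ?ltW.
by rewrite lee_fin ger0_norm ?sqr_ge0 // ler_pXn2r ?nnegrE // (le_trans ne1).
Qed.

Section truncation.
Variables (f : T -> R) (m : R).
Hypotheses (mf : measurable_fun setT f) (f0 : forall x, (0 <= f x)%R).
Hypothesis fm : \int[Q]_x (f x)%:E = m%:E.

Let ftrunc t x : R := (f x * \1_[set x | (f x <= t)%R] x)%R.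

Let mftrunc t : measurable_fun setT (ftrunc t).
Proof. by apply: measurable_funM => //; apply/measurable_indicP/measurable_level_le. Qed.

Let ftrunc_ge0 t x : (0 <= ftrunc t x)%R.
Proof. by rewrite mulr_ge0 // indicE. Qed.

Let ftrunc_le t x : (ftrunc t x <= f x)%R.
Proof. by rewrite /ftrunc indicE; case: (_ \in _); rewrite ?mulr1 ?mulr0. Qed.

Let ftruncE t x : (f x <= t)%R -> ftrunc t x = f x.
Proof. by move=> fxt; rewrite /ftrunc indicE mem_set // mulr1. Qed.

Let measurable_gt t : measurable [set x | (t < f x)%R].
Proof.
rewrite (_ : mkset _ = ~` [set x | (f x <= t)%R]); first exact/measurableC/measurable_level_le.
by apply/seteqP; split => x /=; rewrite ltNge => /negP.
Qed.

Let trunc_costE t x : (trunc_cost t (f x))%:E =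
  t%:E * (\1_[set x | (t < f x)%R] x)%:E + t^-1%:E * (ftrunc t x ^+ 2)%:E.
Proof.
rewrite -!EFinM -EFinD; congr EFin.
rewrite /trunc_cost; congr (_ + _)%R; rewrite ?indicE.
  rewrite mulrC; have -> // : (x \in [set x0 | (t < f x0)%R]) = (t < f x)%R.
  by apply/idP/idP => [/set_mem|xt]; [|exact/mem_set].
have [fxt|fxt] := leP (f x) t; first by rewrite (ftruncE fxt) mul1r mulrC.
by rewrite /ftrunc indicE memNset ?mulr0 ?expr0n ?mulr0 ?mul0r //= leNgt fxt.
Qed.

Let mi t : measurable_fun setT (fun x => (\1_[set x | (t < f x)%R] x : R)%:E).
Proof. exact/measurable_EFinP/measurable_indicP. Qed.

Let mv t : measurable_fun setT (fun x => (ftrunc t x ^+ 2)%:E).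
Proof. exact/measurable_EFinP/measurable_funX. Qed.

Let mcost t : measurable_fun setT (fun x => (trunc_cost t (f x))%:E).
Proof.
under eq_fun do rewrite trunc_costE.
by apply: emeasurable_funD; exact: measurable_funeM.
Qed.

(** Either one of the n values exceeds t, or the truncated values have the large sum. Since t <= n
    <= 2 t, the union bound is at most 2 t Q(f > t), and Chebyshev's bound v / (n e^2) at most v /
    (t e^2). Truncation only lowers the mean, so m can be kept. *)
Lemma sample_mean_tail t e n : (0 < t)%R -> (0 < e)%R -> (0 < n)%N ->
  (t <= n%:R <= 2 * t)%R ->
  P [set w | (n%:R * (m + e) <= \sum_(i < n) f (X i w))%R] <=
  (2 + e ^- 2)%:E * \int[Q]_x (trunc_cost t (f x))%:E.
Proof.
move=> t0 e0 n0 /andP[tn nt].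
have costE : \int[Q]_x (trunc_cost t (f x))%:E =
    t%:E * Q [set x | (t < f x)%R] + t^-1%:E * \int[Q]_x (ftrunc t x ^+ 2)%:E.
  have <- : \int[Q]_x (t%:E * (\1_[set x | (t < f x)%R] x)%:E) =
      t%:E * Q [set x | (t < f x)%R].
    by rewrite ge0_integralZl_EFin ?(ltW t0) // ?integral_indic ?setIT.
  have <- : \int[Q]_x (t^-1%:E * (ftrunc t x ^+ 2)%:E) =
      t^-1%:E * \int[Q]_x (ftrunc t x ^+ 2)%:E.
    rewrite ge0_integralZl_EFin ?invr_ge0 ?(ltW t0) // => x _.
    by rewrite lee_fin sqr_ge0.
  rewrite -ge0_integralD //; last 4 first.
  - by move=> x _; rewrite lee_fin indicE mulr_ge0 ?(ltW t0).
  - exact: measurable_funeM.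
  - by move=> x _; rewrite lee_fin mulr_ge0 ?sqr_ge0 // invr_ge0 ltW.
  - exact: measurable_funeM.
  by apply: eq_integral => x _; rewrite trunc_costE.
have [v vE] : exists v, \int[Q]_x (ftrunc t x ^+ 2)%:E = v%:E.
  exists (fine (\int[Q]_x (ftrunc t x ^+ 2)%:E)); rewrite fineK //.
  rewrite ge0_fin_numE; last by apply: integral_ge0 => x _; rewrite lee_fin sqr_ge0.
  apply: (@le_lt_trans _ _ (\int[Q]_x (t * f x)%:E)).
    apply: ge0_le_integral => //.
    - by move=> x _; rewrite lee_fin sqr_ge0.
    - by apply/measurable_EFinP/measurable_funM.
    move=> x _; rewrite lee_fin expr2 ler_pM //.
    by rewrite /ftrunc indicE; case: (boolP (_ \in _)) => [/set_mem/=|_]; rewrite ?mulr1 ?mulr0 // ltW.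
  under eq_integral do rewrite EFinM.
  rewrite ge0_integralZl_EFin ?fm ?ltry ?ltW //; first by move=> x _; rewrite lee_fin.
  exact/measurable_EFinP.
have v0 : (0 <= v)%R by rewrite -lee_fin -vE integral_ge0 // => x _; rewrite lee_fin sqr_ge0.
have [q qE] : exists q, Q [set x | (t < f x)%R] = q%:E.
  by exists (fine (Q [set x | (t < f x)%R])); rewrite fineK // fin_num_measure.
have q0 : (0 <= q)%R by rewrite -lee_fin -qE.
have [mt mtE] : exists mt, \int[Q]_x (ftrunc t x)%:E = mt%:E.
  exists (fine (\int[Q]_x (ftrunc t x)%:E)); rewrite fineK //.
  rewrite ge0_fin_numE; last by apply: integral_ge0 => x _; rewrite lee_fin.
  apply: (@le_lt_trans _ _ m%:E); last exact: ltry.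
  rewrite -fm; apply: ge0_le_integral => //.
  - by move=> x _; rewrite lee_fin.
  - exact/measurable_EFinP.
  - exact/measurable_EFinP.
  - by move=> x _; rewrite lee_fin.
have mtm : (mt <= m)%R.
  rewrite -lee_fin -fm -mtE; apply: ge0_le_integral => //.
  - by move=> x _; rewrite lee_fin.
  - exact/measurable_EFinP.
  - exact/measurable_EFinP.
  - by move=> x _; rewrite lee_fin.
pose F i := X i @^-1` [set x | (t < f x)%R].
have mF i : measurable (F i).
  by rewrite -[X in measurable X]setTI; apply: measurable_funPT.
have mS (g : T -> R) c : measurable_fun setT g ->
    measurable [set w | (c <= \sum_(i < n) g (X i w))%R].
  move=> mg; apply: measurable_level_ge; apply: measurable_sum => i.
  exact: measurableT_comp.
apply: (@le_trans _ _ (P (\big[setU/set0]_(i < n) F i `|`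
    [set w | (n%:R * (mt + e) <= \sum_(i < n) ftrunc t (X i w))%R]))).
  apply: le_measure; rewrite ?inE.
  - exact: mS.
  - by apply: measurableU; [exact: bigsetU_measurable|exact: mS].
  move=> w /= Sw.
  have [[i fi]|nfi] := pselect (exists i : 'I_n, (t < f (X i w))%R).
    by left; rewrite -bigcup_mkord; exists i => /=.
  right; rewrite (eq_bigr (fun i : 'I_n => f (X i w))) => [|i _].
    by apply: le_trans Sw; rewrite ler_wpM2l // lerD2r.
  by apply: ftruncE; rewrite leNgt; apply/negP => fi; apply: nfi; exists i.
apply: (le_trans (measureU2 P _ _)); first exact: bigsetU_measurable.
  exact: mS.
apply: (@le_trans _ _ ((n%:R * q)%:E + (v / (n%:R * e ^+ 2))%:E)).
  apply: leeD; last by apply: sample_chebyshev; rewrite ?vE.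
  apply: (le_trans (Boole_inequality _ _)) => //.
  rewrite (eq_bigr (fun=> q%:E)) => [|i _]; last by rewrite -qE -(X_distr i).
  by rewrite sumEFin sumr_const card_ord mulr_natl.
rewrite costE vE qE -!EFinM -!EFinD lee_fin.
have nq : (n%:R * q <= 2 * (t * q))%R by rewrite mulrA ler_wpM2r.
have e2 : (0 < e ^+ 2)%R by rewrite exprn_gt0.
have vn : (v / (n%:R * e ^+ 2) <= e ^- 2 * (t^-1 * v))%R.
  have nr0 : (0 < n%:R :> R)%R by rewrite ltr0n.
  rewrite ler_pdivrMr; last exact: mulr_gt0.
  have -> : (e ^- 2 * (t^-1 * v) * (n%:R * e ^+ 2) = v * (n%:R / t))%R.
    by field; rewrite !gt_eqF.
  by rewrite ler_peMr // ler_pdivlMr // mul1r.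
have : (0 <= e ^- 2 * (t * q))%R by rewrite !mulr_ge0 ?invr_ge0 ?(ltW e2) ?(ltW t0).
have : (0 <= t^-1 * v)%R by rewrite mulr_ge0 ?invr_ge0 ?(ltW t0).
by move: (e ^- 2)%R (t^-1 * v)%R nq vn => E V; lra.
Qed.

(** Borel-Cantelli. By [trunc_cost_sum] the costs at the levels a^j add up to at most a multiple of
    f, so a finite mean makes the probabilities summable. Taking a - 1 as the slack leaves a single
    parameter to send to its limit. *)
Lemma sample_mean_geometric a : (1 < a)%R ->
  {ae P, forall w, exists J, forall j, (J <= j)%N ->
    let n := (Num.truncn (a ^+ j)).+1 in
    (\sum_(i < n) f (X i w) <= n%:R * (m + (a - 1)))%R}.
Proof.
move=> a1; pose N j := (Num.truncn (a ^+ j)).+1.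
have e0 : (0 < a - 1)%R by rewrite subr_gt0.
have a0 : (0 < a)%R by rewrite (lt_trans ltr01).
have NE j : (a ^+ j <= (N j)%:R <= 2 * a ^+ j)%R.
  have /andP[N1 N2] := truncn_itv (ltW (exprn_gt0 j a0)).
  rewrite (ltW N2) /= /N -natr1.
  have h : (1 <= a ^+ j)%R by rewrite exprn_ege1 // ltW.
  by rewrite mulr_natl mulr2n lerD.
pose F j := [set w | ((N j)%:R * (m + (a - 1)) <= \sum_(i < N j) f (X i w))%R].
have mF j : measurable (F j).
  apply: measurable_level_ge; apply: measurable_sum => i; exact: measurableT_comp.
pose K := (2 * (a + 1) / (a - 1))%R.
have K0 : (0 <= K)%R.
  by rewrite divr_ge0 ?(ltW e0) // mulr_ge0 // addr_ge0 // ltW.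
have sumF J : \sum_(0 <= j < J) P (F j) <= (2 + (a - 1) ^- 2)%:E * (K * m)%:E.
  apply: (@le_trans _ _ (\sum_(0 <= j < J)
      ((2 + (a - 1) ^- 2)%:E * \int[Q]_x (trunc_cost (a ^+ j) (f x))%:E))).
    apply: lee_sum => j _; apply: sample_mean_tail => //; exact: exprn_gt0.
  rewrite -ge0_sume_distrr => [|j _]; last first.
    by apply: integral_ge0 => x _; rewrite lee_fin trunc_cost_ge0 // ltW ?exprn_gt0.
  apply: lee_wpmul2l; first by rewrite lee_fin addr_ge0 // invr_ge0 sqr_ge0.
  rewrite -ge0_integral_sum // => [|j x _]; last first.
    by rewrite lee_fin trunc_cost_ge0 // ltW ?exprn_gt0.
  rewrite EFinM -fm -ge0_integralZl_EFin //; last 2 first.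
  - by move=> x _; rewrite lee_fin.
  - exact/measurable_EFinP.
  apply: ge0_le_integral => //.
  - by move=> x _; apply: sume_ge0 => j _; rewrite lee_fin trunc_cost_ge0 // ltW ?exprn_gt0.
  - exact: emeasurable_sum.
  - by apply: measurable_funeM; exact/measurable_EFinP.
  by move=> x _; rewrite sumEFin big_mkord lee_fin trunc_cost_sum.
have F_lim0 : P (lim_sup_set F) = 0.
  apply: lim_sup_set_cvg0 => //.
  apply: (@le_lt_trans _ _ ((2 + (a - 1) ^- 2)%:E * (K * m)%:E)).
    apply: lime_le; first exact: is_cvg_nneseries.
    exact: nearW.
  by rewrite -EFinM ltry.
have : P.-negligible (lim_sup_set F).
  apply/negligibleP => //; apply: bigcapT_measurable => n.
  by apply: bigcup_measurable.
apply: negligibleS => w /= nJ n _.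
apply: contrapT => nF; apply: nJ; exists n => j nj /=.
rewrite leNgt; apply/negP => jF; apply: nF; exists j => //=.
exact: ltW.
Qed.

(* Etemadi's argument: between consecutive points of a geometric subsequence the sums
   are monotone, at the price of a factor a > 1. *)
Lemma sample_mean_limsup : {ae P, forall w, forall e, (0 < e)%R ->
  \forall n \near \oo, (\sum_(i < n) f (X i w) <= n%:R * (m + e))%R}.
Proof.
pose a (p : nat) : R := (1 + p.+1%:R^-1)%R.
have a1 p : (1 < a p)%R by rewrite ltrDl invr_gt0.
have /ae_forall_countable := fun p => sample_mean_geometric (a1 p).
apply: filterS => w geo e e0.
have m0 : (0 <= m)%R by rewrite -lee_fin -fm integral_ge0 // => x _; rewrite lee_fin.
(* With A = 1 + b and b <= 1, the final bound (A n + 1)(m + b) exceeds n m by at most n b (m + 2) +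
   m + 1. The condition b <= c makes the first term at most n e / 2, and n >= 2 (m + 1) / e does the
   same for the rest. *)
pose c := (e / (2 * (m + 2)))%R.
have c0 : (0 < c)%R by rewrite divr_gt0 // mulr_gt0 // ltr_wpDl.
pose p := Num.truncn c^-1; have := a1 p; have := geo p.
have ap : (a p = 1 + (a p - 1))%R by rewrite addrC subrK.
have bc : (a p - 1 <= c)%R.
  rewrite /a addrC addKr invf_ple ?posrE //.
  by have /andP[_ /ltW] := truncn_itv (ltW (eqbRL (invr_gt0 c) c0)).
have b1 : (a p - 1 <= 1)%R by rewrite /a addrC addKr invf_le1 // ler1n.
move: (a p) ap bc b1 => A ap bc b1 [J geoJ] A1.
set b := (A - 1)%R in ap bc b1 geoJ; have b0 : (0 < b)%R by rewrite subr_gt0.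
have unbounded n : exists j, (n%:R <= A ^+ j)%R.
  have bern j : (1 + j%:R * b <= A ^+ j)%R.
    elim: j => [|j IHj]; first by rewrite mul0r addr0.
    rewrite exprS; apply: le_trans (ler_wpM2l _ IHj); last by rewrite ltW // (lt_trans ltr01).
    by rewrite ap -natr1; have := sqr_ge0 b; have : (0 <= j%:R :> R)%R by []; nra.
  exists (Num.truncn (n%:R / b)).+1; apply: le_trans (bern _).
  have /andP[_ /ltW] := truncn_itv (divr_ge0 (ler0n R n) (ltW b0)).
  by rewrite ler_pdivrMr //; lra.
have n_large : \forall n \near \oo, (A ^+ J <= n%:R)%R /\ (2 * (m + 1) / e <= n%:R)%R.
  by apply: filterI; exact: nbhs_infty_ger.
apply: filterS n_large => n [nJ ne].
have [j nj jmin] := ex_minnP (unbounded n).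
have jJ : (J <= j)%N.
  rewrite leqNgt; apply/negP => jltJ.
  rewrite -(ltr_eXn2l A1) in jltJ.
  by have := le_lt_trans nj (lt_le_trans jltJ nJ); rewrite ltxx.
have Aj : (A ^+ j <= A * n%:R)%R.
  case: j jmin {nj jJ} => [|j] jmin.
    by rewrite expr0 mulr_ege1 ?(ltW A1) // (le_trans _ nJ) // exprn_ege1 // ltW.
  rewrite exprS ler_wpM2l ?(ltW (lt_trans ltr01 A1)) // ltW // ltNge; apply/negP => /jmin.
  by rewrite ltnn.
have /andP[Nj Nj'] := truncn_itv (exprn_ge0 j (ltW (lt_trans ltr01 A1))).
have nNj : (n <= (Num.truncn (A ^+ j)).+1)%N by rewrite -(ler_nat R) (le_trans nj) // ltW.
have -> : (\sum_(i < n) f (X i w) = \sum_(0 <= i < n) f (X i w))%R by rewrite big_mkord.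
apply: (@le_trans _ _ (\sum_(i < (Num.truncn (A ^+ j)).+1) f (X i w))%R).
  by rewrite -(big_mkord xpredT (fun i => f (X i w))) [leRHS](big_cat_nat (n := n)) //= lerDl sumr_ge0.
apply: le_trans (geoJ _ jJ) _.
apply: (@le_trans _ _ ((A * n%:R + 1) * (m + b))%R).
  apply: ler_wpM2r; first by rewrite addr_ge0 // ltW.
  by rewrite -natr1 lerD2r (le_trans Nj).
move: ne bc; rewrite /c ler_pdivrMr // ler_pdivlMr ?mulr_gt0 ?ltr_wpDl // => ne bc.
have n0 : (0 <= n%:R :> R)%R by [].
have : (b * (2 * (m + 2)) * n%:R <= e * n%:R)%R by rewrite ler_wpM2r.
have : (b * (b * n%:R) <= b * n%:R)%R by rewrite ler_piMl ?mulr_ge0 ?(ltW b0).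
by rewrite ap; lra.
Qed.

End truncation.
End slln.

(** * Uniform law of large numbers for clamped quadratic polynomials *)

Section probability_expectation.
Context d (T : measurableType d) (R : realType) (Q : probability T R).
Implicit Types f g h : T -> R.

Lemma integrable_bounded f c : measurable_fun setT f -> (forall x, `|f x| <= c) ->
  Q.-integrable setT (EFin \o f).
Proof.
move=> mf fc; apply: (@le_integrable _ _ _ Q setT measurableT _ (EFin \o cst c)).
- exact/measurable_EFinP.
- by move=> x _ /=; rewrite lee_fin (le_trans (fc x)) // ler_norm.
exact: finite_measure_integrable_cst.
Qed.

(** Here h stands for the mass far out, where f and g are not close. [sample_avg_close] is the same
    estimate for the empirical averages. *)
Lemma Rintegral_close f g h (eta : R) :
  measurable_fun setT f -> measurable_fun setT g -> measurable_fun setT h ->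
  (forall x, 0 <= f x <= 1) -> (forall x, 0 <= g x <= 1) -> (forall x, 0 <= h x <= 1) ->
  (forall x, `|f x - g x| <= eta + h x) ->
  `|Rintegral Q setT f - Rintegral Q setT g| <= eta + Rintegral Q setT h.
Proof.
move=> mf mg mh f01 g01 h01 fgh.
have int (k : T -> R) : measurable_fun setT k -> (forall x, 0 <= k x <= 1) ->
    Q.-integrable setT (EFin \o k).
  move=> mk k01; apply: (integrable_bounded mk (c := 1)) => x.
  by have /andP[k0 k1] := k01 x; rewrite ger0_norm.
have ifg : Q.-integrable setT (EFin \o (fun x => f x - g x)).
  apply: (@integrable_bounded _ 1); first exact: measurable_funB.
  move=> x; have := f01 x; have := g01 x; rewrite ler_norml; lra.
have iabs : Q.-integrable setT (EFin \o (fun x => `|f x - g x|)).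
  by have := integrable_norm ifg.
rewrite -RintegralB //; [|exact: int..].
apply: (le_trans (le_normr_Rintegral measurableT ifg)).
have ic : Q.-integrable setT (EFin \o cst eta) by exact: finite_measure_integrable_cst.
have <- : Rintegral Q setT (fun x => cst eta x + h x) = eta + Rintegral Q setT h.
  rewrite RintegralD //; last exact: int.
  by rewrite Rintegral_cst //= probability_setT mulr1.
apply: le_Rintegral => //.
by have := integrableD measurableT ic (int _ mh h01); exact: eq_integrable.
Qed.

Lemma Rintegral_le_measure f (A : set T) : measurable A -> measurable_fun setT f ->
  (forall x, 0 <= f x <= 1) -> (forall x, ~ A x -> f x = 0) ->
  ((Rintegral Q setT f)%:E <= Q A)%E.
Proof.
move=> mA mf f01 fA; rewrite -[X in (_ <= Q X)%E]setIT -integral_indic //.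
rewrite /Rintegral fineK; last first.
  apply: integrable_fin_num => //; apply: (integrable_bounded (c := 1) mf) => x.
  by have /andP[f0 f1] := f01 x; rewrite ger0_norm.
apply: ge0_le_integral => //.
- by move=> x _; rewrite lee_fin; case/andP: (f01 x).
- exact/measurable_EFinP.
- by apply/measurable_EFinP/measurable_indicP.
move=> x _; rewrite lee_fin indicE; have [Ax|/fA ->] := pselect (A x); last exact: ler0n.
by rewrite mem_set //; case/andP: (f01 x).
Qed.

Lemma measure_le_Rintegral f (A : set T) : measurable A -> measurable_fun setT f ->
  (forall x, 0 <= f x <= 1) -> (forall x, A x -> f x = 1) ->
  (Q A <= (Rintegral Q setT f)%:E)%E.
Proof.
move=> mA mf f01 fA; rewrite -[X in (Q X <= _)%E]setIT -integral_indic //.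
rewrite /Rintegral fineK; last first.
  apply: integrable_fin_num => //; apply: (integrable_bounded (c := 1) mf) => x.
  by have /andP[f0 f1] := f01 x; rewrite ger0_norm.
apply: ge0_le_integral => //.
- by apply/measurable_EFinP/measurable_indicP.
- exact/measurable_EFinP.
move=> x _; rewrite lee_fin indicE; have [Ax|nA] := pselect (A x).
  by rewrite mem_set // fA.
by rewrite memNset //; case/andP: (f01 x).
Qed.

Lemma tail_small f e : measurable_fun setT f -> 0 < e ->
  exists M : nat, (Q [set x | (M%:R <= f x)%R] < e%:E)%E.
Proof.
move=> mf e0; pose F (M : nat) := [set x | M%:R <= f x].
have mF M : measurable (F M) by exact: measurable_level_ge.
have capF : \bigcap_M F M = set0.
  apply/seteqP; split => // x Fx; have := Fx (Num.truncn `|f x|).+1 I => /= fx.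
  have /andP[_ h] := truncn_itv (normr_ge0 (f x)).
  by have := lt_le_trans h fx; rewrite ltNge ler_norm.
have : Q (F M) @[M --> \oo] --> Q (\bigcap_M F M).
  apply: nonincreasing_cvg_mu => //; first by rewrite -ge0_fin_numE ?fin_num_measure.
    exact: bigcapT_measurable.
  move=> M N MN; apply/subsetPset => x /=; rewrite /F /=.
  by apply: le_trans; rewrite ler_nat.
rewrite capF measure0 => /fine_cvgP[_ /cvgrPdist_lt/(_ _ e0)] [N _ /(_ N (leqnn N))] /=.
rewrite sub0r normrN ger0_norm ?fine_ge0 // => h; exists N.
have fQ : Q (F N) \is a fin_num by exact: fin_num_measure.
by rewrite -/(F N) -(fineK fQ) lte_fin.
Qed.

End probability_expectation.

Section quadratics.
Variables (R : realType) (k : nat).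
Implicit Types (x v : 'cV[R]_k) (A : 'M[R]_k) (t : 'M[R]_k * 'cV[R]_k * R).

Definition quadratic t x : R := quad_form t.1.1 x + (t.1.2^T *m x) 0 0 + t.2.

Definition clamp (r : R) : R := Num.max 0 (Num.min 1 r).

Lemma clamp01 r : 0 <= clamp r <= 1.
Proof. by rewrite /clamp le_max lexx /= ge_max ler01 ge_min lexx. Qed.

Lemma clamp_ge1 r : 1 <= r -> clamp r = 1.
Proof. by move=> r1; rewrite /clamp min_l // max_r. Qed.

Lemma clamp_le0 r : r <= 0 -> clamp r = 0.
Proof. by move=> r0; rewrite /clamp min_r ?max_l // (le_trans r0). Qed.

Lemma clamp_id r : 0 <= r <= 1 -> clamp r = r.
Proof. by case/andP=> r0 r1; rewrite /clamp min_r // max_r. Qed.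

Lemma clamp_lip r s : `|clamp r - clamp s| <= `|r - s|.
Proof.
have h1 := ler_norm (r - s); have h2 := ler_norm (s - r); rewrite distrC in h2.
have cases u : [\/ u <= 0 /\ clamp u = 0, (0 <= u <= 1) /\ clamp u = u |
    1 <= u /\ clamp u = 1].
  have [u0|u0] := leP u 0; first by constructor 1; rewrite clamp_le0.
  have [u1|u1] := leP u 1; first by constructor 2; rewrite clamp_id (ltW u0).
  by constructor 3; rewrite clamp_ge1 // ltW.
by rewrite ler_norml; case: (cases r) => -[? ->]; case: (cases s) => -[? ->]; lra.
Qed.

Definition clamp_quadratic t x := clamp (quadratic t x).

Lemma quadraticE t x : quadratic t x =
  \sum_i \sum_j t.1.1 i j * (x i 0 * x j 0) + \sum_i t.1.2 i 0 * x i 0 + t.2.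
Proof.
rewrite /quadratic quad_formE; congr (_ + _ + _).
by rewrite mxE; apply: eq_bigr => i _; rewrite mxE.
Qed.

Lemma measurable_coord i : measurable_fun setT (fun x => x i 0).
Proof.
apply: (measurability _ (RGenOInfty.measurableE R)) => //.
move=> _ [_ [a ->] <-]; apply: sub_sigma_algebra; rewrite setTI.
apply: open_comp; last exact: interval_open.
by move=> x _; exact: coord_continuous.
Qed.

Lemma measurable_quadratic t : measurable_fun setT (quadratic t).
Proof.
rewrite (funext (quadraticE t)).
apply: measurable_funD => //; apply: measurable_funD.
  apply: measurable_sum => i; apply: measurable_sum => j.
  by apply: measurable_funM => //; apply: measurable_funM; exact: measurable_coord.
by apply: measurable_sum => i; apply: measurable_funM => //; exact: measurable_coord.
Qed.

Lemma measurable_clamp_quadratic t : measurable_fun setT (clamp_quadratic t).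
Proof.
apply: measurable_maxr => //; apply: measurable_minr => //.
exact: measurable_quadratic.
Qed.

(** There are k^2 + k + 1 coefficients; each moves by less than eta and multiplies a monomial of
    absolute value at most 1 + r. *)
Lemma quadratic_lip t u x eta r : ball t eta u -> sqnorm x <= r ->
  `|quadratic t x - quadratic u x| <= ((k * k + k + 1)%:R * (1 + r)) * eta.
Proof.
case=> [[]] [_ tu1] [_ tu2] tu3 xr; have r0 : 0 <= r.
  by apply: le_trans xr; apply: sumr_ge0 => i _; rewrite sqr_ge0.
have eta0 : 0 <= eta.
  by apply: le_trans (ltW tu3).
have xi i : x i 0 ^+ 2 <= r.
  apply: le_trans xr; rewrite /sqnorm (bigD1 i) //= lerDl.
  by apply: sumr_ge0 => j _; rewrite sqr_ge0.
have xij i j : `|x i 0 * x j 0| <= 1 + r.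
  by rewrite ler_norml; have := xi i; have := xi j; nra.
have xi1 i : `|x i 0| <= 1 + r.
  by rewrite ler_norml; have := xi i; nra.
have -> : quadratic t x - quadratic u x =
    \sum_i \sum_j (t.1.1 i j - u.1.1 i j) * (x i 0 * x j 0) +
    \sum_i (t.1.2 i 0 - u.1.2 i 0) * x i 0 + (t.2 - u.2).
  rewrite !quadraticE.
  under [X in _ = X + _ + _]eq_bigr do (under eq_bigr do rewrite mulrBl; rewrite sumrB).
  under [X in _ = _ + X + _]eq_bigr do rewrite mulrBl.
  by rewrite !sumrB; ring.
have -> : (k * k + k + 1)%:R * (1 + r) * eta =
    \sum_(i < k) \sum_(j < k) eta * (1 + r) + \sum_(i < k) eta * (1 + r) + eta * (1 + r).
  rewrite !sumr_const card_ord !natrD natrM.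
  by rewrite -mulrnA -[X in _ = X + _ + _]mulr_natl -[X in _ = _ + X + _]mulr_natl natrM; ring.
apply: le_trans (ler_normD _ _) _; apply: lerD.
  apply: le_trans (ler_normD _ _) _; apply: lerD.
    apply: le_trans (ler_norm_sum _ _ _) _; apply: ler_sum => i _.
    apply: le_trans (ler_norm_sum _ _ _) _; apply: ler_sum => j _.
    rewrite normrM ler_pM //; exact/ltW/(tu1 i j).
  apply: le_trans (ler_norm_sum _ _ _) _; apply: ler_sum => i _.
  rewrite normrM ler_pM //; exact/ltW/(tu2 i 0).
rewrite -[leLHS]mulr1 ler_pM //; last by rewrite lerDl.
exact/ltW.
Qed.

(** A countable dense set of coefficients, so that the null sets of the corresponding laws can be
    united. *)
Definition rat_param (t : 'M[rat]_k * 'cV[rat]_k * rat) : 'M[R]_k * 'cV[R]_k * R :=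
  (map_mx ratr t.1.1, map_mx ratr t.1.2, ratr t.2).

Lemma rat_param_dense t eta : 0 < eta -> exists u, ball t eta (rat_param u).
Proof.
move=> eta0; have approx (r : R) : exists q : rat, `|r - ratr q| < eta.
  have /rat_in_itvoo[q] : r - eta < r + eta by lra.
  rewrite in_itv /= => /andP[q1 q2]; exists q; rewrite ltr_norml; lra.
have [q qE] := choice approx.
exists (\matrix_(i, j) q (t.1.1 i j), \col_i q (t.1.2 i 0), q t.2).
split; [split|exact: qE]; split=> // i j; rewrite /ball /= !mxE; last rewrite (ord1 j); exact: qE.
Qed.

Section uniform_law.
Variables (P0 : probability 'cV[R]_k R) (X : nat -> 'cV[R]_k).

Definition sample_avg (f : 'cV[R]_k -> R) n : R := n%:R^-1 * \sum_(i < n) f (X i).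

Lemma sample_avg_close f g h eta n : (0 < n)%N ->
  (forall x, `|f x - g x| <= eta + h x) ->
  `|sample_avg f n - sample_avg g n| <= eta + sample_avg h n.
Proof.
move=> n0 fgh; have n0' : 0 < n%:R :> R by rewrite ltr0n.
rewrite /sample_avg -mulrBr -sumrB normrM ger0_norm ?invr_ge0 ?(ltW n0') //.
have -> : eta = n%:R^-1 * \sum_(i < n) eta.
  by rewrite sumr_const card_ord -[eta *+ n]mulr_natl mulKf ?gt_eqF.
rewrite -mulrDr -big_split /= ler_pM2l ?invr_gt0 //.
by apply: le_trans (ler_norm_sum _ _ _) _; apply: ler_sum.
Qed.

Lemma integrable_clamp_quadratic t :
  P0.-integrable setT (EFin \o clamp_quadratic t).
Proof.
apply: (@integrable_bounded _ _ _ P0 _ 1); first exact: measurable_clamp_quadratic.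
by move=> x; have /andP[c0 c1] := clamp01 (quadratic t x); rewrite ger0_norm.
Qed.

Hypothesis X_rat : forall u : 'M[rat]_k * 'cV[rat]_k * rat,
  sample_avg (clamp_quadratic (rat_param u)) n @[n --> \oo] -->
  Rintegral P0 setT (clamp_quadratic (rat_param u)).

(** On a large ball a clamped quadratic is Lipschitz in its coefficients. Outside, two of them
    differ by at most 1, and this error is dominated by one further clamped quadratic of small
    integral that itself obeys the law. *)
Lemma uniform_law t0 e : 0 < e -> \forall n \near \oo & t \near t0,
  `|sample_avg (clamp_quadratic t) n - Rintegral P0 setT (clamp_quadratic t0)| < e.
Proof.
move=> e0.
have mnorm : measurable_fun setT (fun x : 'cV[R]_k => sqnorm x).
  by apply: measurable_sum => i; apply: measurable_funX; exact: measurable_coord.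
(* The final estimate spends nine portions of size e / 10: three for t against t0, three for t0
   against u, one for the law at u, two for the integrals. *)
have e10 : 0 < e / 10 by lra.
have [M PM] := tail_small P0 mnorm e10.
(* The clamp of |x|^2 - M is 0 below level M and 1 above M + 1; its rational coefficients bring it
   under [X_rat]. *)
pose cut : 'M[rat]_k * 'cV[rat]_k * rat := (1%:M, 0, - M%:R).
have cutE x : quadratic (rat_param cut) x = sqnorm x - M%:R.
  rewrite quadraticE /= raddfN /= ratr_nat; congr (_ + _).
  rewrite [X in _ + X]big1 ?addr0 => [|i _]; last by rewrite !mxE raddf0 mul0r.
  apply: eq_bigr => i _; rewrite (bigD1 i) //= big1 ?addr0 => [|j ji].
    by rewrite !mxE eqxx rmorph1 mul1r expr2.
  by rewrite !mxE eq_sym (negPf ji) rmorph0 mul0r.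
have Ecut : Rintegral P0 setT (clamp_quadratic (rat_param cut)) <= e / 10.
  rewrite -lee_fin (le_trans _ (ltW PM)) //.
  apply: Rintegral_le_measure.
  - exact: measurable_level_ge.
  - exact: measurable_clamp_quadratic.
  - by move=> x; exact: clamp01.
  move=> x /= /negP; rewrite -ltNge => xM.
  by rewrite /clamp_quadratic cutE clamp_le0 // subr_le0 ltW.
pose C : R := (k * k + k + 1)%:R * (1 + M.+1%:R).
have C0 : 0 < C by rewrite mulr_gt0 ?ltr0n ?addn1 // ltr_wpDr.
pose eta := e / 10 / C.
have eta0 : 0 < eta by rewrite divr_gt0.
have close t u x : ball t eta u ->
    `|clamp_quadratic t x - clamp_quadratic u x| <=
    e / 10 + clamp_quadratic (rat_param cut) x.
  move=> tu; have [xM|xM] := leP (sqnorm x) M.+1%:R.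
    rewrite -[leLHS]addr0 lerD //; last by case/andP: (clamp01 (quadratic (rat_param cut) x)).
    apply: le_trans (clamp_lip _ _) _; apply: le_trans (quadratic_lip tu xM) _.
    by rewrite /eta mulrC divfK // gt_eqF.
  have -> : clamp_quadratic (rat_param cut) x = 1.
    by rewrite /clamp_quadratic cutE clamp_ge1 // lerBrDr addrC natr1 ltW.
  have h1 : 0 <= clamp_quadratic t x <= 1 := clamp01 _.
  have h2 : 0 <= clamp_quadratic u x <= 1 := clamp01 _.
  by rewrite ler_norml; lra.
have [u tu] := rat_param_dense t0 eta0.
have Et0u : `|Rintegral P0 setT (clamp_quadratic t0) -
    Rintegral P0 setT (clamp_quadratic (rat_param u))| <= e / 10 + e / 10.
  apply: le_trans (Rintegral_close P0 (eta := e / 10)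
    (h := clamp_quadratic (rat_param cut)) _ _ _ _ _ _ _) _.
  1-3: exact: measurable_clamp_quadratic.
  1-3: by move=> x; exact: clamp01.
  - by move=> x; exact: close.
  by rewrite lerD2l.
have evu : \forall n \near \oo, [/\ (0 < n)%N,
    `|Rintegral P0 setT (clamp_quadratic (rat_param u)) -
      sample_avg (clamp_quadratic (rat_param u)) n| < e / 10 &
    `|Rintegral P0 setT (clamp_quadratic (rat_param cut)) -
      sample_avg (clamp_quadratic (rat_param cut)) n| < e / 10].
  near=> n; split; first by near: n; exact: nbhs_infty_gt.
    by near: n; have /cvgrPdist_lt := @X_rat u; exact.
  by near: n; have /cvgrPdist_lt := @X_rat cut; exact.
exists ([set n | [/\ (0 < n)%N,
    `|Rintegral P0 setT (clamp_quadratic (rat_param u)) -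
      sample_avg (clamp_quadratic (rat_param u)) n| < e / 10 &
    `|Rintegral P0 setT (clamp_quadratic (rat_param cut)) -
      sample_avg (clamp_quadratic (rat_param cut)) n| < e / 10]],
  ball t0 eta).
  by split => //=; exact: nbhsx_ballx.
move=> [n t] /= [[n0 nu ncut] t0t].
have h1 := sample_avg_close n0 (fun x => close _ _ x t0t).
have h2 := sample_avg_close n0 (fun x => close _ _ x tu).
move: (sample_avg _ _) (sample_avg _ _) (sample_avg _ _) (sample_avg _ _) h1 h2 ncut nu => a b c d.
move: (Rintegral _ _ _) (Rintegral _ _ _) (Rintegral _ _ _) Ecut Et0u => p q r.
by rewrite !ltr_norml !ler_norml; lra.
Unshelve. all: by end_near.
Qed.

End uniform_law.

End quadratics.

(** * Moments *)

Section moments.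
Variables (R : realType) (k : nat).
Implicit Types (x v mu T : 'cV[R]_k) (A M C : 'M[R]_k) (t : 'M[R]_k * 'cV[R]_k * R).
Implicit Type L : ('cV[R]_k -> R) -> R.

(** A common notion for subsample averages and phi-weighted integrals: on quadratics, L acts as the
    expectation of a law with mean T and covariance C. *)
Definition moments L T C := C^T = C /\ forall t,
  L (quadratic t) = \tr (t.1.1 *m (C + T *m T^T)) + (t.1.2^T *m T) 0 0 + t.2.

Definition mahalanobis M mu : 'M[R]_k * 'cV[R]_k * R :=
  (M, - 2 *: (M *m mu), quad_form M mu).

Lemma quad_form_tr M x : quad_form M x = \tr (M *m (x *m x^T)).
Proof. by rewrite mulmxA mxtrace_mulC mulmxA trace_mx11. Qed.

Lemma quad_form0 M : quad_form M 0 = 0.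
Proof. by rewrite -(scale0r 0) quad_formZ expr0n mul0r. Qed.

Lemma quad_formN M x : quad_form M (- x) = quad_form M x.
Proof. by rewrite -scaleN1r quad_formZ sqrrN expr1n mul1r. Qed.

Lemma quadratic_mahalanobis M mu x : M^T = M ->
  quadratic (mahalanobis M mu) x = quad_form M (x - mu).
Proof.
move=> Ms; rewrite quad_formD // quad_formN /quadratic /=; congr (_ + _ + _).
by rewrite linearZ /= trmx_mul Ms [(- mu)^T]linearN /= !mulNmx -scalemxAl !mxE; ring.
Qed.

Lemma moments_mahalanobis L T C M mu : moments L T C -> M^T = M ->
  L (quadratic (mahalanobis M mu)) = \tr (M *m C) + quad_form M (T - mu).
Proof.
case=> Cs LE Ms; rewrite LE /= mulmxDr mxtraceD -quad_form_tr -!addrA; congr (_ + _).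
rewrite quad_formD // quad_formN addrA; congr (_ + _ + _).
by rewrite linearZ /= trmx_mul Ms [(- mu)^T]linearN /= !mulNmx -scalemxAl !mxE; ring.
Qed.

(** The form of C at a is the value of L at the square of a'(x - T), a Mahalanobis quadratic with
    matrix a a'. *)
Lemma moments_psd L T C : moments L T C ->
  (forall t, (forall x, 0 <= quadratic t x) -> 0 <= L (quadratic t)) -> psd C.
Proof.
move=> LTC L0; have [Cs LE] := LTC; split=> // a.
have aas : (a *m a^T)^T = a *m a^T by rewrite trmx_mul trmxK.
have := moments_mahalanobis T LTC aas.
rewrite subrr quad_form0 addr0.
have -> : \tr (a *m a^T *m C) = quad_form C a.
  by rewrite -mulmxA mxtrace_mulC trace_mx11.
move=> <-; apply: L0 => x; rewrite quadratic_mahalanobis //.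
rewrite /quad_form mulmxA -mulmxA.
have -> : (x - T)^T *m a = (a^T *m (x - T))^T by rewrite trmx_mul trmxK.
rewrite mxE big_ord1 mxE -expr2 sqr_ge0 //.
Qed.

Lemma moments_sample (X : nat -> 'cV[R]_k) n (S : {set 'I_n}) : (0 < #|S|)%N ->
  moments (fun f => #|S|%:R^-1 * \sum_(i in S) f (X i)) (mean_hat X S) (cov_hat X S).
Proof.
move=> S0; have nS : #|S|%:R != 0 :> R by rewrite pnatr_eq0 -lt0n.
split.
  rewrite /cov_hat linearZ /= linear_sum; congr (_ *: _); apply: eq_bigr => i _.
  by rewrite /= trmx_mul trmxK.
move=> t; rewrite /cov_hat; have TE : mean_hat X S = #|S|%:R^-1 *: \sum_(i in S) X i by [].
move: (mean_hat X S) TE => T TE.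
have sumX : \sum_(i in S) X i = #|S|%:R *: T by rewrite TE scalerA mulfV // scale1r.
have -> : \sum_(i in S) (X i - T) *m (X i - T)^T =
    \sum_(i in S) X i *m (X i)^T - #|S|%:R *: (T *m T^T).
  under eq_bigr do rewrite [(_ - T)^T]linearB /= mulmxBl !mulmxBr.
  rewrite !sumrB -mulmx_sumr -mulmx_suml -linear_sum /= sumX sumr_const.
  have -> : T *m T^T *+ #|S| = #|S|%:R *: (T *m T^T) by rewrite scaler_nat.
  by rewrite -scalemxAl [(_ *: T)^T]linearZ /= -scalemxAr subrr subr0.
rewrite scalerBr scalerA mulVf // scale1r subrK.
rewrite -scalemxAr mxtraceZ mulmx_sumr linear_sum /= /quadratic.
under [X in _ = _ * X + _ + _]eq_bigr do rewrite -quad_form_tr.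
have -> : (t.1.2^T *m T) 0 0 = #|S|%:R^-1 * \sum_(i in S) (t.1.2^T *m X i) 0 0.
  by rewrite TE -scalemxAr mxE mulmx_sumr summxE.
rewrite [X in _ = _ + X](_ : t.2 = #|S|%:R^-1 * \sum_(i in S) t.2); last first.
  by rewrite sumr_const -[t.2 *+ _]mulr_natl mulrA mulVf // mul1r.
by rewrite -!mulrDr -!big_split.
Qed.

End moments.

Section Rintegral_sum.
Context d (T : measurableType d) (R : realType) (Q : probability T R).

Lemma integrable_Rsum (I : Type) (s : seq I) (F : I -> T -> R) :
  (forall i, Q.-integrable setT (EFin \o F i)) ->
  Q.-integrable setT (EFin \o (fun x => \sum_(i <- s) F i x)).
Proof.
move=> iF; have := integrable_sum measurableT s (fun i (_ : true) => iF i).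
by apply: eq_integrable => // x _ /=; rewrite sumEFin.
Qed.

Lemma Rintegral_sum (I : Type) (s : seq I) (F : I -> T -> R) :
  (forall i, Q.-integrable setT (EFin \o F i)) ->
  Rintegral Q setT (fun x => \sum_(i <- s) F i x) = \sum_(i <- s) Rintegral Q setT (F i).
Proof.
move=> iF; elim: s => [|i s IHs].
  rewrite big_nil; under eq_Rintegral do rewrite big_nil.
  by rewrite Rintegral_cst // mul0r.
rewrite big_cons -IHs -RintegralD //; last exact: integrable_Rsum.
by apply: eq_Rintegral => x _; rewrite big_cons.
Qed.

Lemma integrable_RZl r (F : T -> R) : Q.-integrable setT (EFin \o F) ->
  Q.-integrable setT (EFin \o (fun x => r * F x)).
Proof. by move=> iF; exact: (integrableZl measurableT r iF). Qed.

Lemma integrable_RD (F G : T -> R) : Q.-integrable setT (EFin \o F) ->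
  Q.-integrable setT (EFin \o G) -> Q.-integrable setT (EFin \o (fun x => F x + G x)).
Proof. by move=> iF iG; exact: (integrableD measurableT iF iG). Qed.

End Rintegral_sum.

Section class_moments.
Variables (R : realType) (k : nat) (P0 : probability 'cV[R]_k R) (gamma : R).
Hypothesis gamma0 : 0 < gamma.
Variable phi : 'cV[R]_k -> R.
Hypothesis phi_class : mcd_class P0 gamma phi.

Let mphi : measurable_fun setT phi. Proof. by case: phi_class. Qed.
Let phi01 x : 0 <= phi x <= 1. Proof. by case: phi_class. Qed.

Lemma mcd_class_integrable : P0.-integrable setT (EFin \o phi).
Proof.
apply: (@integrable_bounded _ _ _ P0 _ 1 mphi) => x.
by have /andP[p0 p1] := phi01 x; rewrite ger0_norm.
Qed.

Lemma mcd_class_mass : gamma <= Rintegral P0 setT phi.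
Proof.
case: phi_class => _ _ gphi _; rewrite -lee_fin fineK //.
exact: (integrable_fin_num _ mcd_class_integrable).
Qed.

Let beta0 : 0 < Rintegral P0 setT phi.
Proof. exact: lt_le_trans mcd_class_mass. Qed.

Lemma sqnorm_ge0 (x : 'cV[R]_k) : 0 <= sqnorm x.
Proof. by apply: sumr_ge0 => i _; rewrite sqr_ge0. Qed.

Lemma coord_sq_le_sqnorm (x : 'cV[R]_k) i : x i 0 ^+ 2 <= sqnorm x.
Proof. by rewrite /sqnorm (bigD1 i) //= lerDl sumr_ge0 // => j _; rewrite sqr_ge0. Qed.

Let measurable_sqnorm : measurable_fun setT (@sqnorm R k).
Proof. by apply: measurable_sum => i; apply: measurable_funX; exact: measurable_coord. Qed.

Lemma mcd_class_integrable_le (f : 'cV[R]_k -> R) : measurable_fun setT f ->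
  (forall x, `|f x| <= 1 + sqnorm x) ->
  P0.-integrable setT (EFin \o (fun x => f x * phi x)).
Proof.
move=> mf fle.
have isq : P0.-integrable setT (EFin \o (fun x => sqnorm x * phi x)).
  apply/integrableP; split.
    by apply/measurable_EFinP; exact: measurable_funM.
  case: phi_class => _ _ _; apply: le_lt_trans.
  rewrite (eq_integral (fun x => (sqnorm x * phi x)%:E)) // => x _.
  by rewrite gee0_abs // lee_fin mulr_ge0 ?sqnorm_ge0 //; case/andP: (phi01 x).
apply: (le_integrable measurableT _ _ (integrable_RD mcd_class_integrable isq)).
  by apply/measurable_EFinP; exact: measurable_funM.
move=> x _ /=; have /andP[p0 p1] := phi01 x.
have -> : phi x + sqnorm x * phi x = (1 + sqnorm x) * phi x by ring.
rewrite lee_fin !normrM (ger0_norm p0) ler_wpM2r // (le_trans (fle x)) //.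
exact: ler_norm.
Qed.

Let ix i : P0.-integrable setT (EFin \o (fun x : 'cV[R]_k => x i 0 * phi x)).
Proof.
apply: mcd_class_integrable_le => [|x]; first exact: measurable_coord.
by have := coord_sq_le_sqnorm x i; rewrite ler_norml; nra.
Qed.

Let ixx i j : P0.-integrable setT (EFin \o (fun x : 'cV[R]_k => x i 0 * x j 0 * phi x)).
Proof.
apply: mcd_class_integrable_le => [|x].
  by apply: measurable_funM; exact: measurable_coord.
have := coord_sq_le_sqnorm x i; have := coord_sq_le_sqnorm x j.
by rewrite ler_norml; nra.
Qed.

Let quadratic_phiE t x : quadratic t x * phi x =
  \sum_i \sum_j t.1.1 i j * (x i 0 * x j 0 * phi x) +
  \sum_i t.1.2 i 0 * (x i 0 * phi x) + t.2 * phi x.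
Proof.
rewrite quadraticE !mulrDl !mulr_suml; congr (_ + _ + _).
  by apply: eq_bigr => i _; rewrite mulr_suml; apply: eq_bigr => j _; ring.
by apply: eq_bigr => i _; ring.
Qed.

Lemma mcd_class_integrable_quadratic t :
  P0.-integrable setT (EFin \o (fun x => quadratic t x * phi x)).
Proof.
rewrite (funext (quadratic_phiE t)).
apply: integrable_RD; last exact: integrable_RZl mcd_class_integrable.
apply: integrable_RD; apply: integrable_Rsum => i; last exact: integrable_RZl.
by apply: integrable_Rsum => j; exact: integrable_RZl.
Qed.

Let mean f := (Rintegral P0 setT phi)^-1 * Rintegral P0 setT (fun x => f x * phi x).

Let mean_quadratic t : mean (quadratic t) =
  \sum_i \sum_j t.1.1 i j * mean (fun x : 'cV[R]_k => x i 0 * x j 0) +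
  \sum_i t.1.2 i 0 * mean (fun x : 'cV[R]_k => x i 0) + t.2.
Proof.
rewrite /mean (funext (quadratic_phiE t)).
rewrite RintegralD //; last exact: integrable_RZl mcd_class_integrable.
  rewrite RintegralD //; last by apply: integrable_Rsum => i; exact: integrable_RZl.
    rewrite Rintegral_sum => [|i]; last by apply: integrable_Rsum => j; exact: integrable_RZl.
    rewrite Rintegral_sum => [|i]; last exact: integrable_RZl.
    rewrite (RintegralZl _ _ mcd_class_integrable) // !mulrDr.
    rewrite [X in _ + X = _]mulrCA mulVf ?gt_eqF // mulr1 !mulr_sumr; congr (_ + _ + _).
      apply: eq_bigr => i _; rewrite Rintegral_sum => [|j]; last exact: integrable_RZl.
      rewrite mulr_sumr; apply: eq_bigr => j _.
      by rewrite (RintegralZl _ _ (ixx i j)) //; ring.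
    apply: eq_bigr => i _.
    by rewrite (RintegralZl _ _ (ix i)) //; ring.
  by apply: integrable_Rsum => i; apply: integrable_Rsum => j; exact: integrable_RZl.
apply: integrable_RD; apply: integrable_Rsum => i; last exact: integrable_RZl.
by apply: integrable_Rsum => j; exact: integrable_RZl.
Qed.

Lemma mcd_class_moments : moments mean (mcd_loc P0 phi) (mcd_cov P0 phi).
Proof.
have TE i : mcd_loc P0 phi i 0 = mean (fun x : 'cV[R]_k => x i 0) by rewrite !mxE.
rewrite /mcd_cov; move: (mcd_loc P0 phi) TE => T TE; set C := _ *: _.
have CE i j : C i j = mean (fun x : 'cV[R]_k => x i 0 * x j 0) - T i 0 * T j 0.
  pose t : 'M[R]_k * 'cV[R]_k * R :=
    (delta_mx i j, - T j 0 *: delta_mx i 0 - T i 0 *: delta_mx j 0, T i 0 * T j 0).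
  have sum1 (F : 'I_k -> R) (l : 'I_k) : \sum_m (m == l)%:R * F m = F l.
    rewrite (bigD1 l) //= eqxx mul1r big1 ?addr0 // => m /negPf ->.
    by rewrite mul0r.
  have sum2 F : \sum_l \sum_m t.1.1 l m * F l m = F i j.
    rewrite -[RHS](sum1 (F^~ j)); apply: eq_bigr => l _.
    rewrite -[in RHS](sum1 (F l)) mulr_sumr; apply: eq_bigr => m _.
    by rewrite mxE mulrA -natrM mulnb.
  have sum3 (F : 'I_k -> R) : \sum_l t.1.2 l 0 * F l = - T j 0 * F i - T i 0 * F j.
    rewrite -(sum1 F i) -(sum1 F j) !mulr_sumr -sumrB; apply: eq_bigr => l _.
    by rewrite !mxE !andbT; ring.
  have tE x : quadratic t x = ((x - T) *m (x - T)^T) i j.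
    rewrite quadraticE sum2 sum3 !mxE big_ord1 !mxE /=; ring.
  rewrite mxE [X in _ * X]mxE.
  transitivity (mean (quadratic t)).
    by congr (_ * _); apply: eq_Rintegral => x _; rewrite tE.
  rewrite mean_quadratic sum2 sum3 -!TE /=; ring.
split; first by apply/matrixP => i j; rewrite mxE !CE [T j 0 * _]mulrC; congr (mean _ - _);
  apply/funext => x; rewrite mulrC.
move=> t; rewrite mean_quadratic; congr (_ + _ + _).
  rewrite /mxtrace; apply: eq_bigr => i _; rewrite mxE; apply: eq_bigr => j _.
  rewrite mxE CE [(T *m T^T) j i]mxE big_ord1 mxE; congr (_ * _).
  rewrite subrK; congr (mean _).
  by apply/funext => x; rewrite mulrC.
by rewrite mxE; apply: eq_bigr => i _; rewrite TE mxE.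
Qed.

End class_moments.

(** * Limits of matrices *)

Section matrix_limits.
Variable R : realType.

Lemma cvg_sumR (T I : Type) (F : set_system T) {FF : Filter F} (r : seq I)
    (f : I -> T -> R) (a : I -> R) :
  (forall i, f i x @[x --> F] --> a i) ->
  \sum_(i <- r) f i x @[x --> F] --> \sum_(i <- r) a i.
Proof.
move=> fa; elim: r => [|i r IHr].
  by rewrite big_nil; under eq_fun do rewrite big_nil; exact: cvg_cst.
by rewrite big_cons; under eq_fun do rewrite big_cons; exact: (cvgD (fa i) IHr).
Qed.

Lemma continuous_sumR (T : topologicalType) (I : Type) (r : seq I) (F : I -> T -> R) :
  (forall i, continuous (F i)) -> continuous (fun x => \sum_(i <- r) F i x).
Proof. by move=> Fc x; apply: (@cvg_sumR _ _ _ (nbhs_filter x)) => i; exact: Fc. Qed.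

Lemma continuous_prodR (T : topologicalType) (I : Type) (r : seq I) (F : I -> T -> R) :
  (forall i, continuous (F i)) -> continuous (fun x => \prod_(i <- r) F i x).
Proof.
move=> Fc; elim: r => [|i r IHr].
  under eq_fun do rewrite big_nil.
  exact: cst_continuous.
under eq_fun do rewrite big_cons.
by move=> x; apply: cvgM; [exact: Fc|exact: IHr].
Qed.

Lemma cvg_mx_entries (I : Type) (F : set_system I) {FF : Filter F} m n
    (f : I -> 'M[R]_(m, n)) (M : 'M[R]_(m, n)) :
  (forall i j, f x i j @[x --> F] --> M i j) -> f @ F --> M.
Proof.
move=> fM; apply/cvg_ballP => e e0.
have : \forall x \near F, forall i j, ball (M i j) e (f x i j).
  apply: filter_forall => i; apply: filter_forall => j.
  by have /cvg_ballP := fM i j; exact.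
by apply: filterS => x fx; split.
Qed.

Lemma cvg_mulmx (T : Type) (F : set_system T) {FF : Filter F} m n p
    (f : T -> 'M[R]_(m, n)) (g : T -> 'M[R]_(n, p)) (A : 'M[R]_(m, n)) (B : 'M[R]_(n, p)) :
  f @ F --> A -> g @ F --> B -> f x *m g x @[x --> F] --> A *m B.
Proof.
move=> fA gB; apply: cvg_mx_entries => i j.
rewrite mxE; under eq_fun do rewrite mxE; apply: cvg_sumR => l.
have hf := cvg_comp _ _ fA (@coord_continuous R m n i l A).
have hg := cvg_comp _ _ gB (@coord_continuous R n p l j B).
exact: (cvgM hf hg).
Qed.

Lemma compact_mx_box m n (c : R) :
  compact [set M : 'M[R]_(m, n) | forall i j, `|M i j| <= c].
Proof.
have vec_cont : continuous (@vec_mx R m n).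
  move=> v; apply: (@cvg_mx_entries _ _ (nbhs_filter v)) => i j; under eq_cvg do rewrite mxE.
  by rewrite mxE; exact: coord_continuous.
have box : compact [set v : 'rV[R]_(m * n) | forall i, `[- c, c]%classic (v ord0 i)].
  by apply: (@rV_compact _ _ (fun=> `[- c, c]%classic)) => i; exact: segment_compact.
have := continuous_compact (continuous_subspaceT vec_cont) box; congr compact.
apply/seteqP; split=> [_ [v vc <-] i j|M Mc] /=.
  by rewrite mxE; have := vc (mxvec_index i j); rewrite /= in_itv /= ler_norml.
exists (mxvec M); last exact: mxvecK.
move=> l; case/mxvec_indexP: l => i j; rewrite mxvecE /= in_itv /= -ler_norml.
exact: Mc.
Qed.

Lemma det_continuous n : continuous (fun M : 'M[R]_n => \det M).
Proof.
apply: continuous_sumR => s M.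
have c i : continuous (fun N : 'M[R]_n => N i (s i)) by exact: coord_continuous.
have h := @continuous_prodR _ _ (index_enum 'I_n) _ c M.
exact: (cvgMl_tmp (a := (-1) ^+ s) h).
Qed.

Lemma cofactor_continuous n (i j : 'I_n) : continuous (fun M : 'M[R]_n => cofactor M i j).
Proof.
case: n i j => [[]//|n] i j M; rewrite /cofactor.
have minor : row' i (col' j N) @[N --> M] --> row' i (col' j M).
  apply: (@cvg_mx_entries _ _ (nbhs_filter M) _ _
    (fun N : 'M[R]_n.+1 => row' i (col' j N))) => a b; under eq_cvg do rewrite !mxE.
  by rewrite !mxE; exact: coord_continuous.
have h := cvg_comp _ _ minor (@det_continuous n (row' i (col' j M))).
exact: (cvgMl_tmp (a := (-1) ^+ (i + j)) h).
Qed.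

Lemma invmx_continuous n (M : 'M[R]_n) : M \in unitmx -> {for M, continuous (@invmx R n)}.
Proof.
move=> uM; have d0 : \det M != 0 by rewrite -unitfE -unitmxE.
(* [invmx] is the adjugate formula only on invertible matrices, but these form a neighbourhood of
   M. *)
have invE : \forall N \near M, (\det N)^-1 *: \adj N = invmx N.
  have : \forall N \near M, \det N != 0.
    exact: (@cvgr_neq0 _ _ _ (nbhs M) _ _ _ (@det_continuous n M) d0).
  apply: filterS => N dN; rewrite /invmx unitmxE unitfE dN //.
have lim : (\det N)^-1 *: \adj N @[N --> M] --> invmx M.
  have -> : invmx M = (\det M)^-1 *: \adj M by rewrite /invmx uM.
  apply: (@cvg_mx_entries _ _ (nbhs_filter M)) => i j; under eq_cvg do rewrite !mxE; rewrite !mxE.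
  have hd : \det N @[N --> M] --> \det M := @det_continuous n M.
  have hc := @cofactor_continuous n j i M.
  exact: (cvgM (cvgV d0 hd) hc).
exact: (cvg_trans (near_eq_cvg invE) lim).
Qed.

End matrix_limits.

(** * Nondegeneracy of large subsamples *)

Section cut_quadratics.
Variables (R : realType) (k : nat).
Implicit Types (x a : 'cV[R]_k) (t : 'M[R]_k * 'cV[R]_k * R) (q b : R).

(** Coefficients of 1 - t / q. When t is nonnegative, its clamp is the trimming weight, falling from
    1 where t = 0 to 0 where t >= q. *)
Definition cut_param t q : 'M[R]_k * 'cV[R]_k * R :=
  (- q^-1 *: t.1.1, - q^-1 *: t.1.2, 1 - q^-1 * t.2).

Lemma quadratic_cut t q x : quadratic (cut_param t q) x = 1 - quadratic t x / q.
Proof.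
rewrite /quadratic /quad_form /= -scalemxAr -scalemxAl [(- q^-1 *: t.1.2)^T]linearZ /=.
by rewrite -scalemxAl !mxE; ring.
Qed.

Definition affine_sq a b : 'M[R]_k * 'cV[R]_k * R := (a *m a^T, (- 2 * b) *: a, b ^+ 2).

Lemma quadratic_affine_sq a b x :
  quadratic (affine_sq a b) x = ((a^T *m x) 0 0 - b) ^+ 2.
Proof.
rewrite /quadratic /quad_form /= [((- 2 * b) *: a)^T]linearZ /= -scalemxAl.
have -> : x^T *m (a *m a^T) *m x = (a^T *m x)^T *m (a^T *m x).
  by rewrite trmx_mul trmxK !mulmxA.
move: (a^T *m x) => y; rewrite !mxE big_ord1 !mxE; ring.
Qed.

Let param : topologicalType := ('M[R]_k * 'cV[R]_k * R)%type.

Lemma param_mx_continuous i j : continuous (fun t : param => t.1.1 i j).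
Proof.
move=> t; have h : continuous_at t (fun t : param => t.1.1).
  exact: (@continuous_comp _ _ _ (fun t : param => t.1) fst t (@cvg_fst _ _ _ _ _) (@cvg_fst _ _ _ _ _)).
exact: (continuous_comp h (@coord_continuous R k k i j t.1.1)).
Qed.

Lemma param_vec_continuous i : continuous (fun t : param => t.1.2 i 0).
Proof.
move=> t; have h : continuous_at t (fun t : param => t.1.2).
  exact: (@continuous_comp _ _ _ (fun t : param => t.1) snd t (@cvg_fst _ _ _ _ _) (@cvg_snd _ _ _ _ _)).
exact: (continuous_comp h (@coord_continuous R k 1 i 0 t.1.2)).
Qed.

Lemma param_cst_continuous : continuous (fun t : param => t.2).
Proof. by move=> t; exact: cvg_snd. Qed.

Lemma param_hausdorff : hausdorff_space param.
Proof.
move=> p q clpq; have sep (f : param -> R) : continuous f -> f p = f q.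
  move=> cf; apply: Rhausdorff => A B nA nB.
  by have [t [At Bt]] := clpq (f @^-1` A) (f @^-1` B) (cf p A nA) (cf q B nB); exists (f t).
have e3 := sep _ param_cst_continuous.
have e1 : p.1.1 = q.1.1.
  by apply/matrixP => i j; exact: sep _ (@param_mx_continuous i j).
have e2 : p.1.2 = q.1.2 by apply/colP => i; exact: sep _ (@param_vec_continuous i).
by case: p q e1 e2 e3 {clpq sep} => [[? ?] ?] [[? ?] ?] /= -> -> ->.
Qed.

Lemma quadratic_continuous x : continuous (fun t : param => quadratic t x).
Proof.
under eq_fun do rewrite quadraticE.
have h1 i : continuous (fun t : param => \sum_j t.1.1 i j * (x i 0 * x j 0)).
  apply: continuous_sumR => j t; exact: (cvgMr_tmp (@param_mx_continuous i j t)).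
have h2 i : continuous (fun t : param => t.1.2 i 0 * x i 0).
  move=> t; exact: (cvgMr_tmp (@param_vec_continuous i t)).
move=> t; apply: cvgD; last exact: param_cst_continuous.
apply: cvgD; [exact: (continuous_sumR h1)|exact: (continuous_sumR h2)].
Qed.

Lemma param_cvg (T : topologicalType) (f : T -> param) (z : T) :
  (forall i j, (f y).1.1 i j @[y --> z] --> (f z).1.1 i j) ->
  (forall i, (f y).1.2 i 0 @[y --> z] --> (f z).1.2 i 0) ->
  (f y).2 @[y --> z] --> (f z).2 -> f y @[y --> z] --> f z.
Proof.
move=> f1 f2 f3; have -> : f = (fun y => ((f y).1.1, (f y).1.2, (f y).2)).
  by apply/funext => y; case: (f y) => [[]].
apply: (@cvg_pair _ _ _ (nbhs z) (nbhs ((f z).1.1, (f z).1.2)) (nbhs (f z).2)); last exact: f3.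
apply: (@cvg_pair _ _ _ (nbhs z) (nbhs (f z).1.1) (nbhs (f z).1.2)).
  exact: (@cvg_mx_entries R _ _ (nbhs_filter z)).
apply: (@cvg_mx_entries R _ _ (nbhs_filter z)) => i j.
by rewrite (ord1 j); exact: f2.
Qed.

Lemma cut_param_continuous q : continuous (fun t : param => cut_param t q : param).
Proof.
move=> t; apply: param_cvg => /= [i j|i|].
- under eq_fun do rewrite mxE; rewrite mxE.
  exact: (cvgMl_tmp (@param_mx_continuous i j t)).
- under eq_fun do rewrite mxE; rewrite mxE.
  exact: (cvgMl_tmp (@param_vec_continuous i t)).
apply: cvgB; first exact: cvg_cst.
exact: (cvgMl_tmp (@param_cst_continuous t)).
Qed.

Lemma pair_coord_continuous i : continuous (fun p : 'cV[R]_k * R => p.1 i 0).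
Proof.
move=> p; exact: (@continuous_comp _ _ _ fst (fun a : 'cV[R]_k => a i 0) p
  (@cvg_fst _ _ _ _ _) (@coord_continuous R k 1 i 0 p.1)).
Qed.

Lemma affine_sq_continuous :
  continuous (fun p : 'cV[R]_k * R => affine_sq p.1 p.2 : param).
Proof.
have ca := pair_coord_continuous.
have cb : continuous (fun p : 'cV[R]_k * R => p.2) by move=> p; exact: cvg_snd.
move=> p; apply: param_cvg => /= [i j|i|].
- under eq_fun do rewrite mxE big_ord1 mxE; rewrite mxE big_ord1 mxE.
  exact: (cvgM (ca i p) (ca j p)).
- under eq_fun do rewrite mxE; rewrite mxE.
  exact: (cvgM (cvgMl_tmp (cb p)) (ca i p)).
exact: (cvgM (cb p) (cb p)).
Qed.

End cut_quadratics.

Section spread.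
Variables (R : realType) (k : nat) (gamma : R) (P0 : probability 'cV[R]_k R).
Local Notation param := ('M[R]_k * 'cV[R]_k * R)%type.

(** The cut at level q lies below the indicator of t <= q, and these sets decrease to the zero set
    of t as q tends to 0. *)
Lemma level_cut (t : param) : (forall x, 0 <= quadratic t x) ->
  (P0 [set x | (quadratic t x <= 0)%R] < gamma%:E)%E ->
  exists2 q, 0 < q & Rintegral P0 setT (clamp_quadratic (cut_param t q)) < gamma.
Proof.
move=> t0 Pt; pose F (m : nat) := [set x | quadratic t x <= m.+1%:R^-1].
have mF m : measurable (F m) by apply: measurable_level_le; exact: measurable_quadratic.
have capF : \bigcap_m F m = [set x | (quadratic t x <= 0)%R].
  apply/seteqP; split=> x /= Fx; last first.
    by move=> m _; rewrite /F /=; apply: le_trans Fx _; rewrite invr_ge0.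
  rewrite leNgt; apply/negP => tx.
  have := Fx (Num.truncn (quadratic t x)^-1) I; rewrite /F /=.
  have /andP[_] := truncn_itv (ltW (eqbRL (invr_gt0 (quadratic t x)) tx)).
  rewrite -[X in (_ < X)]invrK ltf_pV2 ?posrE ?invr_gt0 // => /lt_le_trans h /h.
  by rewrite ltxx.
have : P0 (F m) @[m --> \oo] --> P0 (\bigcap_m F m).
  apply: nonincreasing_cvg_mu => //; first by rewrite -ge0_fin_numE ?fin_num_measure.
    exact: bigcapT_measurable.
  move=> m n mn; apply/subsetPset => x /=; rewrite /F /= => /le_trans; apply.
  by rewrite lef_pV2 ?posrE // ler_nat.
rewrite capF => cvgF.
have [m Fm] : exists m, (P0 (F m) < gamma%:E)%E.
  apply: contrapT => nF; move: Pt; rewrite ltNge => /negP; apply.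
  rewrite -(cvg_lim _ cvgF) //; apply: lime_ge; first by apply/cvg_ex; eexists; exact: cvgF.
  by apply: nearW => m; rewrite leNgt; apply/negP => Fm; apply: nF; exists m.
exists m.+1%:R^-1; first by rewrite invr_gt0.
rewrite -lte_fin; apply: le_lt_trans Fm; apply: Rintegral_le_measure => //.
- exact: measurable_clamp_quadratic.
- by move=> x; exact: clamp01.
move=> x; rewrite /F /= => /negP; rewrite -ltNge => mx.
rewrite /clamp_quadratic quadratic_cut clamp_le0 // subr_le0 invrK.
by rewrite -ler_pdivrMr // mul1r ltW.
Qed.

Hypothesis hyperplane_lt : forall H, hyperplane H -> (P0 H < gamma%:E)%E.
Hypothesis gamma0 : 0 < gamma.

(** The zero set of (a'x - b)^2 is a hyperplane if a != 0, and empty if a = 0, as b is then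
    nonzero. *)
Lemma affine_sq_level_cut (a : 'cV[R]_k) b : 0 < sqnorm a + b ^+ 2 ->
  exists2 q, 0 < q &
    Rintegral P0 setT (clamp_quadratic (cut_param (affine_sq a b) q)) < gamma.
Proof.
move=> ab; apply: level_cut => [x|]; first by rewrite quadratic_affine_sq sqr_ge0.
have [a0|a0] := eqVneq a 0.
  rewrite (_ : mkset _ = set0) ?measure0 //.
  apply/seteqP; split => // x /=; rewrite quadratic_affine_sq a0 trmx0 mul0mx mxE sub0r sqrrN.
  move: ab; rewrite a0 /sqnorm big1 ?add0r => [|i _]; last by rewrite mxE expr0n.
  by move=> b0; rewrite leNgt b0.
apply: hyperplane_lt; exists a, b; split=> //; apply/seteqP; split=> x /=;
  rewrite quadratic_affine_sq.
  move=> ax; have : ((a^T *m x) 0 0 - b) ^+ 2 == 0 by rewrite eq_le ax sqr_ge0.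
  rewrite sqrf_eq0 subr_eq0 => /eqP <-; rewrite mxE; apply: eq_bigr => i _.
  by rewrite mxE.
move=> <-; rewrite mxE (eq_bigr (fun i => a i 0 * x i 0)) ?subrr ?expr0n // => i _.
by rewrite mxE.
Qed.

Lemma clamp_trim (d q : R) : 0 <= d -> 0 < q -> 1 <= clamp (1 - d / q) + d / q.
Proof.
move=> d0 q0; have dq : 0 <= d / q by rewrite divr_ge0 // ltW.
have [dq1|dq1] := leP (d / q) 1.
  by rewrite clamp_id ?subrK // subr_ge0 dq1 gerBl.
by rewrite (le_trans (ltW dq1)) // lerDr; case/andP: (clamp01 (1 - d / q)).
Qed.

Variable X : nat -> 'cV[R]_k.

(* Trimming: a subsample has to pay for the points that the cut at level q misses. *)
Lemma subsample_trim (t : param) q n (S : {set 'I_n}) : (forall x, 0 <= quadratic t x) ->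
  0 < q -> #|S|%:R <= n%:R * sample_avg X (clamp_quadratic (cut_param t q)) n +
    q^-1 * \sum_(i in S) quadratic t (X i).
Proof.
move=> t0 q0; have -> : n%:R * sample_avg X (clamp_quadratic (cut_param t q)) n =
    \sum_(i < n) clamp_quadratic (cut_param t q) (X i).
  case: n S => [|n] S; first by rewrite mul0r big_ord0.
  by rewrite mulVKf // pnatr_eq0.
have le1 : \sum_(i in S) clamp_quadratic (cut_param t q) (X i) <=
    \sum_(i < n) clamp_quadratic (cut_param t q) (X i).
  rewrite [leRHS](bigID (mem S)) /= lerDl sumr_ge0 // => i _.
  by case/andP: (clamp01 (quadratic (cut_param t q) (X i))).
apply: le_trans (lerD le1 (lexx _)).
rewrite mulr_sumr -big_split -sumr_const /=; apply: ler_sum => i _.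
by rewrite /clamp_quadratic quadratic_cut [q^-1 * _]mulrC clamp_trim.
Qed.

Hypothesis law : forall (t0 : param) (e : R), 0 < e -> \forall n \near \oo & t \near t0,
  `|sample_avg X (clamp_quadratic t) n - Rintegral P0 setT (clamp_quadratic t0)| < e.

Lemma unit_sphere_compact :
  compact [set p : 'cV[R]_k * R | sqnorm p.1 + p.2 ^+ 2 = 1].
Proof.
pose box := [set a : 'cV[R]_k | forall i j, `|a i j| <= 1] `*` `[(- 1 : R), 1]%classic.
have boxc : compact box.
  by apply: compact_setX; [exact: compact_mx_box|exact: segment_compact].
apply: (subclosed_compact _ boxc).
  have cont : continuous (fun p : 'cV[R]_k * R => sqnorm p.1 + p.2 ^+ 2).
    have ca i : continuous (fun p : 'cV[R]_k * R => p.1 i 0 ^+ 2).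
      under eq_fun do rewrite expr2.
      move=> p; have h := @pair_coord_continuous R k i p.
      exact: (cvgM h h).
    under eq_fun do rewrite expr2.
    move=> p; apply: cvgD; first exact: (continuous_sumR ca).
    exact: (cvgM (@cvg_snd _ _ _ _ _) (@cvg_snd _ _ _ _ _)).
  apply: (@preimage_closed _ _ _ [set r : R | r = 1]); last exact: closed_eq.
  by move=> p _; exact: cont.
move=> [a b] /= ab; split=> /=.
  move=> i j; rewrite (ord1 j); have := coord_sq_le_sqnorm a i; have := sqr_ge0 b.
  by rewrite ler_norml; nra.
by rewrite in_itv /=; have := sqnorm_ge0 a; nra.
Qed.

(** For a given affine function, some cut has integral below gamma, so a subsample of proportion
    gamma keeps a positive fraction of its mass outside the cut and pays at least q for it. The law
    makes this stable in a neighbourhood, compactness of the unit sphere of pairs (a, b) makes it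
    uniform, and homogeneity of degree two removes the normalization. *)
Lemma uniformly_spread : exists2 delta, 0 < delta &
  \forall n \near \oo, forall (S : {set 'I_n}) (a : 'cV[R]_k) b, n%:R * gamma <= #|S|%:R ->
  #|S|%:R * (delta * (sqnorm a + b ^+ 2)) <= \sum_(i in S) ((a^T *m X i) 0 0 - b) ^+ 2.
Proof.
pose sph := [set p : 'cV[R]_k * R | sqnorm p.1 + p.2 ^+ 2 = 1].
pose Pr (i : nat * R) (p : 'cV[R]_k * R) := forall S : {set 'I_i.1},
  i.1%:R * gamma <= #|S|%:R ->
  #|S|%:R * i.2 <= \sum_(j in S) quadratic (affine_sq p.1 p.2) (X j).
(* The filter runs over pairs (n, delta), so that the covering argument makes both choices uniform
   at once. *)
have /compact_near_coveringP/(_ _ (filter_prod \oo (0 : R)^'+) Pr) := unit_sphere_compact.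
case.
  move=> [a b] /= ab1.
  have [q q0 Eq] : exists2 q, 0 < q &
      Rintegral P0 setT (clamp_quadratic (cut_param (affine_sq a b) q)) < gamma.
    by apply: affine_sq_level_cut; rewrite ab1.
  set E := Rintegral _ _ _ in Eq.
  have E0 : 0 <= E.
    apply: Rintegral_ge0 => x _.
    by case/andP: (clamp01 (quadratic (cut_param (affine_sq a b) q) x)).
  (* Half of the gap: nearby sample averages of the cut stay below E + e = gamma - e. *)
  pose e := (gamma - E) / 2.
  have e0 : 0 < e by rewrite divr_gt0 // subr_gt0.
  have [[A B] /= [nA nB] AB] := law (cut_param (affine_sq a b) q) e0.
  have cont : continuous (fun p : 'cV[R]_k * R => cut_param (affine_sq p.1 p.2) q : param).
    move=> p; exact: (continuous_comp (@affine_sq_continuous R k p) (@cut_param_continuous R k q _)).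
  have nB' : \forall p \near ((a, b) : 'cV[R]_k * R), B (cut_param (affine_sq p.1 p.2) q).
    exact: (cont (a, b) B nB).
  exists ([set p : 'cV[R]_k * R | B (cut_param (affine_sq p.1 p.2) q)],
    A `*` [set del | del < q * (e / gamma)]).
    split => //=; exists (A, [set del | del < q * (e / gamma)]) => //; split => //=.
    by apply: nbhs_right_lt; rewrite mulr_gt0 // divr_gt0.
  move=> [p [n del]] /= [Bp [An delq]] S /= gS.
  have := AB (n, _) (conj An Bp); rewrite /= -/E ltr_norml => /andP[_ avg_lt].
  have quad0 x : 0 <= quadratic (affine_sq p.1 p.2) x by rewrite quadratic_affine_sq sqr_ge0.
  have := subsample_trim S quad0 q0; set D := \sum_(i in S) _ => trim.
  have n0 : 0 <= n%:R :> R by [].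
  have avg_le : n%:R * sample_avg X (clamp_quadratic (cut_param (affine_sq p.1 p.2) q)) n <=
      n%:R * (gamma - e).
    by rewrite ler_wpM2l // ltW //; move: avg_lt; rewrite /e; lra.
  (* As n <= |S| / gamma, the cut accounts for at most the fraction 1 - e / gamma of the
     subsample. *)
  have nS : n%:R * (gamma - e) <= #|S|%:R - #|S|%:R * (e / gamma).
    have -> : #|S|%:R - #|S|%:R * (e / gamma) = #|S|%:R / gamma * (gamma - e).
      by field; rewrite gt_eqF.
    apply: ler_wpM2r; last by rewrite ler_pdivlMr.
    by rewrite /e; lra.
  have : #|S|%:R * (e / gamma) <= q^-1 * D by lra.
  rewrite ler_pdivlMl // => h; apply: le_trans h.
  by rewrite mulrCA ler_wpM2l // ltW.
move=> [A B] /= [nA nB] AB.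
have [del [del0 Bdel]] : exists del, 0 < del /\ B del.
  have : \forall d \near (0 : R)^'+, 0 < d /\ B d.
    by apply: filterI => //; exact: nbhs_right_gt.
  by move=> /(@filter_ex _ _ _)[d]; exists d.
exists del => //; apply: filterS nA => n An S a b gS.
have [ab0|ab0] := eqVneq (sqnorm a + b ^+ 2) 0.
  by rewrite ab0 mulr0 mulr0 sumr_ge0 // => i _; rewrite sqr_ge0.
have N0 : 0 < sqnorm a + b ^+ 2 by rewrite lt_def ab0 addr_ge0 ?sqnorm_ge0 ?sqr_ge0.
set N := sqnorm a + b ^+ 2 in ab0 N0 *.
(* Dividing (a, b) by s puts the pair on the unit sphere and divides both sides by N. *)
pose s := Num.sqrt N; have s0 : 0 < s by rewrite sqrtr_gt0.
have s2 : s ^+ 2 = N by rewrite sqr_sqrtr // ltW.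
have := AB (n, del) (conj An Bdel) (s^-1 *: a, s^-1 * b).
rewrite /= /Pr /= => /(_ _ S gS).
have -> : \sum_(j in S) quadratic (affine_sq (s^-1 *: a) (s^-1 * b)) (X j) =
    N^-1 * \sum_(i in S) ((a^T *m X i) 0 0 - b) ^+ 2.
  rewrite mulr_sumr; apply: eq_bigr => i _; rewrite quadratic_affine_sq.
  rewrite [(s^-1 *: a)^T]linearZ /= -scalemxAl mxE -mulrBr exprMn exprVn s2 //.
rewrite ler_pdivlMl // => h; rewrite mulrA mulrC; apply: h.
rewrite /sqnorm; under eq_bigr do rewrite mxE exprMn.
rewrite -mulr_sumr exprMn -mulrDr -/(sqnorm a) -/N exprVn s2 mulVf //.
Qed.

End spread.

(** * Trimming at a quantile *)

Lemma invSn_lt (R : realType) (e : R) : 0 < e -> exists m : nat, m.+1%:R^-1 < e.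
Proof.
move=> e0; exists (Num.truncn e^-1); have e1 : 0 < e^-1 by rewrite invr_gt0.
have /andP[_ h] := truncn_itv (ltW e1).
by rewrite -[X in _ < X]invrK ltf_pV2 ?posrE.
Qed.

Section trimmed_function.
Context d0 (T : measurableType d0) (R : realType) (Q : probability T R).
Variables (d : T -> R) (gamma K : R).
Hypotheses (md : measurable_fun setT d) (d_ge0 : forall x, 0 <= d x).
Hypotheses (gamma01 : 0 < gamma <= 1) (K0 : 0 <= K).
Hypothesis cutK : forall q, 0 < q ->
  gamma * (1 - K / q) <= Rintegral Q setT (fun x => clamp (1 - d x / q)).

Let cut q x := clamp (1 - d x / q).

Let mcut q : measurable_fun setT (cut q).
Proof.
apply: measurable_maxr => //; apply: measurable_minr => //.
by apply: measurable_funB => //; exact: measurable_funM.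
Qed.

Let icut q : Q.-integrable setT (EFin \o cut q).
Proof.
apply: (@integrable_bounded _ _ _ Q _ 1 (@mcut q)) => x.
by have /andP[c0 c1] := clamp01 (1 - d x / q); rewrite ger0_norm.
Qed.

Let icst r : Q.-integrable setT (EFin \o cst r).
Proof. exact: finite_measure_integrable_cst. Qed.

Let Ecst (r : R) : Rintegral Q setT (cst r) = r.
Proof. by rewrite Rintegral_cst //= probability_setT mulr1. Qed.

(** Full mass has no finite quantile when d is essentially unbounded. Instead q (1 - cut q) = min(d,
    q) has integral at most K by [cutK], and increases to d. *)
Lemma trimmed_function_full : gamma = 1 ->
  Q.-integrable setT (EFin \o d) /\ Rintegral Q setT d <= K.
Proof.
move=> g1; have dE : (\int[Q]_x (d x)%:E <= K%:E)%E.
  pose g (n : nat) x := (n.+1%:R * (1 - cut n.+1%:R x))%:E.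
  have gE n x : g n x = (Num.min (d x) n.+1%:R)%:E.
    rewrite /g /cut; congr EFin.
    have n0 : 0 < n.+1%:R :> R by rewrite ltr0n.
    have [dn|dn] := leP (d x) n.+1%:R.
      rewrite clamp_id; first by field; rewrite gt_eqF.
      by rewrite subr_ge0 ler_pdivrMr // mul1r dn gerBl divr_ge0.
    by rewrite clamp_le0 ?subr0 ?mulr1 // subr_le0 ler_pdivlMr // mul1r ltW.
  have mg n : measurable_fun setT (g n).
    by apply/measurable_EFinP/measurable_funM => //; exact: measurable_funB.
  have gd x : limn (g^~ x) = (d x)%:E.
    apply/cvg_lim => //; apply: cvg_near_cst.
    exists (Num.truncn (d x)) => // n /= dn; rewrite gE min_l //.
    have /andP[_ /ltW] := truncn_itv (d_ge0 x); move=> /le_trans; apply.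
    by rewrite ler_nat ltnS.
  have g_ge0 n x : setT x -> (0 <= g n x)%E.
    by move=> _; rewrite gE lee_fin le_min d_ge0 ler0n.
  have g_nd x : setT x -> {homo g^~ x : m n / (m <= n)%N >-> (m <= n)%E}.
    move=> _ m n mn; rewrite !gE lee_fin le_min ge_min lexx /= ge_min.
    by rewrite ler_nat ltnS mn orbT.
  rewrite (eq_integral (fun x => limn (g^~ x))) => [|x _]; last by rewrite gd.
  rewrite monotone_convergence //; apply: lime_le.
    apply: ereal_nondecreasing_is_cvgn => m n mn.
    by apply: ge0_le_integral => // x _; [exact: g_ge0|exact: g_nd].
  apply: nearW => n; have n0 : 0 < n.+1%:R :> R by rewrite ltr0n.
  have ig : Q.-integrable setT (EFin \o (fun x => 1 - cut n.+1%:R x)).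
    by exact: (integrableB measurableT (icst 1) (icut n.+1%:R)).
  have Eg : Rintegral Q setT (fun x => n.+1%:R * (1 - cut n.+1%:R x)) <= K.
    rewrite RintegralZl // (RintegralB _ (icst 1) (icut _)) // Ecst.
    have := cutK n0; rewrite g1 mul1r -/(cut _) => h.
    by rewrite -ler_pdivlMl // mulrC lerBlDr addrC -lerBlDr; exact: h.
  rewrite -lee_fin in Eg; apply: le_trans Eg; rewrite /Rintegral fineK //.
  exact: (integrable_fin_num _ (integrable_RZl n.+1%:R ig)).
have id : Q.-integrable setT (EFin \o d).
  apply/integrableP; split; first exact/measurable_EFinP.
  rewrite (eq_integral (EFin \o d)) => [|x _]; last by rewrite gee0_abs ?lee_fin.
  by apply: le_lt_trans dE _; rewrite ltry.
by split=> //; rewrite -lee_fin fineK // (integrable_fin_num _ id).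
Qed.

(** For gamma < 1, phi is the indicator of d < q0 at the gamma-quantile q0, plus a fraction of the
    level set d = q0 to reach mass gamma. Then d phi = q0 phi - q0 cut q0 pointwise, so [cutK] at
    the single level q0 gives q0 gamma - q0 gamma (1 - K / q0) = K gamma. *)
Lemma trimmed_function : exists phi : T -> R,
  [/\ measurable_fun setT phi, forall x, 0 <= phi x <= 1,
    Rintegral Q setT phi = gamma,
    Q.-integrable setT (EFin \o (fun x => d x * phi x)) &
    Rintegral Q setT (fun x => d x * phi x) <= K * gamma].
Proof.
have /andP[g0 g1] := gamma01; move: g1; rewrite le_eqVlt => /orP[/eqP g1|g1].
  have [id dK] := trimmed_function_full g1.
  exists (cst 1); split => //.
  - by move=> x; rewrite ler01 lexx.
  - by rewrite Ecst.
  - by apply: eq_integrable id => // x _ /=; rewrite mulr1.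
  by under eq_Rintegral do rewrite mulr1; rewrite g1 mulr1.
pose A := [set q | (gamma%:E <= Q [set x | (d x <= q)%R])%E].
have mle q : measurable [set x | d x <= q] by exact: measurable_level_le.
have Qfin B : measurable B -> Q B \is a fin_num by move=> mB; exact: fin_num_measure.
have Aup q r : q <= r -> A q -> A r.
  move=> qr /le_trans; apply; apply: le_measure; rewrite ?inE //.
  by move=> x /= /le_trans; apply.
have A0 q : A q -> 0 <= q.
  move=> Aq; rewrite leNgt; apply/negP => q0; move: Aq; rewrite /A /=.
  rewrite (_ : mkset _ = set0) ?measure0 ?leNgt ?lte_fin ?g0 //.
  by apply/seteqP; split => // x /= dq; have := d_ge0 x; lra.
have Anonempty : A !=set0.
  have e0 : 0 < 1 - gamma by rewrite subr_gt0.
  have [M QM] := tail_small Q md e0; exists M%:R; rewrite /A /=.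
  rewrite -[X in Q X]setCK probability_setC; last exact: measurableC.
  rewrite leeBrDr; last by apply: Qfin; exact: measurableC.
  have : (Q (~` [set x | (d x <= M%:R)%R]) <= (1 - gamma)%:E)%E.
    apply: le_trans (ltW QM); apply: le_measure; rewrite ?inE.
    - exact: measurableC.
    - exact: measurable_level_ge.
    by move=> x /= /negP; rewrite -ltNge => /ltW.
  move=> h; apply: (le_trans (leeD2l _ h)).
  by rewrite -EFinD addrC subrK.
have Ainf : has_inf A by split=> //; exists 0 => q /A0.
pose q0 := inf A.
have q00 : 0 <= q0 by apply: lb_le_inf => // q /A0.
have mlt : measurable [set x | d x < q0].
  rewrite (_ : mkset _ = ~` [set x | q0 <= d x]); first exact/measurableC/measurable_level_ge.
  by apply/seteqP; split => x /=; rewrite ltNge => /negP.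
have meq : measurable [set x | d x = q0].
  rewrite (_ : mkset _ = [set x | d x <= q0] `&` [set x | q0 <= d x]).
    by apply: measurableI => //; exact: measurable_level_ge.
  apply/seteqP; split => x /= => [->//|[d1 d2]]; by apply/eqP; rewrite eq_le d1.
have Aq0 : A q0.
  pose F (m : nat) := [set x | d x <= q0 + m.+1%:R^-1].
  have mF m : measurable (F m) by exact: mle.
  have capF : \bigcap_m F m = [set x | (d x <= q0)%R].
    apply/seteqP; split=> x /= Fx; last first.
      by move=> m _; rewrite /F /=; apply: le_trans Fx _; rewrite lerDl invr_ge0.
    apply/ler_addgt0Pr => e /invSn_lt[m me]; apply: le_trans (Fx m I) _.
    by rewrite lerD2l ltW.
  have : Q (F m) @[m --> \oo] --> Q (\bigcap_m F m).
    apply: nonincreasing_cvg_mu => //; first by rewrite -ge0_fin_numE ?Qfin //; exact: mle.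
      by rewrite capF.
    move=> m n mn; apply/subsetPset => x /=; rewrite /F /= => /le_trans; apply.
    by rewrite lerD2l lef_pV2 ?posrE // ler_nat.
  rewrite capF => cvgF; rewrite /A /=.
  rewrite -(cvg_lim _ cvgF) //; apply: lime_ge; first by apply/cvg_ex; eexists; exact: cvgF.
  apply: nearW => m; have m0 : 0 < m.+1%:R^-1 :> R by rewrite invr_gt0.
  by have [q Aq /ltW/Aup] := inf_adherent m0 Ainf; exact.
have lt_le : (Q [set x | (d x < q0)%R] <= gamma%:E)%E.
  pose F (m : nat) := [set x | d x <= q0 - m.+1%:R^-1].
  have mF m : measurable (F m) by exact: mle.
  have cupF : \bigcup_m F m = [set x | (d x < q0)%R].
    apply/seteqP; split=> x /=.
      move=> [m _]; rewrite /F /= => /le_lt_trans; apply.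
      by rewrite gtrDl oppr_lt0 invr_gt0.
    rewrite -subr_gt0 => /invSn_lt[m me]; exists m => //; rewrite /F /=.
    by rewrite lerBrDr -lerBrDl ltW.
  have : Q (F m) @[m --> \oo] --> Q (\bigcup_m F m).
    apply: nondecreasing_cvg_mu => //; first by rewrite cupF.
    move=> m n mn; apply/subsetPset => x /=; rewrite /F /= => /le_trans; apply.
    by rewrite lerD2l lerN2 lef_pV2 ?posrE // ler_nat.
  rewrite cupF => cvgF.
  rewrite -(cvg_lim _ cvgF) //; apply: lime_le; first by apply/cvg_ex; eexists; exact: cvgF.
  apply: nearW => m; rewrite leNgt; apply/negP => /ltW Am0.
  have Am : A (q0 - m.+1%:R^-1) by [].
  have := ge_inf (proj2 Ainf) Am; rewrite -/q0 lerDl oppr_ge0 => h.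
  have : 0 < m.+1%:R^-1 :> R by rewrite invr_gt0.
  by rewrite ltNge h.
pose m1 := fine (Q [set x | (d x < q0)%R]).
pose m2 := fine (Q [set x | d x = q0]).
have m1E : Q [set x | d x < q0] = m1%:E by rewrite fineK // Qfin.
have m2E : Q [set x | d x = q0] = m2%:E by rewrite fineK // Qfin.
have m1g : m1 <= gamma by rewrite -lee_fin -m1E.
have gm12 : gamma <= m1 + m2.
  rewrite -lee_fin EFinD -m1E -m2E; apply: le_trans Aq0 _.
  apply: le_trans (measureU2 Q mlt meq); apply: le_measure; rewrite ?inE //.
    exact: measurableU.
  by move=> x /=; rewrite le_eqVlt => /orP[/eqP ->|]; [right|left].
have m20 : 0 <= m2 by rewrite -lee_fin -m2E.
(* If m2 = 0, division by zero gives c = 0, which is right because m1 = gamma in that case. *)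
pose c := (gamma - m1) / m2.
have cm2 : c * m2 = gamma - m1.
  have [m2_0|m2_0] := eqVneq m2 0; last by rewrite divfK.
  by rewrite m2_0 mulr0; lra.
have c01 : 0 <= c <= 1.
  rewrite divr_ge0 ?subr_ge0 //=; have [m2_0|m2_0] := eqVneq m2 0.
    by rewrite /c m2_0 invr0 mulr0.
  rewrite ler_pdivrMr ?mul1r; first by lra.
  by rewrite lt_def m2_0.
pose phi x : R := \1_[set x | d x < q0] x + c * \1_[set x | d x = q0] x.
have phiE x : phi x = (d x < q0)%R%:R + c * (d x == q0)%R%:R.
  have b1 : (x \in [set y | d y < q0]) = (d x < q0).
    by apply/idP/idP => [/set_mem|?]; [|exact/mem_set].
  have b2 : (x \in [set y | d y = q0]) = (d x == q0).
    by apply/idP/idP => [/set_mem/eqP|/eqP ?]; [|exact/mem_set].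
  by rewrite /phi !indicE b1 b2.
have i1 : Q.-integrable setT (EFin \o \1_[set x | d x < q0]) by exact: integrable_indic.
have i2 : Q.-integrable setT (EFin \o \1_[set x | d x = q0]) by exact: integrable_indic.
have iphi : Q.-integrable setT (EFin \o phi).
  exact: (integrable_RD i1 (integrable_RZl c i2)).
have Ephi : Rintegral Q setT phi = gamma.
  rewrite RintegralD //; last exact: integrable_RZl.
  have E1 : Rintegral Q setT (\1_[set x | d x < q0]) = m1.
    by rewrite /Rintegral integral_indic // setIT.
  have E2 : Rintegral Q setT (\1_[set x | d x = q0]) = m2.
    by rewrite /Rintegral integral_indic // setIT.
  by rewrite RintegralZl // E1 E2 cm2 addrC subrK.
(* Below q0, phi is 1 and q0 cut q0 = q0 - d; at q0 and above, q0 cut q0 vanishes. If q0 = 0, the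
   cut is 1 by division by zero, but the factor q0 cancels it. *)
have dphi x : d x * phi x = q0 * phi x - q0 * cut q0 x.
  rewrite phiE /cut; have [dq|dq|dq] := ltgtP (d x) q0.
  - have q00' : 0 < q0 by exact: le_lt_trans dq.
    rewrite clamp_id; first by rewrite mulr0 addr0 !mulr1; field; rewrite gt_eqF.
    by rewrite subr_ge0 ler_pdivrMr // mul1r ltW //= gerBl divr_ge0.
  - rewrite mulr0 addr0 !mulr0 sub0r; have [->|q0n] := eqVneq q0 0.
      by rewrite mul0r oppr0.
    rewrite clamp_le0 ?mulr0 ?oppr0 // subr_le0 ler_pdivlMr ?mul1r ?ltW //.
    by rewrite lt_def q0n.
  rewrite dq; have [->|q0n] := eqVneq q0 0; first by rewrite !mul0r subr0.
  by rewrite clamp_le0 ?divff ?subrr // mulr0 subr0.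
exists phi; split => //.
- by have /measurable_EFinP := measurable_int _ iphi.
- by move=> x; rewrite phiE; case: ltgtP => _ /=;
    rewrite ?mulr0 ?mulr1 ?addr0 ?add0r ?lexx ?ler01.
- rewrite (funext dphi).
  by apply: (integrable_RD (integrable_RZl q0 iphi)); have := integrable_RZl (- q0) (icut q0);
    apply: eq_integrable => // x _ /=; rewrite mulNr.
rewrite (funext dphi) RintegralB //; [|exact: integrable_RZl..].
rewrite !RintegralZl // Ephi.
have [->|q0n] := eqVneq q0 0; first by rewrite !mul0r subr0 mulr_ge0 // ltW.
have q0p : 0 < q0 by rewrite lt_def q0n.
have := ler_wpM2l q00 (cutK q0p); rewrite -/(cut q0).
have -> : q0 * (gamma * (1 - K / q0)) = q0 * gamma - K * gamma by field.
by move=> h; rewrite lerBlDr addrC -lerBlDr; exact: h.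
Qed.

End trimmed_function.

(** * Coefficient bounds for Mahalanobis quadratics *)

Section moment_bounds.
Variables (R : realType) (k : nat).
Implicit Types (a : 'cV[R]_k) (b : R).

Lemma moments_affine_sq (L : ('cV[R]_k -> R) -> R) T C a b : moments L T C ->
  L (quadratic (affine_sq a b)) = quad_form C a + ((a^T *m T) 0 0 - b) ^+ 2.
Proof.
case=> _ ->; rewrite /= mulmxDr mxtraceD [((- 2 * b) *: a)^T]linearZ /= -scalemxAl.
have -> : \tr (a *m a^T *m C) = quad_form C a.
  by rewrite -mulmxA mxtrace_mulC trace_mx11.
have -> : \tr (a *m a^T *m (T *m T^T)) = (a^T *m T) 0 0 ^+ 2.
  rewrite mulmxA mxtrace_mulC -(mulmxA a) (mulmxA T^T).
  have -> : T^T *m a = (a^T *m T)^T by rewrite trmx_mul trmxK.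
  move: (a^T *m T) => y; rewrite trace_mx11 mxE big_ord1 !mxE expr2 //.
move: (a^T *m T) => y; rewrite !mxE; ring.
Qed.

Lemma sqnorm_gt0 a : a != 0 -> 0 < sqnorm a.
Proof.
move=> a0; rewrite lt_def sqnorm_ge0 andbT; apply: contra_neq a0 => sa.
apply/colP => i; rewrite mxE; apply/eqP; rewrite -sqrf_eq0 eq_le sqr_ge0 andbT.
by rewrite -sa coord_sq_le_sqnorm.
Qed.

(* The hypothesis bounds the matrix of second moments of (X, 1) from below by delta I. *)
Lemma mahalanobis_bounded (C : 'M[R]_k) T delta : pd C -> 0 < delta ->
  (forall a b, delta * (sqnorm a + b ^+ 2) <= quad_form C a + ((a^T *m T) 0 0 - b) ^+ 2) ->
  let t := mahalanobis (invmx C) T in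
  [/\ forall i j, `|t.1.1 i j| <= 2 / delta, forall i j, `|t.1.2 i j| <= 2 / delta &
      `|t.2| <= 2 / delta].
Proof.
move=> Cp delta0 Cdelta; set M := invmx C; have uC := pd_unit Cp.
have [Ms Mp] := pd_invmx Cp; rewrite -/M in Ms Mp.
have CM y : quad_form C (M *m y) = quad_form M y.
  by rewrite /quad_form trmx_mul Ms !mulmxA mulmxKV.
(* Test the hypothesis at a = M y and b = a'T, which cancels the square on the right. *)
have key y : delta * (sqnorm (M *m y) + ((M *m y)^T *m T) 0 0 ^+ 2) <= quad_form M y.
  by have := Cdelta (M *m y) (((M *m y)^T *m T) 0 0); rewrite subrr expr0n addr0 CM.
have bound (y : 'cV[R]_k) i (c : R) : `|c| <= `|(M *m y) i 0| -> quad_form M y <= delta^-1 ->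
    `|c| <= delta^-1.
  move=> cy My; apply: le_trans cy _.
  have h1 := coord_sq_le_sqnorm (M *m y) i.
  have h2 := le_trans (key y) My.
  have h3 := sqr_ge0 (((M *m y)^T *m T) 0 0).
  have : ((M *m y) i 0) ^+ 2 <= delta^-1 ^+ 2.
    rewrite -(ler_pM2l delta0) (_ : delta * delta^-1 ^+ 2 = delta^-1); last by field; rewrite gt_eqF.
    by apply: le_trans h2; rewrite ler_wpM2l ?(ltW delta0) // (le_trans h1) // lerDl.
  by rewrite -[X in X <= _]real_normK ?num_real // ler_pXn2r ?nnegrE // invr_ge0 ltW.
have twice : delta^-1 <= 2 / delta by rewrite ler_peMl ?ler1n // invr_ge0 ltW.
(* For y = e_j the number y'My is a coordinate of M y, and for y = T it is (M y)'T. In both cases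
   [key] gives delta (y'My)^2 <= y'My. *)
have quad_le y : sqnorm (M *m y) >= quad_form M y ^+ 2 \/
    (((M *m y)^T *m T) 0 0) ^+ 2 >= quad_form M y ^+ 2 -> quad_form M y <= delta^-1.
  move=> h; have h3 := sqr_ge0 (((M *m y)^T *m T) 0 0); have h4 := sqnorm_ge0 (M *m y).
  have : delta * quad_form M y ^+ 2 <= quad_form M y.
    by apply: le_trans (key y); rewrite ler_wpM2l ?(ltW delta0) //; case: h; lra.
  have [q0|q0 _] := ltP 0 (quad_form M y); last by rewrite (le_trans q0) // invr_ge0 ltW.
  by rewrite expr2 mulrA -[X in _ <= X -> _]mul1r ler_pM2r // -ler_pdivlMl // mulr1.
have diag_le j : quad_form M (delta_mx j 0) <= delta^-1.
  apply: quad_le; left.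
  have -> : quad_form M (delta_mx j 0) = (M *m (delta_mx j 0 : 'cV[R]_k)) j 0.
    by rewrite /quad_form trmx_delta -mulmxA -rowE mxE.
  exact: coord_sq_le_sqnorm.
have T_le : quad_form M T <= delta^-1.
  by apply: quad_le; right; rewrite /quad_form trmx_mul Ms.
split => /=.
- move=> i j; apply: (le_trans _ twice); apply: (bound (delta_mx j 0) i _ _ (diag_le j)).
  by rewrite -colE mxE.
- move=> i j; rewrite (ord1 j) mxE normrM normrN normr_nat ler_pM2l //.
  exact: (bound T i _ (lexx _) T_le).
apply: (le_trans _ twice); rewrite ger0_norm //.
by have [->|/Mp/ltW//] := eqVneq T 0; rewrite quad_form0.
Qed.

End moment_bounds.

(** The clamp of this quadratic interpolates between the indicators of t <= s^2 and t <= s'^2, and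
    falls under the uniform law. *)
Definition level_param (R : realType) k (t : 'M[R]_k * 'cV[R]_k * R) (s s' : R) :=
  cut_param (t.1.1, t.1.2, t.2 - s ^+ 2) (s' ^+ 2 - s ^+ 2).

Lemma clamp_level (R : realType) k (t : 'M[R]_k * 'cV[R]_k * R) s s' x : 0 <= s < s' ->
  (quadratic t x <= s ^+ 2 -> clamp_quadratic (level_param t s s') x = 1) /\
  (s' ^+ 2 <= quadratic t x -> clamp_quadratic (level_param t s s') x = 0).
Proof.
move=> /andP[s0 ss']; have q0 : 0 < s' ^+ 2 - s ^+ 2.
  by rewrite subr_gt0 ltr_pXn2r // nnegrE ltW // (le_lt_trans s0).
have E : quadratic (level_param t s s') x =
    1 - (quadratic t x - s ^+ 2) / (s' ^+ 2 - s ^+ 2).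
  by rewrite quadratic_cut /quadratic /=; congr (1 - _ / _); ring.
rewrite /clamp_quadratic E; split=> tx.
  by rewrite clamp_ge1 // lerDl oppr_ge0 mulr_le0_ge0 ?subr_le0 // invr_ge0 ltW.
by rewrite clamp_le0 // subr_le0 ler_pdivlMr // mul1r lerD2r.
Qed.

(** * Subsamples of closest points *)

Section order_statistics.
Variables (R : realType) (n : nat) (d psi : 'I_n -> R).

(** The h smallest values described by a threshold q instead of a sorting; ties at q may fall on
    either side. Each step adds a minimizer over the remaining indices. *)
Lemma order_statistic h : (h <= n)%N -> (forall i, 0 <= d i) ->
  exists (A : {set 'I_n}) q, [/\ #|A| = h, 0 <= q,
    forall i, i \in A -> d i <= q & forall i, i \notin A -> q <= d i].
Proof.
move=> + d0; elim: h => [_|h IH hn].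
  by exists finset.set0, 0; split=> // [|i]; [rewrite cards0|rewrite finset.in_set0].
have [A [q [Ah q0 Aq Acq]]] := IH (ltnW hn).
have [i iA] : exists i, i \notin A.
  apply/existsP; apply: contraTT hn => /existsPn allA; rewrite -leqNgt -Ah.
  rewrite -{1}(card_ord n); apply/subset_leq_card/fintype.subsetP => i _.
  by have := allA i; rewrite negbK.
have [j jA jmin] := @arg_minP _ _ _ i (fun i => i \notin A) d iA.
exists (j |: A), (d j); split=> // [|l|l].
- by rewrite cardsU1 jA Ah.
- rewrite !inE => /orP[/eqP->//|/Aq/le_trans]; apply; exact: Acq.
- by rewrite !inE negb_or => /andP[_]; exact: jmin.
Qed.

(** A Neyman-Pearson comparison: (1_A - psi)(q - d) >= 0 at every index. *)
Lemma subsample_sum_le (A : {set 'I_n}) q : (forall i, 0 <= psi i <= 1) ->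
  (forall i, i \in A -> d i <= q) -> (forall i, i \notin A -> q <= d i) ->
  \sum_(i in A) d i <= \sum_i d i * psi i + q * (#|A|%:R - \sum_i psi i).
Proof.
move=> psi01 Aq Acq; rewrite -sumr_const mulrBr !mulr_sumr [\sum_(i in A) d i]big_mkcond.
rewrite [\sum_(i in A) _]big_mkcond -sumrB -big_split /=; apply: ler_sum => i _.
have /andP[p0 p1] := psi01 i; case: ifPn => iA.
  have : 0 <= (1 - psi i) * (q - d i) by rewrite mulr_ge0 ?subr_ge0 // Aq.
  by rewrite mulr1; lra.
have : 0 <= psi i * (d i - q) by rewrite mulr_ge0 ?subr_ge0 // Acq.
by lra.
Qed.

End order_statistics.

Section subsample_determinant.
Variables (R : realType) (k : nat) (X : nat -> 'cV[R]_k).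

(* The competitor of a minimizing subsample consists of the points that are closest to
   the center of the functional. *)
Lemma close_subsample (t : 'M[R]_k * 'cV[R]_k * R) (beta c : R) (psi : 'cV[R]_k -> R) :
  0 < beta -> 0 <= c -> (forall x, 0 <= quadratic t x) -> (forall x, 0 <= psi x <= 1) ->
  (forall e, 0 < e -> \forall n \near \oo,
    \sum_(i < n) quadratic t (X i) * psi (X i) <= n%:R * (beta * c + e)) ->
  (forall e, 0 < e -> \forall n \near \oo, n%:R * (beta - e) <= \sum_(i < n) psi (X i)) ->
  (beta = 1 /\ (forall x, psi x = 1)) \/
    (exists m e, 0 < e /\ \forall n \near \oo,
      n%:R * (beta + e) <= #|[pred i : 'I_n | (quadratic t (X i) <= m)%R]|%:R) ->
  forall e, 0 < e -> \forall n \near \oo, exists A : {set 'I_n},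
    n%:R * beta <= #|A|%:R /\ \sum_(i in A) quadratic t (X i) <= #|A|%:R * (c + e).
Proof.
move=> beta0 c0 t0 psi01 mean_le mass_ge bulk e e0.
case: bulk => [[beta1 psi1]|[m [e1 [e10 bulk]]]].
  apply: filterS (mean_le _ e0) => n; rewrite beta1 mul1r mulr1 => le_n.
  exists finset.setT; rewrite cardsT card_ord; split=> //; apply: le_trans le_n.
  by rewrite le_eqVlt; apply/orP; left; apply/eqP; apply: eq_big => [i|i _];
    rewrite ?inE // psi1 mulr1.
pose m' := `|m|; have m'0 : 0 <= m' by rewrite normr_ge0.
(* The errors in mean and mass contribute at most n e2 (1 + m') = n beta e / 2, as the threshold q
   is at most m'. The leftover m' comes from rounding and is below n beta e / 2 for large n. *)
pose e2 := beta * e / (2 * (1 + m')).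
have den0 : 0 < 2 * (1 + m') by rewrite mulr_gt0 // ltr_pwDl.
have e20 : 0 < e2 by rewrite divr_gt0 // mulr_gt0.
near=> n.
have n_e1 : 2 <= n%:R * e1.
  rewrite -ler_pdivrMr //; near: n; exact: nbhs_infty_ger.
have n_e : 2 * m' <= n%:R * (beta * e).
  rewrite -ler_pdivrMr ?mulr_gt0 //; near: n; exact: nbhs_infty_ger.
have mean_n : \sum_(i < n) quadratic t (X i) * psi (X i) <= n%:R * (beta * c + e2).
  by near: n; exact: mean_le.
have mass_n : n%:R * (beta - e2) <= \sum_(i < n) psi (X i) by near: n; exact: mass_ge.
have bulk_n : n%:R * (beta + e1) <= #|[pred i : 'I_n | (quadratic t (X i) <= m)%R]|%:R.
  by near: n.
have nb0 : 0 <= n%:R * beta by rewrite mulr_ge0 // ltW.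
pose h := (Num.truncn (n%:R * beta)).+1.
have h_ge : n%:R * beta < h%:R by rewrite truncnS_gt.
have h_le : h%:R <= n%:R * beta + 1 by rewrite /h -natr1 lerD2r truncn_le.
have h_lt : (h < #|[pred i : 'I_n | (quadratic t (X i) <= m)%R]|)%N.
  rewrite -(ltr_nat R); apply: lt_le_trans bulk_n; rewrite mulrDr; lra.
have hn : (h <= n)%N.
  by rewrite -[leqRHS](card_ord n) (leq_trans (ltnW h_lt)) // max_card.
have [A [q [Ah q0 Aq Acq]]] := order_statistic hn (fun i => t0 (X i)).
have qm : q <= m'.
  (* More than h points lie below level m, so one of them is outside A and bounds the threshold
     q. *)
  have [i iB iA] : exists2 i, i \in [pred i : 'I_n | (quadratic t (X i) <= m)%R] & i \notin A.
    apply/fintype.subsetPn; apply: contraTN h_lt => /subset_leq_card; rewrite Ah -leqNgt; exact.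
  by apply: le_trans (Acq _ iA) _; move: iB; rewrite inE => /le_trans; apply; exact: ler_norm.
exists A; rewrite Ah; split; first exact: ltW.
have := subsample_sum_le (fun i => psi01 (X i)) Aq Acq; rewrite Ah.
move=> le_A.
have le_q : q * (h%:R - \sum_(i < n) psi (X i)) <= m' * (1 + n%:R * e2).
  apply: (@le_trans _ _ (q * (1 + n%:R * e2))); last by rewrite ler_wpM2r // addr_ge0 // mulr_ge0 // ltW.
  by rewrite ler_wpM2l // -(lerD2r (\sum_(i < n) psi (X i))) subrK; lra.
have e2E : e2 * (1 + m') = beta * e / 2.
  by rewrite /e2; field; lra.
have : n%:R * (e2 * (1 + m')) = n%:R * (beta * e / 2) by rewrite e2E.
have : n%:R * beta * (c + e) <= h%:R * (c + e).
  by rewrite ler_wpM2r ?(ltW h_ge) // addr_ge0 // ltW.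
by lra.
Unshelve. all: by end_near. Qed.

Lemma psd_cov_hat n (A : {set 'I_n}) : (0 < #|A|)%N -> psd (cov_hat X A).
Proof.
move=> A0; apply: (moments_psd (moments_sample X A0)) => t t0.
by rewrite mulr_ge0 ?invr_ge0 // sumr_ge0.
Qed.

(** The average of the quadratic is tr (M C) plus the nonnegative form of the offset of the means;
    the determinant inequality applies to M / c. *)
Lemma det_cov_hat_le n (A : {set 'I_n}) (M : 'M[R]_k) mu c : pd M -> 0 < c -> (0 < #|A|)%N ->
  \sum_(i in A) quadratic (mahalanobis M mu) (X i) <= #|A|%:R * (k%:R * c) ->
  \det M * \det (cov_hat X A) <= c ^+ k.
Proof.
move=> Mp c0 A0 sum_le; have [Ms M0] := pd_psd Mp.
have A0' : 0 < #|A|%:R :> R by rewrite ltr0n.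
have Mc : pd (c^-1 *: M).
  split=> [|x /(proj2 Mp) qx]; first by rewrite [(c^-1 *: M)^T]linearZ /= Ms.
  rewrite /quad_form -scalemxAr -scalemxAl mxE mulr_gt0 ?invr_gt0 //.
have tr_le : \tr (c^-1 *: M *m cov_hat X A) <= k%:R.
  rewrite -scalemxAl mxtraceZ ler_pdivrMl // [c * _]mulrC.
  have := moments_mahalanobis mu (moments_sample X A0) Ms.
  have := M0 (mean_hat X A - mu).
  have : #|A|%:R^-1 * \sum_(i in A) quadratic (mahalanobis M mu) (X i) <= k%:R * c.
    by rewrite ler_pdivrMl.
  by lra.
have [+ _] := pd_psd_tr_det Mc (psd_cov_hat A0) tr_le.
by rewrite detZ -mulrA exprVn ler_pdivrMl ?exprn_gt0 // mulr1.
Qed.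

End subsample_determinant.

(** * Convergence of minimizing subsamples *)

Lemma quad_form_cauchy_schwarz (R : realType) n (M : 'M[R]_n) x y : pd M ->
  ((y^T *m M *m x) 0 0) ^+ 2 <= quad_form M x * quad_form M y.
Proof.
move=> Mp; have [Ms M0] := pd_psd Mp; have [->|/(proj2 Mp) qy] := eqVneq y 0.
  by rewrite trmx0 mul0mx mul0mx mxE expr0n quad_form0 mulr0.
set b := (y^T *m M *m x) 0 0.
have := M0 (x + (- b / quad_form M y) *: y).
rewrite quad_formD // quad_formZ [((- b / _) *: y)^T]linearZ /= -!scalemxAl mxE -/b.
have -> : quad_form M x + 2 * (- b / quad_form M y * b) +
    (- b / quad_form M y) ^+ 2 * quad_form M y = quad_form M x - b ^+ 2 / quad_form M y.
  by field; rewrite gt_eqF.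
by rewrite subr_ge0 ler_pdivrMr.
Qed.

(** The coordinate x_i is the M-inner product of x with M^-1 e_i, whose squared M-norm is the i-th
    diagonal entry of M^-1; apply Cauchy-Schwarz and sum. *)
Lemma pd_coercive (R : realType) n (M : 'M[R]_n) : pd M ->
  forall x, sqnorm x <= \tr (invmx M) * quad_form M x.
Proof.
move=> Mp x; rewrite /sqnorm mulr_suml; apply: ler_sum => i _.
have uM := pd_unit Mp; have [Ms _] := Mp.
have := quad_form_cauchy_schwarz x (invmx M *m (delta_mx i 0 : 'cV[R]_n)) Mp.
have -> : ((invmx M *m (delta_mx i 0 : 'cV[R]_n))^T *m M *m x) 0 0 = x i 0.
  by rewrite trmx_mul trmx_inv Ms mulmxKV // trmx_delta -rowE mxE.
move=> /le_trans; apply; rewrite mulrC le_eqVlt; apply/orP; left; apply/eqP; congr (_ * _).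
rewrite /quad_form trmx_mul trmx_inv Ms mulmxKV // trmx_delta -rowE mxE -colE mxE //.
Qed.

Lemma sqnorm_le (R : realType) n (x y : 'cV[R]_n) :
  sqnorm x <= 2 * sqnorm (x - y) + 2 * sqnorm y.
Proof.
rewrite /sqnorm !mulr_sumr -big_split; apply: ler_sum => i _ /=.
by rewrite !mxE; have := sqr_ge0 (x i 0 - 2 * y i 0); nra.
Qed.

Section mcd_deterministic.
Variables (R : realType) (k : nat) (gamma : R) (P0 : probability 'cV[R]_k R).
Hypothesis k_gt0 : (0 < k)%N.
Hypothesis gamma01 : 0 < gamma <= 1.
Hypothesis hyperplane_lt : forall H, hyperplane H -> (P0 H < gamma%:E)%E.
Local Notation param := ('M[R]_k * 'cV[R]_k * R)%type.

Let gamma0 : 0 < gamma. Proof. by case/andP: gamma01. Qed.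

(** Trimming under P0: phi is at most the cut of (a'x - b)^2 plus q^-1 (a'x - b)^2 phi. The cut
    integrates to less than gamma and phi to at least gamma, so the second term has positive
    integral. *)
Lemma mcd_cov_pd phi : mcd_class P0 gamma phi -> pd (mcd_cov P0 phi).
Proof.
move=> cphi; have mom := mcd_class_moments gamma0 cphi.
have beta_ge := mcd_class_mass cphi.
have [mphi phi01 _ _] := cphi.
set beta := Rintegral P0 setT phi in mom beta_ge.
have beta0 : 0 < beta by exact: lt_le_trans beta_ge.
split=> [|a a0]; first by case: mom.
pose b := (a^T *m mcd_loc P0 phi) 0 0.
have := moments_affine_sq a b mom; rewrite subrr expr0n addr0 => <-.
rewrite mulr_gt0 ?invr_gt0 //.
have [q q0 Eq] : exists2 q, 0 < q &
    Rintegral P0 setT (clamp_quadratic (cut_param (affine_sq a b) q)) < gamma.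
  by apply: affine_sq_level_cut => //; rewrite ltr_pwDl ?sqr_ge0 ?sqnorm_gt0.
have i1 := integrable_clamp_quadratic P0 (cut_param (affine_sq a b) q).
have i2 := mcd_class_integrable_quadratic cphi (affine_sq a b).
have : beta <= Rintegral P0 setT (fun x => clamp_quadratic (cut_param (affine_sq a b) q) x +
    q^-1 * (quadratic (affine_sq a b) x * phi x)).
  apply: le_Rintegral => //.
  - exact: mcd_class_integrable cphi.
  - exact: (integrable_RD i1 (integrable_RZl q^-1 i2)).
  move=> x _; have /andP[p0 p1] := phi01 x; rewrite /clamp_quadratic quadratic_cut.
  have d0 : 0 <= quadratic (affine_sq a b) x by rewrite quadratic_affine_sq sqr_ge0.
  have h := clamp_trim d0 q0.
  have [c0 _] := andP (clamp01 (1 - quadratic (affine_sq a b) x / q)).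
  move: h c0; set c := clamp _; set e := quadratic _ x => h c0.
  have : phi x * 1 <= phi x * (c + e / q) by rewrite ler_wpM2l.
  have : phi x * c <= c by rewrite ler_piMl.
  have -> : q^-1 * (e * phi x) = phi x * (e / q) by ring.
  by rewrite mulrDr mulr1; lra.
rewrite RintegralD //; last exact: integrable_RZl.
rewrite RintegralZl // => h.
have : 0 < q^-1 * Rintegral P0 setT (fun x => quadratic (affine_sq a b) x * phi x).
  by move: h Eq beta_ge; lra.
by rewrite pmulr_rgt0 // invr_gt0.
Qed.

Section sample.
Variables (X : nat -> 'cV[R]_k) (S : forall n, {set 'I_n}).
Hypothesis law : forall (t0 : param) (e : R), 0 < e -> \forall n \near \oo & t \near t0,
  `|sample_avg X (clamp_quadratic t) n - Rintegral P0 setT (clamp_quadratic t0)| < e.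
Hypothesis S_min : forall n, (1 <= n)%N -> minimizing_subsample X gamma (S n).

Let Cn n := cov_hat X (S n).
Let Tn n := mean_hat X (S n).
Let tn n : param := mahalanobis (invmx (Cn n)) (Tn n).

Lemma subsample_card n (A : {set 'I_n}) : subsample gamma A -> n%:R * gamma <= #|A|%:R.
Proof. by rewrite /subsample ceil_le_int. Qed.

Lemma subsample_nonempty n (A : {set 'I_n}) : (0 < n)%N -> subsample gamma A -> (0 < #|A|)%N.
Proof.
move=> n0 /subsample_card nA; rewrite -(ltr_nat R); apply: lt_le_trans nA.
by rewrite mulr_gt0 // ltr0n.
Qed.

Lemma cov_hat_spread : exists2 delta, 0 < delta & \forall n \near \oo,
  [/\ (0 < n)%N, pd (Cn n) & forall a b, delta * (sqnorm a + b ^+ 2) <=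
    quad_form (Cn n) a + ((a^T *m Tn n) 0 0 - b) ^+ 2].
Proof.
have [delta delta0 spread] := uniformly_spread hyperplane_lt gamma0 law.
exists delta => //; near=> n.
have n0 : (0 < n)%N by near: n; exact: nbhs_infty_gt.
have [Sn _] := S_min n0; have Sn0 := subsample_nonempty n0 Sn.
have spread_n : forall a b, delta * (sqnorm a + b ^+ 2) <=
    quad_form (Cn n) a + ((a^T *m Tn n) 0 0 - b) ^+ 2.
  move=> a b; rewrite -(moments_affine_sq a b (moments_sample X Sn0)).
  rewrite /= [leRHS]mulrC ler_pdivlMr ?ltr0n // mulrC.
  under eq_bigr do rewrite quadratic_affine_sq.
  by apply: (near spread n) => //; exact: subsample_card.
split=> //; split=> [|a a0]; first by case: (psd_cov_hat X Sn0).
have := spread_n a ((a^T *m Tn n) 0 0); rewrite subrr expr0n addr0; apply: lt_le_trans.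
by rewrite mulr_gt0 // ltr_pwDl ?sqr_ge0 ?sqnorm_gt0.
Unshelve. all: by end_near. Qed.

Lemma trimmed_sample_avg n q : (0 < n)%N -> pd (Cn n) -> 0 < q ->
  gamma * (1 - k%:R / q) <= sample_avg X (clamp_quadratic (cut_param (tn n) q)) n.
Proof.
move=> n0 Cp q0; have [Sn _] := S_min n0; have Sn0 := subsample_nonempty n0 Sn.
have [Ms Mp] := pd_psd (pd_invmx Cp).
have t0 x : 0 <= quadratic (tn n) x by rewrite quadratic_mahalanobis.
have avg0 : 0 <= sample_avg X (clamp_quadratic (cut_param (tn n) q)) n.
  rewrite mulr_ge0 ?invr_ge0 // sumr_ge0 // => i _.
  by case/andP: (clamp01 (quadratic (cut_param (tn n) q) (X i))).
(* The bound |S| >= n gamma can be multiplied by 1 - k / q only if this is nonnegative; otherwise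
   the claim is trivial. *)
have [kq|kq] := leP q k%:R.
  apply: le_trans avg0; rewrite mulr_ge0_le0 ?(ltW gamma0) // subr_le0.
  by rewrite ler_pdivlMr // mul1r.
have kq' : 0 <= 1 - k%:R / q by rewrite subr_ge0 ler_pdivrMr // mul1r ltW.
have := subsample_trim X (S n) t0 q0.
have -> : \sum_(i in S n) quadratic (tn n) (X i) = #|S n|%:R * k%:R.
  have := moments_mahalanobis (Tn n) (moments_sample X Sn0) Ms.
  rewrite subrr quad_form0 addr0 mulVmx ?pd_unit // mxtrace1 => <-.
  by rewrite mulVKf // pnatr_eq0 -lt0n.
move=> trim; have n0' : 0 < n%:R :> R by rewrite ltr0n.
rewrite -(ler_pM2l n0') mulrA.
apply: (@le_trans _ _ (#|S n|%:R * (1 - k%:R / q))).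
  by rewrite ler_wpM2r // subsample_card.
rewrite mulrBr mulr1 lerBlDr; apply: le_trans trim _.
by rewrite lerD2l le_eqVlt; apply/orP; left; apply/eqP; ring.
Qed.

Lemma law_along (u : nat -> param) u0 e : u n @[n --> \oo] --> u0 -> 0 < e ->
  \forall n \near \oo,
    `|sample_avg X (clamp_quadratic (u n)) n - Rintegral P0 setT (clamp_quadratic u0)| < e.
Proof.
move=> uu0 e0; have [[A B] /= [nA nB] AB] := law u0 e0.
have : \forall n \near \oo, A n /\ B (u n) by apply: filterI => //; exact: (uu0 _ nB).
by apply: filterS => n [An Bn]; exact: (AB (n, u n) (conj An Bn)).
Qed.

Lemma det_cov_hat_liminf (M : 'M[R]_k) mu beta (psi : 'cV[R]_k -> R) :
  pd M -> gamma <= beta -> (forall x, 0 <= psi x <= 1) ->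
  (forall e, 0 < e -> \forall n \near \oo,
    \sum_(i < n) quadratic (mahalanobis M mu) (X i) * psi (X i) <= n%:R * (beta * k%:R + e)) ->
  (forall e, 0 < e -> \forall n \near \oo, n%:R * (beta - e) <= \sum_(i < n) psi (X i)) ->
  (beta = 1 /\ (forall x, psi x = 1)) \/
    (exists2 s, 0 <= s & (beta%:E < P0 [set x | (quadratic (mahalanobis M mu) x <= s ^+ 2)%R])%E) ->
  forall e, 0 < e < 1 -> \forall n \near \oo,
    \det M * (1 - k%:R * e) <= \det (invmx (Cn n)).
Proof.
move=> Mp gamma_beta psi01 mean_le mass_ge bulk e /andP[e0 e1].
set t := mahalanobis M mu in mean_le bulk *.
have [Ms M0] := pd_psd Mp.
have t0 x : 0 <= quadratic t x by rewrite quadratic_mahalanobis.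
have beta0 : 0 < beta := lt_le_trans gamma0 gamma_beta.
have bulk' : (beta = 1 /\ (forall x, psi x = 1)) \/
    (exists m e, 0 < e /\ \forall n \near \oo,
      n%:R * (beta + e) <= #|[pred i : 'I_n | (quadratic t (X i) <= m)%R]|%:R).
  (* The excess of mass over beta passes to the sample through a clamp between the radii s and s +
     1, so the radius grows by 1. *)
  case: bulk => [|[s s0 Ps]]; [by left|right; exists ((s + 1) ^+ 2)].
  have ss' : 0 <= s < s + 1 by rewrite s0 ltrDl ltr01.
  pose E := Rintegral P0 setT (clamp_quadratic (level_param t s (s + 1))).
  have betaE : beta < E.
    rewrite -lte_fin; apply: lt_le_trans Ps _; apply: measure_le_Rintegral => //.
    - by apply: measurable_level_le; exact: measurable_quadratic.
    - exact: measurable_clamp_quadratic.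
    - by move=> x; exact: clamp01.
    by move=> x /(proj1 (clamp_level t x ss')).
  exists ((E - beta) / 2); have e20 : 0 < (E - beta) / 2 by rewrite divr_gt0 // subr_gt0.
  split=> //; have law_n := law_along (@cvg_cst _ (level_param t s (s + 1)) _ \oo eventually_filter) e20.
  apply: filterS (filterI (nbhs_infty_gt 0) law_n) => n [n0 avg].
  have n0' : 0 < n%:R :> R by rewrite ltr0n.
  apply: (@le_trans _ _ (\sum_(i < n) clamp_quadratic (level_param t s (s + 1)) (X i))).
    rewrite -ler_pdivlMl //; move: avg; rewrite ltr_norml /sample_avg -/E; lra.
  rewrite -sum1_card natr_sum [leRHS]big_mkcond /=; apply: ler_sum => i _.
  rewrite inE; have [xs|xs] := leP (quadratic t (X i)) ((s + 1) ^+ 2).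
    by case/andP: (clamp01 (quadratic (level_param t s (s + 1)) (X i))).
  by rewrite (proj2 (clamp_level t (X i) ss') (ltW xs)).
(* The competitor satisfies det M det C <= c^k; inverting gives the factor (1 - e)^k, at least 1 - k
   e by Bernoulli's inequality. *)
pose c := (1 - e)^-1; have c0 : 0 < c by rewrite invr_gt0 subr_gt0.
have c1 : 1 < c by rewrite invf_gt1 ?subr_gt0 // gtrBl.
have k0 : 0 < k%:R :> R by rewrite ltr0n.
have slack : 0 < k%:R * (c - 1) by rewrite mulr_gt0 // subr_gt0.
have [delta _ spread] := cov_hat_spread.
have := close_subsample beta0 (ltW k0) t0 psi01 mean_le mass_ge bulk' slack.
move=> close; apply: filterS (filterI spread close) => n [[n0 Cp _] [A [A_ge A_le]]].
have n0' : 0 < n%:R :> R by rewrite ltr0n.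
have A0 : (0 < #|A|)%N by rewrite -(ltr_nat R) (lt_le_trans _ A_ge) // mulr_gt0.
have sA : subsample gamma A.
  by rewrite /subsample ceil_le_int (le_trans _ A_ge) // ler_wpM2l // ltW.
have dA := (proj2 (S_min n0)) _ sA.
have dM := pd_det_gt0 Mp; have dC := pd_det_gt0 Cp.
have := @det_cov_hat_le _ _ X n A M mu c Mp c0 A0.
have -> : k%:R * c = k%:R + k%:R * (c - 1) by rewrite mulrBr mulr1 addrC subrK.
move=> /(_ A_le) detA.
have bern : 1 - k%:R * e <= (1 - e) ^+ k.
  elim: (k) => [|j IH]; first by rewrite mul0r subr0 expr0.
  have e1' : 0 <= 1 - e by rewrite subr_ge0 ltW.
  have je : 0 <= j%:R * (e * e) by rewrite mulr_ge0 // mulr_ge0 // ltW.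
  rewrite exprS; apply: le_trans (ler_wpM2l e1' IH).
  by rewrite -natr1; lra.
have dMC : \det M * \det (Cn n) <= c ^+ k.
  by apply: le_trans detA; rewrite ler_wpM2l // ltW.
have ce0 : 0 < (1 - e) ^+ k by rewrite exprn_gt0 // subr_gt0.
rewrite det_inv; apply: (@le_trans _ _ (\det M * (1 - e) ^+ k)).
  by rewrite ler_wpM2l // ltW.
by rewrite -[leRHS]div1r ler_pdivlMr // mulrAC -ler_pdivlMr // div1r -exprVn.
Qed.

(** * Cluster points of the minimizing quadratics *)

Section cluster_point.
Variables (phi0 : 'cV[R]_k -> R).
Hypothesis phi0_min : mcd_minimizer P0 gamma phi0.
Hypothesis functional_unique : forall TC, mcd_functional P0 gamma TC ->
  TC = (mcd_loc P0 phi0, mcd_cov P0 phi0).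

Let T0 := mcd_loc P0 phi0.
Let C0 := mcd_cov P0 phi0.

Hypothesis det_liminf : forall e, 0 < e < 1 -> \forall n \near \oo,
  \det (invmx C0) * (1 - k%:R * e) <= \det (invmx (Cn n)).

(* The function trimmed according to a limit t of the quadratics is admissible, and its
   dispersion has no larger determinant than C0. It is thus a minimizer, and the
   equality case of the arithmetic-geometric inequality identifies t. *)
Lemma limit_quadratic_unique (t : param) : t.1.1^T = t.1.1 ->
  (forall x, 0 <= quad_form t.1.1 x) -> (forall x, 0 <= quadratic t x) ->
  \det (invmx C0) <= \det t.1.1 ->
  (forall q, 0 < q -> gamma * (1 - k%:R / q) <=
    Rintegral P0 setT (clamp_quadratic (cut_param t q))) ->
  t = mahalanobis (invmx C0) T0.
Proof.
case: t => [[M v] c] /= Ms Mp t0 detM trim; set t : param := (M, v, c).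
have C0p : pd C0 by apply: mcd_cov_pd; case: phi0_min.
have dC0 : 0 < \det (invmx C0) by exact/pd_det_gt0/pd_invmx.
have Mpd : pd M.
  by apply: psd_pd; [split|rewrite gt_eqF // (lt_le_trans dC0)].
have uM := pd_unit Mpd.
(* Completing the square: t is the quadratic of M centred at T plus a constant r, which is
   nonnegative as the value of t at T. *)
pose T : 'cV[R]_k := - 2^-1 *: (invmx M *m v).
have vE : v = - 2 *: (M *m T).
  by rewrite /T -scalemxAr mulKVmx // scalerA mulrNN mulfV // scale1r.
pose r := c - quad_form M T.
have tE x : quadratic t x = quad_form M (x - T) + r.
  rewrite -(quadratic_mahalanobis T x Ms) /quadratic /= -vE /r; ring.
have r0 : 0 <= r by have := t0 T; rewrite -/t tE subrr quad_form0 add0r.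
have mt := measurable_quadratic t.
have trim' q : 0 < q -> gamma * (1 - k%:R / q) <=
    Rintegral P0 setT (fun x => clamp (1 - quadratic t x / q)).
  move=> q0; apply: le_trans (trim _ q0) _; rewrite le_eqVlt; apply/orP; left; apply/eqP.
  by apply: eq_Rintegral => x _; rewrite /clamp_quadratic quadratic_cut.
have [phi [mphi phi01 phiE iphi phiK]] :=
  trimmed_function mt t0 gamma01 (ler0n R k) trim'.
have cphi : mcd_class P0 gamma phi.
  have iphi1 : P0.-integrable setT (EFin \o phi).
    apply: (@integrable_bounded _ _ _ P0 _ 1 mphi) => x.
    by have /andP[p0 p1] := phi01 x; rewrite ger0_norm.
  split => //.
    by rewrite -phiE fineK // (integrable_fin_num _ iphi1).
  pose s := `|\tr (invmx M)|.
  have sq_le x : sqnorm x <= 2 * s * quadratic t x + 2 * sqnorm T.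
    have h1 : sqnorm (x - T) <= s * quadratic t x.
      apply: le_trans (pd_coercive Mpd (x - T)) _; rewrite tE.
      apply: (@le_trans _ _ (s * quad_form M (x - T))).
        by rewrite ler_wpM2r // ler_norm.
      by rewrite ler_wpM2l ?normr_ge0 // lerDl.
    have h2 := sqnorm_le x T.
    by lra.
  have sq_phi0 x : 0 <= sqnorm x * phi x.
    by rewrite mulr_ge0 ?sqnorm_ge0 //; case/andP: (phi01 x).
  have msq : measurable_fun setT (fun x : 'cV[R]_k => sqnorm x * phi x).
    apply: measurable_funM => //; apply: measurable_sum => i.
    by apply: measurable_funX; exact: measurable_coord.
  have isq : P0.-integrable setT (EFin \o (fun x => sqnorm x * phi x)).
    have i1 := integrable_RD (integrable_RZl (2 * s) iphi) (integrable_RZl (2 * sqnorm T) iphi1).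
    apply: (le_integrable measurableT _ _ i1); first exact/measurable_EFinP.
    move=> x _ /=; rewrite lee_fin (ger0_norm (sq_phi0 x)).
    apply: le_trans (ler_norm _); have /andP[p0 _] := phi01 x.
    have := ler_wpM2r p0 (sq_le x); lra.
  have /integrableP[_] := isq; apply: le_lt_trans.
  rewrite [leLHS](eq_integral (fun x => `|(sqnorm x * phi x)%:E|%E)) // => x _.
  by rewrite gee0_abs // lee_fin.
have mom := mcd_class_moments gamma0 cphi; rewrite phiE in mom.
set C := mcd_cov P0 phi in mom; set Tphi := mcd_loc P0 phi in mom.
have mean_t : gamma^-1 * Rintegral P0 setT (fun x => quadratic t x * phi x) =
    \tr (M *m C) + quad_form M (Tphi - T) + r.
  have := moments_mahalanobis T mom Ms.
  have [_ momE] := mom; rewrite momE /= -vE => <-; rewrite momE /= /r; ring.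
have mean_le : \tr (M *m C) + quad_form M (Tphi - T) + r <= k%:R.
  by rewrite -mean_t ler_pdivrMl // mulrC.
have qT0 := Mp (Tphi - T).
have Cp : pd C by exact: mcd_cov_pd.
have trMC : \tr (M *m C) <= k%:R by lra.
have [det_le detE] := pd_psd_tr_det Mpd (pd_psd Cp) trMC.
have C0C : \det C0 <= \det C by case: phi0_min => _; exact.
have detC0 : \det (invmx C0) * \det C0 = 1.
  by rewrite -det_mulmx mulVmx ?det1 // pd_unit.
(* It is at least 1 because det M >= det C0^-1 by assumption and det C >= det C0 by minimality of
   phi0. *)
have detMC : \det M * \det C = 1.
  apply/eqP; rewrite eq_le det_le /= -detC0 ler_pM //; first exact: ltW.
  exact/ltW/pd_det_gt0.
have CE : C = invmx M by exact: detE.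
have phi_min : mcd_minimizer P0 gamma phi.
  split=> // psi /(proj2 phi0_min); apply: le_trans; rewrite -/C -/C0.
  have dM := pd_det_gt0 Mpd.
  rewrite -(ler_pM2l dM) detMC -detC0 ler_wpM2r //.
  exact/ltW/pd_det_gt0.
have [TE CE0] : Tphi = T0 /\ C = C0.
  have [] : (Tphi, C) = (T0, C0) by apply: functional_unique; exists phi.
  by [].
have trMCE : \tr (M *m C) = k%:R by rewrite CE mulmxV // mxtrace1.
have ME : M = invmx C0 by rewrite -CE0 CE invmxK.
(* The trace alone uses up the bound k in [mean_le], so r and the form of the offset of the means
   both vanish. *)
have r_0 : r = 0 by lra.
have TT0 : T = T0.
  apply/eqP; rewrite eq_sym -TE -subr_eq0; apply: contraT => /(proj2 Mpd); lra.
by rewrite -ME -TT0 /mahalanobis -vE; congr (_, _, _); rewrite -[LHS](subrK (quad_form M T)) -/r r_0 add0r.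
Qed.

Let t0 : param := mahalanobis (invmx C0) T0.
Let FF : set_system param := tn @ \oo.

Let cluster_lb (f : param -> R) c p : cluster FF p -> continuous f ->
  (forall e, 0 < e -> \forall n \near \oo, c - e <= f (tn n)) -> c <= f p.
Proof.
move=> clp cf fn; rewrite leNgt; apply/negP => fpc.
have e0 : 0 < (c - f p) / 2 by rewrite divr_gt0 // subr_gt0.
have U : \forall t \near p, f t < c - (c - f p) / 2.
  have h : f p < c - (c - f p) / 2 by lra.
  exact: (cf p _ (lt_nbhsl h)).
have := clp [set t | c - (c - f p) / 2 <= f t] _ (fn _ e0) U.
by move=> [t [/= h1 h2]]; have := le_lt_trans h1 h2; rewrite ltxx.
Qed.

Let pd_near : \forall n \near \oo, (0 < n)%N /\ pd (Cn n).
Proof.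
by have [delta _] := cov_hat_spread; apply: filterS => n [n0 Cp _].
Qed.

Let cluster_unique p : cluster FF p -> p = t0.
Proof.
move=> clp; have cmx i j := @param_mx_continuous R k i j.
have lb0 (f : param -> R) : continuous f -> (\forall n \near \oo, 0 <= f (tn n)) -> 0 <= f p.
  move=> cf f0; apply: (cluster_lb clp cf) => e e0.
  by apply: filterS f0 => n f0; rewrite sub0r (le_trans _ f0) // oppr_le0 ltW.
(* The form is recovered from values of the quadratic, so its continuity in t follows from
   [quadratic_continuous]. *)
have quadE (t : param) x : quad_form t.1.1 x =
    (quadratic t x + quadratic t (- x)) / 2 - quadratic t 0.
  rewrite /quadratic quad_formN quad_form0 !mulmx0 mulmxN.
  by move: (t.1.2^T *m x) => y; rewrite !mxE; field.
apply: limit_quadratic_unique.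
- apply/matrixP => i j; rewrite mxE; apply/eqP; rewrite eq_le.
  have half a b : 0 <= p.1.1 a b - p.1.1 b a.
    apply: (lb0 (fun t => t.1.1 a b - t.1.1 b a)).
      by move=> t; exact: (cvgB (cmx a b t) (cmx b a t)).
    apply: filterS pd_near => n [_ /pd_invmx[Ms _]] /=.
    have /matrixP/(_ b a) := Ms; rewrite mxE => ->.
    by rewrite subrr.
  by apply/andP; split; rewrite -subr_ge0 half.
- move=> x; apply: (lb0 (fun t => quad_form t.1.1 x)).
    under eq_fun do rewrite quadE.
    have c x' := @quadratic_continuous R k x'.
    by move=> t; exact: (cvgB (cvgMr_tmp (cvgD (c x t) (c (- x) t))) (c 0 t)).
  by apply: filterS pd_near => n [_ /pd_invmx/pd_psd[_]]; exact.
- move=> x; apply: (lb0 (fun t => quadratic t x)); first exact: quadratic_continuous.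
  apply: filterS pd_near => n [_ /pd_invmx/pd_psd[Ms M0]] /=.
  by rewrite quadratic_mahalanobis.
- apply: (cluster_lb clp (f := fun t => \det t.1.1)).
    move=> t; have h : continuous_at t (fun t : param => t.1.1).
      exact: (@continuous_comp _ _ _ (fun t : param => t.1) fst t (@cvg_fst _ _ _ _ _) (@cvg_fst _ _ _ _ _)).
    exact: (continuous_comp h (@det_continuous R k t.1.1)).
  move=> e e0; have C0p : pd C0 by apply: mcd_cov_pd; case: phi0_min.
  have dC0 : 0 < \det (invmx C0) by exact/pd_det_gt0/pd_invmx.
  set D := \det _ in dC0 *; have k0 : 0 < k%:R :> R by rewrite ltr0n.
  pose e' := e / (e + D * k%:R + D).
  have den0 : 0 < e + D * k%:R + D by rewrite !addr_gt0 // mulr_gt0.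
  have e'01 : 0 < e' < 1.
    rewrite divr_gt0 //= ltr_pdivrMr // mul1r -addrA ltrDl addr_gt0 // mulr_gt0 //.
  have De' : D * (k%:R * e') <= e.
    rewrite /e' !mulrA ler_pdivrMr // mulrC ler_pM2l //.
    by have := ltW e0; have := ltW dC0; lra.
  apply: filterS (det_liminf e'01) => n; apply: le_trans.
  by rewrite mulrBr mulr1 lerD2l lerN2.
move=> q q0; rewrite leNgt; apply/negP => lt_trim.
set E := Rintegral _ _ _ in lt_trim.
have e0 : 0 < gamma * (1 - k%:R / q) - E by rewrite subr_gt0.
have [[A B] /= [nA nB] AB] := law (cut_param p q) e0.
have U : \forall t \near p, B (cut_param t q) by exact: (@cut_param_continuous R k q p B nB).
(* The set remembers the index n, so that a parameter near p comes with an n to which both the law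
   and [trimmed_sample_avg] apply. *)
have A' : FF [set t | exists2 n, A n /\ (0 < n)%N /\ pd (Cn n) & t = tn n].
  have : \forall n \near \oo, A n /\ (0 < n)%N /\ pd (Cn n).
    by apply: filterI => //; exact: pd_near.
  by apply: filterS => n An; exists n.
have [t [[n [An [n0 Cp]] tE] Bt]] := clp _ _ A' U.
have := trimmed_sample_avg n0 Cp q0; rewrite -tE.
have := AB (n, _) (conj An Bt); rewrite /= -/E ltr_norml => /andP[_]; lra.
Qed.

Let tn_cvg : tn n @[n --> \oo] --> t0.
Proof.
have [delta delta0 spread] := cov_hat_spread.
pose box (B : R) : set param := [set t : param | [/\ forall i j, `|t.1.1 i j| <= B,
  forall i j, `|t.1.2 i j| <= B & `|t.2| <= B]].
have boxc B : compact (box B).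
  have -> : box B = [set M : 'M[R]_k | forall i j, `|M i j| <= B] `*`
      [set v : 'cV[R]_k | forall i j, `|v i j| <= B] `*` `[- B, B]%classic.
    by apply/seteqP; split=> -[[M v] c] /=; rewrite in_itv /= -ler_norml; [case|case=> [[]]].
  apply: compact_setX; last exact: segment_compact.
  by apply: compact_setX; exact: compact_mx_box.
have Fbox : FF (box (2 / delta)).
  apply: filterS spread => n [n0 Cp sp].
  exact: (mahalanobis_bounded Cp delta0 sp).
have Fproper : ProperFilter FF by exact: fmap_proper_filter.
have [t1 [t1box t1cl]] := boxc _ _ Fproper Fbox.
have t0box : box (2 / delta) t0 by rewrite -(cluster_unique t1cl).
(* The limit may lie on the boundary of the first box; the enlarged compact box is a neighbourhood
   of it, as [compact_cluster_set1] demands. *)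
have nbox : nbhs t0 (box (2 / delta + 1)).
  exists (ball t0.1 1, ball t0.2 1); first by split; exact: nbhsx_ballx.
  move=> [[M v] c] [] /= [] /= [_ bM] [_ bv] bc; have [hM hv hc] := t0box.
  have tri (a b : R) : `|a| <= 2 / delta -> `|a - b| < 1 -> `|b| <= 2 / delta + 1.
    by move=> ha /ltW hab; rewrite -[b](subKr a) (le_trans (ler_normB _ _)) // lerD.
  split=> [i j|i j|]; [exact: (tri _ _ (hM i j) (bM i j))|
    exact: (tri _ _ (hv i j) (bv i j))|exact: (tri _ _ hc bc)].
have Fbox1 : FF (box (2 / delta + 1)).
  apply: filterS Fbox => t [h1 h2 h3].
  have le1 : 2 / delta <= 2 / delta + 1 by rewrite lerDl.
  by split=> [i j|i j|]; apply: le_trans le1.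
have clE : cluster FF = [set t0].
  apply/seteqP; split=> [p /cluster_unique ->//|p ->].
  by rewrite -(cluster_unique t1cl).
exact: (compact_cluster_set1 (@param_hausdorff R k) (boxc _) nbox Fproper Fbox1 clE).
Qed.

Lemma mcd_estimator_cvg : (Tn n, Cn n) @[n --> \oo] --> (T0, C0).
Proof.
have C0p : pd C0 by apply: mcd_cov_pd; case: phi0_min.
have uM0 : invmx C0 \in unitmx by rewrite unitmx_inv pd_unit.
have h1 : (tn n).1 @[n --> \oo] --> t0.1.
  exact: (cvg_comp _ _ tn_cvg (@cvg_fst _ _ _ _ _)).
have h11 : (tn n).1.1 @[n --> \oo] --> invmx C0.
  exact: (cvg_comp _ _ h1 (@cvg_fst _ _ _ _ _)).
have h12 : (tn n).1.2 @[n --> \oo] --> t0.1.2.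
  exact: (cvg_comp _ _ h1 (@cvg_snd _ _ _ _ _)).
have hC : Cn n @[n --> \oo] --> C0.
  (* Holds for every n: on singular matrices [invmx] is the identity, so it is an involution
     everywhere. *)
  have -> : Cn = invmx \o (fun n => (tn n).1.1) by apply/funext => n; rewrite /= invmxK.
  by have := cvg_comp _ _ h11 (invmx_continuous uM0); rewrite invmxK.
suff hT : Tn n @[n --> \oo] --> T0 by exact: (cvg_pair hT hC).
have -> : T0 = (- 2^-1)%:M *m (C0 *m t0.1.2).
  rewrite mul_scalar_mx /t0 /= -scalemxAr mulKVmx ?pd_unit // scalerA mulrNN mulVf //.
  by rewrite scale1r.
have lim : (- 2^-1)%:M *m (Cn n *m (tn n).1.2) @[n --> \oo] -->
    (- 2^-1)%:M *m (C0 *m t0.1.2).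
  apply: cvg_mulmx; first exact: cvg_cst.
  exact: (cvg_mulmx hC h12).
apply: cvg_trans lim; apply: near_eq_cvg; apply: filterS pd_near => n [_ Cp].
rewrite mul_scalar_mx /= -scalemxAr mulKVmx ?pd_unit // scalerA mulrNN mulVf //.
by rewrite scale1r.
Qed.

Lemma level_param_cvg s s' :
  level_param (tn n) s s' @[n --> \oo] --> level_param t0 s s'.
Proof.
have shift : continuous (fun t : param => (t.1.1, t.1.2, t.2 - s ^+ 2) : param).
  move=> t; apply: param_cvg => /= [i j|i|].
  - exact: param_mx_continuous.
  - exact: param_vec_continuous.
  by apply: cvgB; [exact: param_cst_continuous|exact: cvg_cst].
exact: (cvg_comp _ _ (cvg_comp _ _ tn_cvg (shift t0)) (@cut_param_continuous R k _ _)).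
Qed.

Lemma ellipsoidE (M : 'M[R]_k) mu s : M^T = M ->
  ellipsoid mu M s = [set x | quadratic (mahalanobis (invmx M) mu) x <= s ^+ 2].
Proof.
move=> Ms; have iMs : (invmx M)^T = invmx M by rewrite trmx_inv Ms.
by apply/seteqP; split => x; rewrite /ellipsoid /= quadratic_mahalanobis.
Qed.

Lemma empirical_measureE n (A : set 'cV[R]_k) :
  empirical_measure X n A = (sample_avg X \1_A n)%:E.
Proof.
rewrite /empirical_measure /mscale /= /msum /sample_avg EFinM -sumEFin; congr (_ * _)%E.
Qed.

Let ellipsoid_mono mu (M : 'M[R]_k) s s' : 0 <= s <= s' ->
  ellipsoid mu M s `<=` ellipsoid mu M s'.
Proof.
move=> /andP[s0 ss'] x; rewrite /ellipsoid /= => /le_trans; apply.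
by rewrite ler_pXn2r // nnegrE // (le_trans s0).
Qed.

Let sample_avg_le f g n : (forall x, f x <= g x) -> sample_avg X f n <= sample_avg X g n.
Proof. by move=> fg; rewrite ler_wpM2l ?invr_ge0 // ler_sum. Qed.

Lemma mcd_radius_cvg :
  (forall e, 0 < e -> (gamma%:E < P0 (ellipsoid T0 C0 (mcd_radius gamma P0 T0 C0 + e)))%E) ->
  radius_hat X gamma (S n) @[n --> \oo] --> mcd_radius gamma P0 T0 C0.
Proof.
set r0 := mcd_radius gamma P0 T0 C0 => P0_gt.
have C0s : C0^T = C0 by have [] : pd C0 by apply: mcd_cov_pd; case: phi0_min.
have r0_ge0 : 0 <= r0.
  apply: lb_le_inf; last by move=> s [/ltW].
  (* The hypothesis on P0 supplies a member of the set defining r0, which is therefore a genuine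
     infimum and not the default value. *)
  exists (`|r0| + 1); have r1 : 0 < `|r0| + 1 by rewrite ltr_wpDl.
  split=> //; apply/ltW; have := P0_gt (`|r0| - r0 + 1).
  rewrite (_ : r0 + _ = `|r0| + 1); last by ring.
  by apply; have := ler_norm r0; lra.
have mlev s : measurable [set x | quadratic t0 x <= s].
  by apply: measurable_level_le; exact: measurable_quadratic.
have upper e : 0 < e -> \forall n \near \oo, (0 < n)%N /\
    (gamma%:E <= empirical_measure X n (ellipsoid (Tn n) (Cn n) (r0 + e)))%E.
  move=> e0; pose s := r0 + e / 2; have ss' : 0 <= s < r0 + e by rewrite /s; lra.
  have E0 : 0 < Rintegral P0 setT (clamp_quadratic (level_param t0 s (r0 + e))) - gamma.
    rewrite subr_gt0 -lte_fin; apply: lt_le_trans (P0_gt (e / 2) _) _.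
      by rewrite divr_gt0.
    rewrite ellipsoidE //; apply: measure_le_Rintegral => //.
    - exact: measurable_clamp_quadratic.
    - by move=> x; exact: clamp01.
    by move=> x /(proj1 (clamp_level t0 x ss')).
  have := law_along (@level_param_cvg s (r0 + e)) E0.
  move=> law_n; apply: filterS (filterI pd_near law_n) => n [[n0 Cp] avg].
  split=> //; rewrite empirical_measureE lee_fin.
  apply: (@le_trans _ _ (sample_avg X (clamp_quadratic (level_param (tn n) s (r0 + e))) n)).
    by move: avg; rewrite ltr_norml; lra.
  apply: sample_avg_le => x; rewrite ellipsoidE; last by case: Cp.
  rewrite indicE; have [xs|xs] := leP (quadratic (tn n) x) ((r0 + e) ^+ 2).
    by rewrite mem_set //; case/andP: (clamp01 (quadratic (level_param (tn n) s (r0 + e)) x)).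
  by rewrite (proj2 (clamp_level (tn n) x ss') (ltW xs)) ler0n.
have lower e : 0 < e -> \forall n \near \oo, 0 < r0 - e ->
    (empirical_measure X n (ellipsoid (Tn n) (Cn n) (r0 - e)) < gamma%:E)%E.
  (* Admissible radii are positive, so nothing has to be excluded when r0 <= e. Otherwise P0 gives
     mass below gamma to the radius r0 - e / 2, by definition of the infimum. *)
  move=> e0; have [re0|re0] := ltP 0 (r0 - e); last by apply: nearW.
  pose s' := r0 - e / 2; have ss' : 0 <= r0 - e < s' by rewrite /s'; lra.
  have E0 : 0 < gamma - Rintegral P0 setT (clamp_quadratic (level_param t0 (r0 - e) s')).
    rewrite subr_gt0 -lte_fin; apply: (@le_lt_trans _ _ (P0 (ellipsoid T0 C0 s'))).
      rewrite ellipsoidE //; apply: Rintegral_le_measure => //.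
      - exact: measurable_clamp_quadratic.
      - by move=> x; exact: clamp01.
      move=> x /= /negP; rewrite -ltNge => /ltW.
      exact: (proj2 (clamp_level t0 x ss')).
    rewrite ltNge; apply/negP => Ps'.
    have : r0 <= s'.
      apply: ge_inf; first by exists 0 => r [/ltW].
      by split=> //; rewrite /s'; lra.
    by rewrite /s'; lra.
  have := law_along (@level_param_cvg (r0 - e) s') E0.
  move=> law_n; apply: filterS (filterI pd_near law_n) => n [[n0 Cp] avg].
  rewrite empirical_measureE lte_fin => _.
  apply: (@le_lt_trans _ _ (sample_avg X (clamp_quadratic (level_param (tn n) (r0 - e) s')) n)).
    apply: sample_avg_le => x; rewrite ellipsoidE; last by case: Cp.
    rewrite indicE; have [xs|xs] := leP (quadratic (tn n) x) ((r0 - e) ^+ 2).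
      by rewrite (proj1 (clamp_level (tn n) x ss')) //; case: (_ \in _).
    rewrite memNset; last by rewrite /= leNgt xs.
    by case/andP: (clamp01 (quadratic (level_param (tn n) (r0 - e) s') x)).
  by move: avg; rewrite ltr_norml; lra.
apply/cvgrPdist_le => e e0; near=> n.
have [n0 up] : (0 < n)%N /\
    (gamma%:E <= empirical_measure X n (ellipsoid (Tn n) (Cn n) (r0 + e)))%E.
  by near: n; exact: upper.
have low : 0 < r0 - e ->
    (empirical_measure X n (ellipsoid (Tn n) (Cn n) (r0 - e)) < gamma%:E)%E.
  by near: n; exact: lower.
have r0e : 0 < r0 + e by rewrite ltr_wpDl.
have r_le : radius_hat X gamma (S n) <= r0 + e.
  by apply: ge_inf; [exists 0 => r [/ltW]|split].
have r_ge : r0 - e <= radius_hat X gamma (S n).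
  apply: lb_le_inf; first by exists (r0 + e).
  move=> r [r_gt0 r_in]; rewrite leNgt; apply/negP => r_lt.
  have := low (lt_trans r_gt0 r_lt).
  rewrite ltNge => /negP; apply; apply: le_trans r_in _.
  rewrite !empirical_measureE lee_fin; apply: sample_avg_le => x; rewrite !indicE.
  have [xr|xr] := boolP (x \in ellipsoid (Tn n) (Cn n) r); last by case: (_ \in _).
  rewrite mem_set //; apply: ellipsoid_mono (set_mem xr).
  by rewrite !ltW.
by rewrite ler_norml; lra.
Unshelve. all: by end_near. Qed.

End cluster_point.
End sample.
End mcd_deterministic.

(** * Almost sure convergence *)

Lemma mutually_independent_pair d d' (Omega : measurableType d) (T : measurableType d')
    (R : realType) (P : probability Omega R) (X : nat -> Omega -> T) i j (A B : set T) :
  mutually_independent P X -> i != j -> measurable A -> measurable B ->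
  P (X i @^-1` A `&` X j @^-1` B) = (P (X i @^-1` A) * P (X j @^-1` B))%E.
Proof.
move=> indep ij mA mB.
have := indep (i |` [fset j])%fset (fun l => if l == i then A else B).
rewrite set_fsetU1 set_fset1 bigcap_setU1 bigcap_set1 big_fsetU1 ?in_fset1 //=.
rewrite big_seq_fset1 eqxx eq_sym (negPf ij); apply.
by move=> l; case: ifP.
Qed.

Section sample_mean.
Context d d' (Omega : measurableType d) (T : measurableType d') (R : realType).
Variables (P : probability Omega R) (Q : probability T R) (X : nat -> {RV P >-> T}).
Hypothesis X_distr : forall i A, measurable A -> distribution P (X i) A = Q A.
Hypothesis X_pair : forall i j A B, i != j -> measurable A -> measurable B ->
  P (X i @^-1` A `&` X j @^-1` B) = (Q A * Q B)%E.

(** The one-sided law for f and for 1 - f gives both bounds. *)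
Lemma sample_mean_bounded (f : T -> R) : measurable_fun setT f -> (forall x, 0 <= f x <= 1) ->
  {ae P, forall w, forall e, 0 < e -> \forall n \near \oo,
    n%:R * (Rintegral Q setT f - e) <= \sum_(i < n) f (X i w) <= n%:R * (Rintegral Q setT f + e)}.
Proof.
move=> mf f01; set m := Rintegral Q setT f.
have f0 x : 0 <= f x by case/andP: (f01 x).
have f1 x : 0 <= 1 - f x by rewrite subr_ge0; case/andP: (f01 x).
have fi : Q.-integrable setT (EFin \o f).
  by apply: (@integrable_bounded _ _ _ Q _ 1) => // x; rewrite ger0_norm //; case/andP: (f01 x).
have i1 : Q.-integrable setT (EFin \o (cst 1 : T -> R)).
  by apply: (@integrable_bounded _ _ _ Q _ 1) => // x; rewrite normr1.
have fm : (\int[Q]_x (f x)%:E)%E = m%:E.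
  by rewrite /m /Rintegral fineK //; exact: integrable_fin_num.
have gm : (\int[Q]_x (1 - f x)%:E)%E = (1 - m)%:E.
  under eq_integral do rewrite EFinB.
  by rewrite integralB // fm integral_cst //= mul1e probability_setT.
have mg : measurable_fun setT (fun x => 1 - f x) by exact: measurable_funB.
have ae1 := sample_mean_limsup X_distr X_pair mf f0 fm.
have ae2 := sample_mean_limsup X_distr X_pair mg f1 gm.
apply: filterS (filterI ae1 ae2) => w [up low] e e0.
apply: filterS (filterI (up e e0) (low e e0)) => n [-> +]; rewrite andbT.
by rewrite sumrB sumr_const card_ord; lra.
Qed.

End sample_mean.

Lemma sample_avg_cvg (R : realType) k (X : nat -> 'cV[R]_k) f m :
  (forall e, 0 < e -> \forall n \near \oo,
    n%:R * (m - e) <= \sum_(i < n) f (X i) <= n%:R * (m + e)) ->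
  sample_avg X f n @[n --> \oo] --> m.
Proof.
move=> fm; apply/cvgrPdist_le => e e0.
apply: filterS (filterI (nbhs_infty_gt 0) (fm e e0)) => n [n0 /andP[h1 h2]].
have n0' : 0 < n%:R :> R by rewrite ltr0n.
rewrite distrC ler_distl /sample_avg.
by rewrite ler_pdivlMl // ler_pdivrMl // h1 h2.
Qed.

(* If phi has mass one, it equals 1 almost everywhere and is replaced by 1, so that the whole
   sample can be taken as a competitor. *)
Lemma competitor_weight (R : realType) k (gamma : R) (P0 : probability 'cV[R]_k R) phi :
  0 < gamma -> mcd_class P0 gamma phi -> pd (mcd_cov P0 phi) ->
  let t := mahalanobis (invmx (mcd_cov P0 phi)) (mcd_loc P0 phi) in
  let beta := Rintegral P0 setT phi in
  exists psi : 'cV[R]_k -> R, [/\ measurable_fun setT psi, forall x, 0 <= psi x <= 1,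
    Rintegral P0 setT psi = beta,
    (\int[P0]_x (quadratic t x * psi x)%:E)%E = (beta * k%:R)%:E &
    beta = 1 /\ (forall x, psi x = 1) \/
    exists2 s : R, 0 <= s & (beta%:E < P0 [set x | (quadratic t x <= s ^+ 2)%R])%E].
Proof.
move=> gamma0 cphi Cp t beta; have [mphi phi01 _ _] := cphi.
have [Ms M0] := pd_psd (pd_invmx Cp).
have t0 x : 0 <= quadratic t x by rewrite quadratic_mahalanobis.
have mt : measurable_fun setT (quadratic t) := measurable_quadratic t.
have iphi := mcd_class_integrable cphi.
have beta0 : 0 < beta := lt_le_trans gamma0 (mcd_class_mass cphi).
have itphi := mcd_class_integrable_quadratic cphi t.
(* The phi-weighted mean of t is tr (C^-1 C) = k, as t is centred at the location of phi. *)
have tphi : (\int[P0]_x (quadratic t x * phi x)%:E)%E = (beta * k%:R)%:E.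
  have := moments_mahalanobis (mcd_loc P0 phi) (mcd_class_moments gamma0 cphi) Ms.
  rewrite subrr quad_form0 addr0 mulVmx ?pd_unit // mxtrace1 -/t -/beta => <-.
  rewrite mulVKf ?gt_eqF // /Rintegral fineK //; exact: integrable_fin_num itphi.
have i1 : P0.-integrable setT (EFin \o (cst 1 : 'cV[R]_k -> R)).
  by apply: (@integrable_bounded _ _ _ P0 _ 1) => // x; rewrite normr1.
have E1 : Rintegral P0 setT (cst 1 : 'cV[R]_k -> R) = 1.
  by rewrite Rintegral_cst //= mul1r probability_setT.
have beta1 : beta <= 1.
  by rewrite -E1; apply: le_Rintegral => // x _; case/andP: (phi01 x).
(* If beta < 1, a large enough ellipsoid has mass above beta. *)
have [beta_1|beta_lt1] := leP 1 beta; last first.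
  exists phi; split=> //; right.
  have e0 : 0 < 1 - beta by rewrite subr_gt0.
  have [M PM] := tail_small P0 mt e0.
  exists (Num.sqrt M%:R); first exact: sqrtr_ge0.
  rewrite sqr_sqrtr //; have mM := measurable_level_ge M%:R mt.
  apply: (@lt_le_trans _ _ (P0 (~` [set x | (M%:R <= quadratic t x)%R]))).
    rewrite probability_setC //; move: PM.
    have /fineK <- : P0 [set x | (M%:R <= quadratic t x)%R] \is a fin_num.
      by apply: fin_num_measure.
    by rewrite -EFinB !lte_fin; lra.
  apply: le_measure; rewrite ?inE.
  - exact: measurableC.
  - exact: measurable_level_le.
  by move=> x /= /negP; rewrite -ltNge => /ltW.
have {beta_1}betaE : beta = 1 by apply/eqP; rewrite eq_le beta1.
exists (cst 1); split=> //.
- by move=> x; rewrite ler01 lexx.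
- by rewrite E1 betaE.
- rewrite -tphi; apply: ge0_ae_eq_integral => //.
  + by apply/measurable_EFinP; apply: measurable_funM.
  + by apply/measurable_EFinP; apply: measurable_funM.
  + by move=> x _; rewrite lee_fin mulr1.
  + by move=> x _; rewrite lee_fin mulr_ge0 //; case/andP: (phi01 x).
  have m1 : measurable_fun setT (fun x => (1 - phi x)%:E).
    by apply/measurable_EFinP; exact: measurable_funB.
  have : (\int[P0]_x `|(1 - phi x)%:E|)%E = 0.
    under eq_integral => x _.
      rewrite gee0_abs; last by rewrite lee_fin subr_ge0; case/andP: (phi01 x).
      rewrite EFinB; over.
    rewrite integralB //= integral_cst //= mul1e probability_setT.
    rewrite -[X in (_ - X)%E]fineK; last exact: integrable_fin_num iphi.
    by rewrite -[fine _]/beta betaE subee.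
  move/(ae_eq_integral_abs P0 measurableT m1); apply: filterS => x /(_ I) /= [].
  by move=> h _; rewrite (_ : phi x = 1) //; lra.
by left; split.
Qed.

Theorem theorem4p2 (R : realType) (k : nat) (hk : (1 <= k)%N)
    (gamma : R) (hgamma : 0 < gamma <= 1)
    (P0 : probability 'cV[R]_k R)
    (hP0 : forall H : set 'cV[R]_k, hyperplane H -> (P0 H < gamma%:E)%E)
    (huniq : mcd_uniquely_defined P0 gamma)
    (phi0 : 'cV[R]_k -> R) (hphi0 : mcd_minimizer P0 gamma phi0)
    (d : measure_display) (Omega : measurableType d) (P : probability Omega R)
    (X : nat -> {RV P >-> 'cV[R]_k})
    (hdistr : forall (i : nat) (A : set 'cV[R]_k),
      measurable A -> distribution P (X i) A = P0 A)
    (hindep : mutually_independent P (fun i : nat => X i : Omega -> 'cV[R]_k))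
    (S : forall n : nat, Omega -> {set 'I_n})
    (hS : forall (n : nat) (w : Omega), (1 <= n)%N ->
      minimizing_subsample (fun i : nat => X i w) gamma (S n w)) :
  {ae P, forall w : Omega,
    (mean_hat (fun i : nat => X i w) (S n w),
     cov_hat (fun i : nat => X i w) (S n w)) @[n --> \oo]
    --> (mcd_loc P0 phi0, mcd_cov P0 phi0)}
  /\
  ((forall eps : R, 0 < eps ->
      (gamma%:E < P0 (ellipsoid (mcd_loc P0 phi0) (mcd_cov P0 phi0)
                        (mcd_functional_radius P0 gamma phi0 + eps)))%E) ->
   {ae P, forall w : Omega,
     radius_hat (fun i : nat => X i w) gamma (S n w) @[n --> \oo]
     --> mcd_functional_radius P0 gamma phi0}).
Proof.
have gamma0 : 0 < gamma by case/andP: hgamma.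
have cphi : mcd_class P0 gamma phi0 by case: hphi0.
have Cp := mcd_cov_pd hgamma hP0 cphi.
have unique TC : mcd_functional P0 gamma TC -> TC = (mcd_loc P0 phi0, mcd_cov P0 phi0).
  have [TC0 [_ TC0E]] := huniq => /TC0E <-; apply: TC0E.
  by exists phi0.
have X_pair i j (A B : set 'cV[R]_k) : i != j -> measurable A -> measurable B ->
    P (X i @^-1` A `&` X j @^-1` B) = (P0 A * P0 B)%E.
  move=> ij mA mB; have := mutually_independent_pair hindep ij mA mB.
  by rewrite -[P (X i @^-1` A)]/(distribution P (X i) A) hdistr //
    -[P (X j @^-1` B)]/(distribution P (X j) B) hdistr.
have [psi [mpsi psi01 psiE tpsiE bulk]] := competitor_weight gamma0 cphi Cp.
set t := mahalanobis _ _ in tpsiE bulk; set beta := Rintegral P0 setT phi0 in psiE tpsiE bulk.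
have [Ms M0] := pd_psd (pd_invmx Cp).
have t0 x : 0 <= quadratic t x by rewrite quadratic_mahalanobis.
have ae_rat : {ae P, forall w, forall u : 'M[rat]_k * 'cV[rat]_k * rat,
    sample_avg (X^~ w) (clamp_quadratic (rat_param R u)) n @[n --> \oo] -->
    Rintegral P0 setT (clamp_quadratic (rat_param R u))}.
  apply: ae_forall_countable => u.
  apply: filterS (sample_mean_bounded hdistr X_pair
    (measurable_clamp_quadratic (rat_param R u)) (fun x => clamp01 _)) => w.
  exact: sample_avg_cvg.
have ae_psi := sample_mean_bounded hdistr X_pair mpsi psi01.
have tpsi0 x : 0 <= quadratic t x * psi x by rewrite mulr_ge0 //; case/andP: (psi01 x).
have mtpsi : measurable_fun setT (fun x => quadratic t x * psi x).
  by apply: measurable_funM => //; exact: measurable_quadratic.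
have ae_tpsi := sample_mean_limsup hdistr X_pair mtpsi tpsi0 tpsiE.
pose good w := forall n : nat, (0 < n)%N -> minimizing_subsample (X^~ w) gamma (S n w).
(* S n is an arbitrary selection, so the null set is chosen from the laws for X alone; the
   determinant bound then holds for any choice of minimizing subsamples. *)
have ae_all : {ae P, forall w,
    (forall t0 e, 0 < e -> \forall n \near \oo & t \near t0,
      `|sample_avg (X^~ w) (clamp_quadratic t) n - Rintegral P0 setT (clamp_quadratic t0)| < e)
    /\ forall e, 0 < e < 1 -> \forall n \near \oo,
      \det (invmx (mcd_cov P0 phi0)) * (1 - k%:R * e) <= \det (invmx (cov_hat (X^~ w) (S n w)))}.
  apply: filterS (filterI ae_rat (filterI ae_psi ae_tpsi)) => w [rat_w [psi_w tpsi_w]].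
  have law := uniform_law rat_w; split=> //.
  apply: (det_cov_hat_liminf hk hgamma hP0 law (fun n => @hS n w) (pd_invmx Cp)
    (mcd_class_mass cphi) psi01 tpsi_w _ bulk).
  by move=> e /psi_w; apply: filterS => n; rewrite psiE => /andP[].
split=> [|radius_pos]; apply: filterS ae_all => w [law det_w].
  exact: (mcd_estimator_cvg hk hgamma hP0 law (fun n => @hS n w) hphi0 unique det_w).
exact: (mcd_radius_cvg hk hgamma hP0 law (fun n => @hS n w) hphi0 unique det_w radius_pos).
Qed.
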